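(* Under the standing assumptions of the context (truncated velocity set $S=[-1,-\delta)\cup(\delta,1]$, symmetric random ordinates, uniformly bounded rescaled weights $\alpha_\ell\le\bar\alpha$, continuous $\sigma_T,\sigma_S,q$, bounded Lipschitz inflow data), there exist $n_0>0$ and a constant $C>0$ independent of $n$ such that for all even $n=2m>n_0$, $$\mathbb{E}\,\|\phi^{\xi}-\phi\|\le C\, n^{-3/2}(\log n)^{1/2},\qquad \big\|\mathbb{E}\,\phi^{\xi}-\phi\big\|\le C\,\lambda\, n^{-3}\log n,$$ where $\|\cdot\|$ is the norm of $L^2(\sigma_T)$ and $\mathbb E$ is the expectation over the random ordinates.
   Context: Let $\Omega=[x_L,x_R]$ be a bounded interval. Let $\sigma_T,\sigma_S,q$ be continuous functions on $\Omega$ with $0<\sigma_S(x)<\sigma_T(x)$ for all $x\in\Omega$. Set $\lambda=\|\sigma_S/\sigma_T\|_\infty\in(0,1)$. $L^2(\sigma_T)$ denotes $L^2(\Omega)$ with inner product $\langle f,g\rangle=\int_{x_L}^{x_R} f g\,\sigma_T\,dx$. Truncated velocity set: fix $\delta\in(0,1)$, let $S=[-1,-\delta)\cup(\delta,1]$, $|S|=2(1-\delta)$, $\fint_S f\,d\mu=\frac1{|S|}\int_S f\,d\mu$. Inflow data: $\psi_L:(\delta,1]\to\mathbb R$ and $\psi_R:[-1,-\delta)\to\mathbb R$ are bounded and Lipschitz. Exact (truncated) problem: $\psi(x,\mu)$, $x\in\Omega$, $\mu\in S$, solves $\mu\partial_x\psi+\sigma_T\psi=\sigma_S\,\phi+q$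 with $\phi(x)=\fint_S\psi(x,\mu')\,d\mu'$, and $\psi(x_L,\mu)=\psi_L(\mu)$ for $\mu>0$, $\psi(x_R,\mu)=\psi_R(\mu)$ for $\mu<0$. Random ordinates: let $n=2m$. Partition $[-1,-\delta)$ into intervals $S_1,\dots,S_m$ and set $S_{n+1-\ell}=-S_\ell$ for $\ell=1,\dots,m$. For $\ell=1,\dots,m$ let $\mu_\ell$ be independent random variables, $\mu_\ell$ uniformly distributed on $S_\ell$, and set $\mu_{n+1-\ell}=-\mu_\ell$. Weights $\omega_\ell=|S_\ell|/|S|$, rescaled weights $\alpha_\ell=n\omega_\ell$, and it is assumed that $\alpha_\ell\le\bar\alpha$ for all $\ell$ and $n$, with $\bar\alpha$ independent of $n$. Random ordinate method (ROM) solution: $\psi_1,\dots,\psi_n$ on $\Omega$ solve $\mu_\ell\psi_\ell'+\sigma_T\psi_\ell=\sigma_S\,\phi^\xi+q$, $\ell=1,\dots,n$, where $\phi^\xi=\sum_{\ell'=1}^n\omega_{\ell'}\psi_{\ell'}$, with $\psi_\ell(x_L)=\psi_L(\mu_\ell)$ if $\mu_\ell>0$ and $\psi_\ell(x_R)=\psi_R(\mu_\ell)$ if $\mu_\ell<0$. *)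

(* Defs.v *)
From Stdlib Require Import Reals Lra.
From Coquelicot Require Import Coquelicot.
Open Scope R_scope.

Definition Sset (delta mu : R) : Prop :=
  (-1 <= mu < -delta) \/ (delta < mu <= 1).

Definition fint_S (delta : R) (f : R -> R) : R :=
  (RInt f (-1) (-delta) + RInt f delta 1) / (2 * (1 - delta)).

Definition cont_on (a b : R) (f : R -> R) : Prop :=
  forall x, a <= x <= b ->
    filterlim f (within (fun y => a <= y <= b) (locally x)) (locally (f x)).

Definition bdd_lip_on (D : R -> Prop) (f : R -> R) : Prop :=
  (exists M, forall u, D u -> Rabs (f u) <= M) /\
  (exists L, forall u v, D u -> D v -> Rabs (f u - f v) <= L * Rabs (u - v)).

Definition L2norm (sigT : R -> R) (xL xR : R) (f : R -> R) : R :=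
  sqrt (RInt (fun x => (f x) ^ 2 * sigT x) xL xR).

Definition exact_solution (xL xR delta : R) (sigT sigS q psiL psiR : R -> R)
    (psi : R -> R -> R) : Prop :=
  (forall x mu, xL <= x <= xR -> Sset delta mu ->
     filterlim (fun p : R * R => psi (fst p) (snd p))
       (within (fun p : R * R => xL <= fst p <= xR /\ Sset delta (snd p))
          (locally (x, mu)))
       (locally (psi x mu))) /\
  (forall x mu, xL < x < xR -> Sset delta mu ->
     exists d, is_derive (fun y => psi y mu) x d /\
       mu * d + sigT x * psi x mu
         = sigS x * fint_S delta (fun nu => psi x nu) + q x) /\
  (forall mu, delta < mu <= 1 -> psi xL mu = psiL mu) /\
  (forall mu, -1 <= mu < -delta -> psi xR mu = psiR mu).

Definition phi_exact (delta : R) (psi : R -> R -> R) (x : R) : R :=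
  fint_S delta (fun nu => psi x nu).

(* The partition of [-1,-delta) into m intervals S_l = [t (l-1), t l), l = 1..m. *)
Definition grid (delta : R) (m : nat) (t : nat -> R) : Prop :=
  t O = -1 /\ t m = - delta /\ (forall i, (i < m)%nat -> t i < t (S i)).

(* Weight omega_l = |S_l|/|S| for l = 1..n (n = 2m), with S_{n+1-l} = -S_l. *)
Definition omega (delta : R) (m : nat) (t : nat -> R) (l : nat) : R :=
  if Nat.leb l m then (t l - t (pred l)) / (2 * (1 - delta))
  else (t (2 * m + 1 - l)%nat - t (pred (2 * m + 1 - l))) / (2 * (1 - delta)).

Definition ordinate (m : nat) (mu : nat -> R) (l : nat) : R :=
  if Nat.leb l m then mu l else - mu (2 * m + 1 - l)%nat.

Definition phi_rom (delta : R) (m : nat) (t : nat -> R)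
    (Psi : nat -> R -> R) (x : R) : R :=
  sum_n_m (fun l => omega delta m t l * Psi l x) 1 (2 * m).

Definition rom_solution (xL xR delta : R) (sigT sigS q psiL psiR : R -> R)
    (m : nat) (t : nat -> R) (mu : nat -> R) (Psi : nat -> R -> R) : Prop :=
  forall l, (1 <= l <= 2 * m)%nat ->
    cont_on xL xR (Psi l) /\
    (forall x, xL < x < xR ->
       exists d, is_derive (Psi l) x d /\
         ordinate m mu l * d + sigT x * Psi l x
           = sigS x * phi_rom delta m t Psi x + q x) /\
    (0 < ordinate m mu l -> Psi l xL = psiL (ordinate m mu l)) /\
    (ordinate m mu l < 0 -> Psi l xR = psiR (ordinate m mu l)).

Definition upd (mu : nat -> R) (j : nat) (y : R) : nat -> R :=
  fun i => if Nat.eqb i j then y else mu i.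

(* Expectation over independent mu_l ~ Uniform(S_l), l = 1..k, written as the
   iterated integral against the product of the uniform densities. *)
Fixpoint Eit (t : nat -> R) (k : nat) (F : (nat -> R) -> R) (mu : nat -> R) : R :=
  match k with
  | O => F mu
  | S k' => RInt (fun y => Eit t k' F (upd mu (S k') y)) (t k') (t (S k'))
            / (t (S k') - t k')
  end.

Definition Expect (t : nat -> R) (m : nat) (F : (nat -> R) -> R) : R :=
  Eit t m F (fun _ => 0).

(* Main.v *)
Require Import Defs.
From Stdlib Require Import Reals Lra Lia.
From Coquelicot Require Import Coquelicot.
Open Scope R_scope.

(** Let [Z] be the error of the random quadrature applied to the exact solution.
    The error [e] of the scalar flux solves [e = K e + Z], where [K] is the
    integral operator obtained by averaging the transport kernels
    [z exp (- s z)], [z = 1 / |mu_l|], over the random ordinates.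

    The energy identity of the transport equation shows that [K] is a
    contraction of L^2(sigma_T), hence [|e| <= C |Z|].  Since [delta > 0], the
    exact solution is Lipschitz in the velocity; [Z] is thus a sum of [m]
    independent centered terms of size O(n^-2), and [E |Z|^2 = O(n^-3)].

    Taking expectations, [E e = (E K) (E e) + E ((K - E K) e)].  The operator
    [E K] is a contraction of the supremum norm, and the kernel of [K - E K] is
    again a sum of [m] independent centered terms of size O(n^-2), so that
    [2 |x y| <= x^2 + y^2] bounds the last term by O(n^-3).

    Every function of the ordinates that occurs is bounded and Lipschitz on the
    open box of admissible ordinates; this provides all the integrability that
    the iterated Riemann integrals require, including at the end point
    [mu_m = - delta], where the inflow data are not controlled. *)

(** * Riemann integrals and continuity on an interval *)

(** Three obstacles shape the argument. The velocity regularity of [psi] cannot be read off its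
    equation: the source contains the scalar flux, an integral about which nothing is known yet.
    Subtracting [psi x 1 / mu] cancels the flux and leaves an explicit formula. Next, [Psi] is an
    arbitrary family of solutions; its dependence on the ordinates is controlled only because the
    error equation, being contractive, is a quantitative uniqueness statement. Finally [sigT] and
    [sigS] are merely continuous, so they stay outside, as weights in front of Lipschitz integrands.

    The energy estimate applies to a kernel produced by actual ordinates. Of the averaged kernel
    only positivity and total mass are used, which is exactly what a contraction in the supremum
    norm takes.

    The ordinates [l] and [n + 1 - l] are dependent; folding each pair into one function of [mu_l]
    leaves [m] independent terms. The bounds come out as pure powers of [n]; the logarithms enter
    through [1 <= ln n], and the factor [lam] through a constant that may depend on [lam]. *)

Lemma RInt_add (f g : R -> R) (a b : R) :
  ex_RInt f a b -> ex_RInt g a b ->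
  RInt (fun x => f x + g x) a b = RInt f a b + RInt g a b.
Proof. intros hf hg. exact (RInt_plus f g a b hf hg). Qed.

Lemma RInt_sub (f g : R -> R) (a b : R) :
  ex_RInt f a b -> ex_RInt g a b ->
  RInt (fun x => f x - g x) a b = RInt f a b - RInt g a b.
Proof. intros hf hg. exact (RInt_minus f g a b hf hg). Qed.

Lemma RInt_mull (k : R) (f : R -> R) (a b : R) :
  ex_RInt f a b -> RInt (fun x => k * f x) a b = k * RInt f a b.
Proof. intros hf. exact (RInt_scal f a b k hf). Qed.

Lemma RInt_cst (a b c : R) : RInt (fun _ => c) a b = (b - a) * c.
Proof. exact (RInt_const a b c). Qed.

Lemma ex_RInt_add (f g : R -> R) (a b : R) :
  ex_RInt f a b -> ex_RInt g a b -> ex_RInt (fun x => f x + g x) a b.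
Proof. intros hf hg. exact (ex_RInt_plus f g a b hf hg). Qed.

Lemma ex_RInt_sub (f g : R -> R) (a b : R) :
  ex_RInt f a b -> ex_RInt g a b -> ex_RInt (fun x => f x - g x) a b.
Proof. intros hf hg. exact (ex_RInt_minus f g a b hf hg). Qed.

Lemma ex_RInt_mull (k : R) (f : R -> R) (a b : R) :
  ex_RInt f a b -> ex_RInt (fun x => k * f x) a b.
Proof. intros hf. exact (ex_RInt_scal f a b k hf). Qed.

Lemma RInt_split (f : R -> R) (a b c : R) :
  ex_RInt f a b -> ex_RInt f b c -> RInt f a b + RInt f b c = RInt f a c.
Proof. exact (RInt_Chasles f a b c). Qed.

Lemma RInt_eq (f g : R -> R) (a b : R) : a <= b ->
  (forall x, a < x < b -> f x = g x) -> RInt f a b = RInt g a b.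
Proof.
  intros h e. apply RInt_ext. rewrite Rmin_left, Rmax_right by lra. exact e.
Qed.

Lemma RInt_ext_all (f g : R -> R) (a b : R) :
  (forall x, f x = g x) -> RInt f a b = RInt g a b.
Proof. intros e. apply RInt_ext. auto. Qed.

Lemma ex_RInt_eq (f g : R -> R) (a b : R) : a <= b ->
  (forall x, a < x < b -> f x = g x) -> ex_RInt f a b -> ex_RInt g a b.
Proof.
  intros h e. apply ex_RInt_ext. rewrite Rmin_left, Rmax_right by lra. exact e.
Qed.

Lemma RInt_Rabs_le (f : R -> R) (a b M : R) :
  a <= b -> ex_RInt f a b -> (forall x, a < x < b -> Rabs (f x) <= M) ->
  Rabs (RInt f a b) <= (b - a) * M.
Proof.
  intros h hf hM.
  assert (h1 : RInt f a b <= RInt (fun _ => M) a b).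
  { apply RInt_le; auto using ex_RInt_const.
    intros x hx. specialize (hM x hx). revert hM. unfold Rabs; destruct (Rcase_abs _); lra. }
  assert (h2 : RInt (fun _ => - M) a b <= RInt f a b).
  { apply RInt_le; auto using ex_RInt_const.
    intros x hx. specialize (hM x hx). revert hM. unfold Rabs; destruct (Rcase_abs _); lra. }
  rewrite RInt_cst in h1, h2. apply Rabs_le. lra.
Qed.

Lemma ex_RInt_cont (f : R -> R) (a b : R) :
  (forall x, continuous f x) -> ex_RInt f a b.
Proof. intros h. apply (ex_RInt_continuous f). auto. Qed.

Lemma continuous_mul (f g : R -> R) (x : R) :
  continuous f x -> continuous g x -> continuous (fun y => f y * g y) x.
Proof. exact (continuous_mult f g x). Qed.

Lemma continuous_add (f g : R -> R) (x : R) :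
  continuous f x -> continuous g x -> continuous (fun y => f y + g y) x.
Proof. exact (continuous_plus f g x). Qed.

Lemma continuous_sub (f g : R -> R) (x : R) :
  continuous f x -> continuous g x -> continuous (fun y => f y - g y) x.
Proof. exact (continuous_minus f g x). Qed.

Lemma continuous_of_lipschitz (f : R -> R) (L : R) :
  (forall x y, Rabs (f x - f y) <= L * Rabs (x - y)) -> forall x, continuous f x.
Proof.
  intros h x. apply continuity_pt_filterlim. intros eps he.
  exists (eps / (Rabs L + 1)). pose proof (Rabs_pos L). split.
  { apply Rdiv_lt_0_compat; lra. }
  intros y [_ hy]. unfold dist in *; simpl in *. unfold R_dist in *.
  specialize (h y x). pose proof (Rle_abs L).
  apply Rle_lt_trans with (1 := h).
  apply Rle_lt_trans with (Rabs L * Rabs (y - x)).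
  { apply Rmult_le_compat_r; auto using Rabs_pos. }
  apply Rle_lt_trans with (Rabs L * (eps / (Rabs L + 1))).
  { apply Rmult_le_compat_l; lra. }
  replace eps with ((Rabs L + 1) * (eps / (Rabs L + 1))) at 2 by (field; lra).
  apply Rmult_lt_compat_r; [apply Rdiv_lt_0_compat|]; lra.
Qed.

(** The projection of the line onto [[a,b]]. Composition with it turns continuity relative to
    [[a,b]] into continuity on all of [R], the form in which integrability and the fundamental
    theorem of calculus are applied. *)
Definition clamp (a b x : R) : R := Rmax a (Rmin x b).

Lemma clamp_in (a b x : R) : a <= b -> a <= clamp a b x <= b.
Proof.
  intros h. unfold clamp, Rmax, Rmin. repeat destruct (Rle_dec _ _); lra.
Qed.

Lemma clamp_id (a b x : R) : a <= x <= b -> clamp a b x = x.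
Proof.
  intros h. unfold clamp, Rmax, Rmin. repeat destruct (Rle_dec _ _); lra.
Qed.

Lemma clamp_lip (a b x y : R) : Rabs (clamp a b x - clamp a b y) <= Rabs (x - y).
Proof.
  unfold clamp, Rmax, Rmin, Rabs.
  repeat destruct (Rle_dec _ _); repeat destruct (Rcase_abs _); lra.
Qed.

Lemma continuous_clamp (a b : R) (f : R -> R) : a <= b ->
  cont_on a b f -> forall x, continuous (fun y => f (clamp a b y)) x.
Proof.
  intros hab hf x. specialize (hf (clamp a b x) (clamp_in a b x hab)).
  unfold continuous.
  eapply filterlim_comp; [| exact hf].
  intros P hP. unfold within in hP. unfold filtermap.
  assert (hc : continuous (clamp a b) x).
  { apply (continuous_of_lipschitz _ 1). intros u v. rewrite Rmult_1_l. apply clamp_lip. }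
  specialize (hc _ hP). unfold filtermap in hc.
  revert hc. apply filter_imp. intros y hy. apply hy. apply clamp_in; auto.
Qed.

Lemma cont_on_of_continuous (a b : R) (f : R -> R) :
  (forall x, continuous f x) -> cont_on a b f.
Proof.
  intros h x _ P hP. specialize (h x P hP). unfold filtermap, within in *.
  revert h. apply filter_imp. auto.
Qed.

Lemma cont_on_eq (a b : R) (f g : R -> R) :
  (forall x, a <= x <= b -> f x = g x) -> cont_on a b f -> cont_on a b g.
Proof.
  intros e h x hx P hP. rewrite <- e in hP by auto.
  specialize (h x hx P hP). unfold filtermap, within in *.
  revert h. apply filter_imp. intros y hy hy'. rewrite <- e by auto. auto.
Qed.

Lemma cont_on_add (a b : R) (f g : R -> R) : a <= b ->
  cont_on a b f -> cont_on a b g -> cont_on a b (fun x => f x + g x).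
Proof.
  intros hab hf hg.
  apply cont_on_eq with (fun x => f (clamp a b x) + g (clamp a b x)).
  { intros x hx. rewrite clamp_id; auto. }
  apply cont_on_of_continuous. intros x. apply continuous_add; apply continuous_clamp; auto.
Qed.

Lemma cont_on_mull (a b k : R) (f : R -> R) : a <= b ->
  cont_on a b f -> cont_on a b (fun x => k * f x).
Proof.
  intros hab hf.
  apply cont_on_eq with (fun x => k * f (clamp a b x)).
  { intros x hx. rewrite clamp_id; auto. }
  apply cont_on_of_continuous. intros x.
  apply continuous_mul; [apply continuous_const | apply continuous_clamp; auto].
Qed.

Lemma cont_on_sub (a b : R) (f g : R -> R) : a <= b ->
  cont_on a b f -> cont_on a b g -> cont_on a b (fun x => f x - g x).
Proof.
  intros hab hf hg.
  apply cont_on_eq with (fun x => f x + (-1) * g x).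
  { intros; ring. }
  apply cont_on_add; auto. apply cont_on_mull; auto.
Qed.

Lemma cont_on_of_lipschitz (a b L : R) (f : R -> R) : a <= b -> 0 <= L ->
  (forall x y, a <= x <= b -> a <= y <= b -> Rabs (f x - f y) <= L * Rabs (x - y)) ->
  cont_on a b f.
Proof.
  intros hab hL h.
  apply cont_on_eq with (fun x => f (clamp a b x)).
  { intros x hx. rewrite clamp_id; auto. }
  apply cont_on_of_continuous.
  apply (continuous_of_lipschitz _ L). intros x y.
  eapply Rle_trans; [apply h; apply clamp_in; auto|].
  apply Rmult_le_compat_l; auto. apply clamp_lip.
Qed.

Lemma ex_RInt_cont_on (a b c d : R) (f : R -> R) :
  a <= c -> c <= d -> d <= b -> cont_on a b f -> ex_RInt f c d.
Proof.
  intros h1 h2 h3 hf.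
  apply ex_RInt_eq with (fun x => f (clamp a b x)); auto.
  { intros x hx. rewrite clamp_id; auto; lra. }
  apply ex_RInt_cont. apply continuous_clamp; auto; lra.
Qed.

Lemma cont_on_bounded (a b : R) (f : R -> R) : a <= b -> cont_on a b f ->
  exists M, 0 <= M /\ forall x, a <= x <= b -> Rabs (f x) <= M.
Proof.
  intros hab hf.
  destruct (continuity_ab_maj (fun x => Rabs (f (clamp a b x))) a b hab) as [c [hc hc']].
  { intros c _. apply continuity_pt_filterlim.
    apply (continuous_comp (fun x => f (clamp a b x)) Rabs).
    - apply continuous_clamp; auto.
    - apply continuous_Rabs. }
  exists (Rabs (f (clamp a b c))). split; [apply Rabs_pos|].
  intros x hx. specialize (hc x hx). simpl in hc. rewrite (clamp_id a b x) in hc; auto.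
Qed.

(* McShane's extension [y |-> sup_z (f z - L |y - z|)]. *)
Lemma lipschitz_extension (D : R -> Prop) (f : R -> R) (L : R) :
  0 <= L -> (exists z, D z) ->
  (forall x y, D x -> D y -> Rabs (f x - f y) <= L * Rabs (x - y)) ->
  exists g : R -> R, (forall x, D x -> g x = f x) /\
    (forall x y, Rabs (g x - g y) <= L * Rabs (x - y)).
Proof.
  intros hL [z0 hz0] hf.
  assert (tri : forall x y z, Rabs (x - z) <= Rabs (x - y) + Rabs (y - z)).
  { intros x y z. replace (x - z) with ((x - y) + (y - z)) by ring. apply Rabs_triang. }
  set (E := fun y r => exists z, D z /\ r = f z - L * Rabs (y - z)).
  assert (hE : forall y, { s | is_lub (E y) s }).
  { intros y. apply completeness.
    - exists (f z0 + L * Rabs (y - z0)). intros r [z [hz ->]].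
      pose proof (hf z z0 hz hz0) as h. apply Rabs_le_between in h.
      pose proof (tri z y z0) as h'. rewrite (Rabs_minus_sym z y) in h'.
      pose proof (Rmult_le_compat_l L _ _ hL h'). lra.
    - eexists. exists z0. split; eauto. }
  exists (fun y => proj1_sig (hE y)). split.
  - intros x hx. destruct (hE x) as [s [hs1 hs2]]; simpl. apply Rle_antisym.
    + apply hs2. intros r [z [hz ->]]. pose proof (hf z x hz hx) as h.
      apply Rabs_le_between in h. rewrite (Rabs_minus_sym z x) in h. lra.
    + apply hs1. exists x. split; auto. rewrite Rminus_diag, Rabs_R0. ring.
  - assert (half : forall x y, proj1_sig (hE x) <= proj1_sig (hE y) + L * Rabs (x - y)).
    { intros x y. destruct (hE x) as [s [hs1 hs2]], (hE y) as [u [hu1 hu2]]; simpl.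
      apply hs2. intros r [z [hz ->]].
      assert (hu : f z - L * Rabs (y - z) <= u) by (apply hu1; exists z; auto).
      pose proof (tri y x z) as h'. rewrite (Rabs_minus_sym y x) in h'.
      pose proof (Rmult_le_compat_l L _ _ hL h'). lra. }
    intros x y. apply Rabs_le. pose proof (half x y). pose proof (half y x) as h.
    rewrite (Rabs_minus_sym y x) in h. lra.
Qed.

(** Only the open interval is controlled, as on the open box of ordinates. A Lipschitz extension to
    the line is continuous, hence integrable, and agrees with [f] except possibly at the end
    points. *)
Lemma ex_RInt_lipschitz (a b L : R) (f : R -> R) : a <= b -> 0 <= L ->
  (forall x y, a < x < b -> a < y < b -> Rabs (f x - f y) <= L * Rabs (x - y)) ->
  ex_RInt f a b.
Proof.
  intros hab hL hf. destruct (Req_dec a b) as [<-|hne].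
  { apply ex_RInt_point. }
  destruct (lipschitz_extension (fun x => a < x < b) f L hL) as [g [hg1 hg2]]; auto.
  { exists ((a + b) / 2). lra. }
  apply ex_RInt_eq with g; auto.
  apply ex_RInt_cont. eapply continuous_of_lipschitz; eauto.
Qed.

Lemma locally_in (a b x : R) : a < x < b -> locally x (fun u => a < u < b).
Proof.
  intros h.
  apply (open_and (fun u => a < u) (fun u => u < b)); [apply open_gt | apply open_lt | lra].
Qed.

Lemma mvt_Rabs (a b M : R) (f : R -> R) : a <= b -> cont_on a b f ->
  (forall x, a < x < b -> exists d, is_derive f x d /\ Rabs d <= M) ->
  forall x y, a <= x <= b -> a <= y <= b -> Rabs (f x - f y) <= M * Rabs (x - y).
Proof.
  intros hab hc hd.
  assert (lt : forall x y, a <= x -> x < y -> y <= b -> Rabs (f y - f x) <= M * Rabs (y - x)).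
  { intros x y hx hxy hy.
    (* [MVT_gen] only localises the point in the closed interval, hence the
       truncation of the derivative to the open one. *)
    set (D := fun z => if Rlt_dec x z then if Rlt_dec z y then Derive f z
                       else Derive f ((x + y) / 2) else Derive f ((x + y) / 2)).
    assert (hD : forall z, a < z < b -> Rabs (Derive f z) <= M).
    { intros z hz. destruct (hd z hz) as [d [hd1 hd2]].
      rewrite (is_derive_unique _ _ _ hd1). exact hd2. }
    destruct (MVT_gen (fun z => f (clamp a b z)) x y D) as [c [hc1 hc2]].
    - rewrite Rmin_left, Rmax_right by lra. intros z hz.
      destruct (hd z) as [d [hd1 _]]; [lra|].
      apply is_derive_ext_loc with f.
      + generalize (locally_in a b z ltac:(lra)). apply filter_imp.
        intros u hu. rewrite clamp_id; auto; lra.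
      + unfold D. destruct (Rlt_dec x z); [|lra]. destruct (Rlt_dec z y); [|lra].
        rewrite (is_derive_unique _ _ _ hd1). exact hd1.
    - intros z _. apply continuity_pt_filterlim. apply continuous_clamp; auto.
    - rewrite !clamp_id in hc2 by lra. rewrite hc2, Rabs_mult.
      apply Rmult_le_compat_r; [apply Rabs_pos|].
      unfold D. destruct (Rlt_dec x c); [destruct (Rlt_dec c y)|]; apply hD; lra. }
  intros x y hx hy. destruct (Rtotal_order x y) as [h|[h|h]].
  - rewrite (Rabs_minus_sym (f x)), (Rabs_minus_sym x). apply lt; lra.
  - rewrite h, !Rminus_diag, Rabs_R0. lra.
  - apply lt; lra.
Qed.

Lemma derive_0_const (a b : R) (f : R -> R) : a <= b -> cont_on a b f ->
  (forall x, a < x < b -> is_derive f x 0) ->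
  forall x y, a <= x <= b -> a <= y <= b -> f x = f y.
Proof.
  intros hab hc hd x y hx hy.
  assert (h : Rabs (f x - f y) <= 0 * Rabs (x - y)).
  { apply (mvt_Rabs a b); auto. intros z hz. exists 0. rewrite Rabs_R0. split; auto; lra. }
  rewrite Rmult_0_l in h. pose proof (Rabs_pos (f x - f y)).
  apply Rminus_diag_uniq. destruct (Req_dec (f x - f y) 0) as [|hn]; auto.
  pose proof (Rabs_pos_lt _ hn). lra.
Qed.

(** Difference quotients are at most [C |h|], so the derivative vanishes; composing with [clamp]
    makes this hold at the end points too. It serves to exchange expectation and integration without
    any measure theory. *)
Lemma quadratic_increments_const (a b C : R) (f : R -> R) : a <= b -> 0 <= C ->
  (forall x y, a <= x <= y -> y <= b -> Rabs (f y - f x) <= C * (y - x) ^ 2) ->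
  f b = f a.
Proof.
  intros hab hC hf.
  assert (h2 : forall x y, Rabs (f (clamp a b y) - f (clamp a b x)) <= C * (y - x) ^ 2).
  { intros x y.
    assert (hq : Rabs (f (clamp a b y) - f (clamp a b x))
                 <= C * (clamp a b y - clamp a b x) ^ 2).
    { pose proof (clamp_in a b x hab). pose proof (clamp_in a b y hab).
      destruct (Rle_dec (clamp a b x) (clamp a b y)).
      - apply hf; lra.
      - rewrite Rabs_minus_sym. replace ((clamp a b y - clamp a b x) ^ 2)
          with ((clamp a b x - clamp a b y) ^ 2) by ring. apply hf; lra. }
    apply Rle_trans with (1 := hq). apply Rmult_le_compat_l; auto.
    rewrite <- (pow2_abs (y - x)), <- (pow2_abs (clamp a b y - clamp a b x)).
    apply pow_incr. split; [apply Rabs_pos | apply clamp_lip]. }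
  assert (hd : forall x, is_derive (fun z => f (clamp a b z)) x 0).
  { intros x. apply is_derive_Reals. intros eps heps.
    assert (hp : 0 < eps / (C + 1)) by (apply Rdiv_lt_0_compat; lra).
    exists (mkposreal _ hp). intros h hne hlt. simpl in hlt. specialize (h2 x (x + h)).
    replace (x + h - x) with h in h2 by ring.
    rewrite Rminus_0_r. unfold Rdiv. rewrite Rabs_mult, Rabs_inv.
    pose proof (Rabs_pos_lt h hne) as hpos.
    rewrite <- (pow2_abs h) in h2.
    apply Rle_lt_trans with (C * Rabs h ^ 2 * / Rabs h).
    { apply Rmult_le_compat_r; auto. left. apply Rinv_0_lt_compat; auto. }
    replace (C * Rabs h ^ 2 * / Rabs h) with (C * Rabs h) by (field; lra).
    apply Rle_lt_trans with ((C + 1) * Rabs h).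
    { apply Rmult_le_compat_r; lra. }
    replace eps with ((C + 1) * (eps / (C + 1))) at 1 by (field; lra).
    apply Rmult_lt_compat_l; lra. }
  pose proof (derive_0_const a b (fun z => f (clamp a b z)) hab) as hcst. cbv beta in hcst.
  assert (hcl : f (clamp a b b) = f (clamp a b a)).
  { apply hcst; auto; try lra. apply cont_on_of_continuous. intros x.
    apply (ex_derive_continuous (fun z => f (clamp a b z))). exists 0. apply hd. }
  rewrite !clamp_id in hcl by lra. exact hcl.
Qed.

(** * Bounded Lipschitz functions *)

(** Summation over [1..n], the index range of the ordinates, which peels off its last term by
    computation. [sum_n_m_psum] links it to the sum in the definition of the scheme. *)
Fixpoint psum (f : nat -> R) (n : nat) : R :=
  match n with O => 0 | S k => psum f k + f (S k) end.

Lemma psum_eq (f g : nat -> R) (n : nat) :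
  (forall l, (1 <= l <= n)%nat -> f l = g l) -> psum f n = psum g n.
Proof.
  induction n as [|n IH]; intros h; simpl; auto. rewrite IH, h; auto; [lia|].
  intros l hl. apply h. lia.
Qed.

Lemma psum_tail_eq (f g : nat -> R) (k n : nat) : (k <= n)%nat ->
  (forall l, (k < l <= n)%nat -> f l = g l) -> psum f n - psum f k = psum g n - psum g k.
Proof.
  intros hk. induction hk as [|n hk IH]; intros h; [lra|]. simpl.
  rewrite (h (S n)) by lia. enough (psum f n - psum f k = psum g n - psum g k) by lra.
  apply IH. intros l hl. apply h. lia.
Qed.

Lemma psum_add (f g : nat -> R) (n : nat) :
  psum (fun l => f l + g l) n = psum f n + psum g n.
Proof. induction n; simpl; lra. Qed.

Lemma psum_sub (f g : nat -> R) (n : nat) :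
  psum (fun l => f l - g l) n = psum f n - psum g n.
Proof. induction n; simpl; lra. Qed.

Lemma psum_mull (c : R) (f : nat -> R) (n : nat) :
  psum (fun l => c * f l) n = c * psum f n.
Proof. induction n; simpl; [ring | rewrite IHn; ring]. Qed.

Lemma psum_mulr (c : R) (f : nat -> R) (n : nat) :
  psum (fun l => f l * c) n = psum f n * c.
Proof. induction n; simpl; [ring | rewrite IHn; ring]. Qed.

Lemma psum_le (f g : nat -> R) (n : nat) :
  (forall l, (1 <= l <= n)%nat -> f l <= g l) -> psum f n <= psum g n.
Proof.
  induction n as [|n IH]; intros h; simpl; [lra|].
  apply Rplus_le_compat; [apply IH; intros; apply h; lia | apply h; lia].
Qed.

Lemma RInt_psum (F : nat -> R -> R) (a b : R) (n : nat) :
  (forall l, (1 <= l <= n)%nat -> ex_RInt (F l) a b) ->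
  ex_RInt (fun x => psum (fun l => F l x) n) a b /\
  RInt (fun x => psum (fun l => F l x) n) a b = psum (fun l => RInt (F l) a b) n.
Proof.
  induction n as [|n IH]; intros h; simpl.
  { split; [apply ex_RInt_const | rewrite RInt_cst; ring]. }
  destruct IH as [IH1 IH2]; [intros; apply h; lia|]. split.
  - apply ex_RInt_add; auto. apply h. lia.
  - rewrite RInt_add, IH2; auto. apply h. lia.
Qed.

(* [d x y r] reads: the distance from [x] to [y] is at most [r].  A relation
   instead of a function also covers Lipschitz continuity in some of the
   coordinates, uniformly in the others. *)
Definition bdd_lip {X : Type} (D : X -> Prop) (d : X -> X -> R -> Prop) (f : X -> R) :=
  exists M L, 0 <= M /\ 0 <= L /\ (forall x, D x -> Rabs (f x) <= M) /\
    (forall x y r, D x -> D y -> 0 <= r -> d x y r -> Rabs (f x - f y) <= L * r).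

Section BddLip.
Context {X : Type} (D : X -> Prop) (d : X -> X -> R -> Prop).
Implicit Types f g : X -> R.

Lemma bdd_lip_eq f g : (forall x, D x -> f x = g x) -> bdd_lip D d f -> bdd_lip D d g.
Proof.
  intros e (M & L & hM & hL & h1 & h2). exists M, L. repeat split; auto.
  - intros x hx. rewrite <- e; auto.
  - intros x y r hx hy. rewrite <- !e; auto.
Qed.

Lemma bdd_lip_const c : bdd_lip D d (fun _ => c).
Proof.
  exists (Rabs c), 0. split; [apply Rabs_pos|]. repeat split; intros; try lra.
  rewrite Rminus_diag, Rabs_R0. lra.
Qed.

Lemma bdd_lip_add f g : bdd_lip D d f -> bdd_lip D d g -> bdd_lip D d (fun x => f x + g x).
Proof.
  intros (M & L & hM & hL & h1 & h2) (M' & L' & hM' & hL' & h1' & h2').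
  exists (M + M'), (L + L'). repeat split; try lra.
  - intros x hx. eapply Rle_trans; [apply Rabs_triang|]. specialize (h1 x hx).
    specialize (h1' x hx). lra.
  - intros x y r hx hy hr hd. specialize (h2 x y r hx hy hr hd).
    specialize (h2' x y r hx hy hr hd).
    replace (f x + g x - (f y + g y)) with ((f x - f y) + (g x - g y)) by ring.
    eapply Rle_trans; [apply Rabs_triang|]. lra.
Qed.

(** Closure under products is the reason why a bound is carried along with the Lipschitz
    constant. *)
Lemma bdd_lip_mul f g : bdd_lip D d f -> bdd_lip D d g -> bdd_lip D d (fun x => f x * g x).
Proof.
  intros (M & L & hM & hL & h1 & h2) (M' & L' & hM' & hL' & h1' & h2').
  exists (M * M'), (M * L' + L * M'). repeat split.
  - apply Rmult_le_pos; auto.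
  - apply Rplus_le_le_0_compat; apply Rmult_le_pos; auto.
  - intros x hx. rewrite Rabs_mult. apply Rmult_le_compat; auto using Rabs_pos.
  - intros x y r hx hy hr hd. specialize (h2 x y r hx hy hr hd).
    specialize (h2' x y r hx hy hr hd). specialize (h1 x hx). specialize (h1' y hy).
    replace (f x * g x - f y * g y) with (f x * (g x - g y) + (f x - f y) * g y) by ring.
    eapply Rle_trans; [apply Rabs_triang|]. rewrite !Rabs_mult.
    replace ((M * L' + L * M') * r) with (M * (L' * r) + (L * r) * M') by ring.
    apply Rplus_le_compat; apply Rmult_le_compat; auto using Rabs_pos.
Qed.

Lemma bdd_lip_mull c f : bdd_lip D d f -> bdd_lip D d (fun x => c * f x).
Proof. intros h. apply bdd_lip_mul; auto. apply bdd_lip_const. Qed.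

Lemma bdd_lip_opp f : bdd_lip D d f -> bdd_lip D d (fun x => - f x).
Proof.
  intros h. apply bdd_lip_eq with (fun x => (-1) * f x); [intros; ring|].
  apply bdd_lip_mull; auto.
Qed.

Lemma bdd_lip_sub f g : bdd_lip D d f -> bdd_lip D d g -> bdd_lip D d (fun x => f x - g x).
Proof. intros hf hg. apply bdd_lip_add; auto. apply bdd_lip_opp; auto. Qed.

Lemma bdd_lip_pow2 f : bdd_lip D d f -> bdd_lip D d (fun x => f x ^ 2).
Proof.
  intros hf. apply bdd_lip_eq with (fun x => f x * f x); [intros; ring|].
  apply bdd_lip_mul; auto.
Qed.

Lemma bdd_lip_psum (F : nat -> X -> R) n :
  (forall l, (1 <= l <= n)%nat -> bdd_lip D d (F l)) ->
  bdd_lip D d (fun x => psum (fun l => F l x) n).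
Proof.
  induction n as [|n IH]; intros h; simpl; [apply bdd_lip_const|].
  apply bdd_lip_add; [apply IH; intros; apply h; lia | apply h; lia].
Qed.

Lemma bdd_lip_postcomp (h : R -> R) (P : R -> Prop) C M f :
  0 <= C -> 0 <= M -> (forall x, D x -> P (f x)) -> (forall u, P u -> Rabs (h u) <= M) ->
  (forall u v, P u -> P v -> Rabs (h u - h v) <= C * Rabs (u - v)) ->
  bdd_lip D d f -> bdd_lip D d (fun x => h (f x)).
Proof.
  intros hC hM hP hb hh (M' & L & hM' & hL & h1 & h2).
  exists M, (C * L). repeat split; auto.
  - apply Rmult_le_pos; auto.
  - intros x y r hx hy hr hd. eapply Rle_trans; [apply hh; auto|].
    rewrite Rmult_assoc. apply Rmult_le_compat_l; auto.
Qed.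

(** On the negative half-line [exp] is bounded by 1 and 1-Lipschitz, the latter from
    [1 + x <= exp x] at [x = u - v]. *)
Lemma bdd_lip_exp f : (forall x, D x -> f x <= 0) -> bdd_lip D d f ->
  bdd_lip D d (fun x => exp (f x)).
Proof.
  intros hf. apply bdd_lip_postcomp with (fun u => u <= 0) 1 1; try lra; auto.
  - intros u hu. rewrite Rabs_pos_eq by (left; apply exp_pos).
    rewrite <- exp_0. destruct hu as [hu| ->]; [left; apply exp_increasing; auto | lra].
  - assert (half : forall u v, u <= v -> v <= 0 -> 0 <= exp v - exp u <= v - u).
    { intros u v huv hv. replace (exp u) with (exp v * exp (u - v)).
      2: { rewrite <- exp_plus. f_equal. ring. }
      pose proof (exp_pos v). pose proof (exp_pos (u - v)).
      assert (exp v <= 1).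
      { rewrite <- exp_0. destruct hv as [hv| ->]; [left; apply exp_increasing; auto | lra]. }
      assert (exp (u - v) <= 1).
      { rewrite <- exp_0. destruct huv as [h| ->];
          [left; apply exp_increasing; lra | rewrite Rminus_diag; lra]. }
      assert (1 + (u - v) <= exp (u - v)).
      { destruct (Req_dec (u - v) 0) as [e|e]; [rewrite e, exp_0; lra|].
        left. apply exp_ineq1. auto. }
      split; nra. }
    intros u v hu hv. rewrite Rmult_1_l. destruct (Rle_dec u v) as [h|h].
    + rewrite (Rabs_minus_sym (exp u)), (Rabs_minus_sym u).
      specialize (half u v h hv). rewrite !Rabs_pos_eq; lra.
    + specialize (half v u ltac:(lra) hu). rewrite !Rabs_pos_eq; lra.
Qed.

Lemma bdd_lip_inv c f : 0 < c -> (forall x, D x -> c <= f x) -> bdd_lip D d f ->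
  bdd_lip D d (fun x => / f x).
Proof.
  intros hc hf.
  assert (hc' : 0 < / c) by (apply Rinv_0_lt_compat; auto).
  apply bdd_lip_postcomp with (fun u => c <= u) (/ c * / c) (/ c); auto.
  - apply Rmult_le_pos; lra.
  - lra.
  - intros u hu. rewrite Rabs_pos_eq; [apply Rinv_le_contravar; lra|].
    left. apply Rinv_0_lt_compat. lra.
  - intros u v hu hv. replace (/ u - / v) with ((/ u * / v) * (v - u)) by (field; lra).
    rewrite Rabs_mult, (Rabs_minus_sym v u). apply Rmult_le_compat_r; [apply Rabs_pos|].
    assert (0 < / u <= / c) by (split; [apply Rinv_0_lt_compat | apply Rinv_le_contravar]; lra).
    assert (0 < / v <= / c) by (split; [apply Rinv_0_lt_compat | apply Rinv_le_contravar]; lra).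
    rewrite Rabs_pos_eq by nra. apply Rmult_le_compat; lra.
Qed.

End BddLip.

Lemma bdd_lip_comp {X Y : Type} (D : X -> Prop) (d : X -> X -> R -> Prop)
  (D' : Y -> Prop) (d' : Y -> Y -> R -> Prop) (g : Y -> X) (C : R) (f : X -> R) :
  0 <= C -> (forall y, D' y -> D (g y)) ->
  (forall y z r, D' y -> D' z -> 0 <= r -> d' y z r -> d (g y) (g z) (C * r)) ->
  bdd_lip D d f -> bdd_lip D' d' (fun y => f (g y)).
Proof.
  intros hC hD hd (M & L & hM & hL & h1 & h2). exists M, (L * C). repeat split; auto.
  - apply Rmult_le_pos; auto.
  - intros y z r hy hz hr hyz. rewrite Rmult_assoc. apply h2; auto.
    apply Rmult_le_pos; auto.
Qed.

Definition prod_dist {X : Type} (d : X -> X -> R -> Prop) (p p' : X * R) (r : R) : Prop :=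
  d (fst p) (fst p') r /\ Rabs (snd p - snd p') <= r.

(** * Integrals depending on a parameter *)

Section ParamIntegral.
Context {X : Type} (D : X -> Prop) (d : X -> X -> R -> Prop) (a b : R) (w : R -> R).
Context (hab : a <= b) (hw : forall x, continuous w x)
  (hrefl : forall x r, 0 <= r -> d x x r).

Let Dab (p : X * R) : Prop := D (fst p) /\ a <= snd p <= b.

Lemma bdd_lip_ex_RInt (F : X -> R -> R) (x : X) (c e : R) :
  D x -> a <= c -> c <= e -> e <= b ->
  bdd_lip Dab (prod_dist d) (fun p => F (fst p) (snd p)) ->
  ex_RInt (fun y => w y * F x y) c e.
Proof.
  intros hx hc hce he (M & L & hM & hL & h1 & h2).
  apply ex_RInt_eq with (fun y => w y * F x (clamp a b y)); auto.
  { intros y hy. rewrite clamp_id; auto; lra. }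
  apply ex_RInt_cont. intros y. apply continuous_mul; auto.
  apply (continuous_of_lipschitz _ L). intros u v.
  eapply Rle_trans; [| apply Rmult_le_compat_l; [exact hL | apply (clamp_lip a b)]].
  apply (h2 (x, clamp a b u) (x, clamp a b v)).
  - split; auto. apply clamp_in; auto.
  - split; auto. apply clamp_in; auto.
  - apply Rabs_pos.
  - split; simpl; [apply hrefl, Rabs_pos | lra].
Qed.

(** The weight [w] is only continuous, so it is kept apart from the Lipschitz integrand. The limits
    may vary with the parameter but must agree at points comparable under [d]: this covers integrals
    from [a] to [x] when only the velocity changes at fixed [x]. *)
Lemma bdd_lip_RInt (F : X -> R -> R) (c e : X -> R) :
  (forall x, D x -> a <= c x <= e x /\ e x <= b) ->
  (forall x y r, D x -> D y -> 0 <= r -> d x y r -> c x = c y /\ e x = e y) ->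
  bdd_lip Dab (prod_dist d) (fun p => F (fst p) (snd p)) ->
  bdd_lip D d (fun x => RInt (fun y => w y * F x y) (c x) (e x)).
Proof.
  intros hce heq hF.
  assert (hex : forall x y, D x -> D y -> c x = c y -> e x = e y ->
    ex_RInt (fun z => w z * F x z) (c y) (e y)).
  { intros x y hx hy h1 h2. destruct (hce y hy). apply bdd_lip_ex_RInt; auto; lra. }
  destruct hF as (M & L & hM & hL & h1 & h2).
  destruct (cont_on_bounded a b w hab) as [W [hW hWb]].
  { apply cont_on_of_continuous; auto. }
  exists ((b - a) * (W * M)), ((b - a) * (W * L)). repeat split.
  - repeat apply Rmult_le_pos; auto; lra.
  - repeat apply Rmult_le_pos; auto; lra.
  - intros x hx. destruct (hce x hx).
    eapply Rle_trans; [apply RInt_Rabs_le with (M := W * M)|].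
    + lra.
    + apply hex; auto.
    + intros y hy. rewrite Rabs_mult. apply Rmult_le_compat; auto using Rabs_pos.
      * apply hWb; lra.
      * apply (h1 (x, y)). split; auto; simpl; lra.
    + apply Rmult_le_compat_r; [apply Rmult_le_pos; auto | lra].
  - intros x x' r hx hx' hr hd. destruct (hce x hx), (heq x x' r) as [e1 e2]; auto.
    rewrite <- e1, <- e2. rewrite <- RInt_sub by (apply hex; auto).
    replace ((b - a) * (W * L) * r) with ((b - a) * (W * (L * r))) by ring.
    eapply Rle_trans; [apply RInt_Rabs_le with (M := W * (L * r))|].
    + lra.
    + apply ex_RInt_sub; apply hex; auto.
    + intros y hy. rewrite <- Rmult_minus_distr_l, Rabs_mult.
      apply Rmult_le_compat; auto using Rabs_pos.
      * apply hWb; lra.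
      * apply (h2 (x, y) (x', y)); auto; split; simpl; auto; try lra.
        rewrite Rminus_diag, Rabs_R0. exact hr.
    + apply Rmult_le_compat_r; [repeat apply Rmult_le_pos; auto | lra].
Qed.

End ParamIntegral.

(** * Expectation over the ordinates *)

(* The ordinates [1..k] are free: in [Eit t k] they have been integrated out. *)
Definition box (t : nat -> R) (k m : nat) (mu : nat -> R) : Prop :=
  forall l, (k < l <= m)%nat -> t (pred l) < mu l < t l.

(** The supremum distance over the coordinates that are not yet integrated out in [Eit t k]. *)
Definition cdist (k m : nat) (mu nu : nat -> R) (r : R) : Prop :=
  forall l, (k < l <= m)%nat -> Rabs (mu l - nu l) <= r.

Lemma cdist_refl (k m : nat) (mu : nat -> R) (r : R) : 0 <= r -> cdist k m mu mu r.
Proof. intros hr l _. rewrite Rminus_diag, Rabs_R0. exact hr. Qed.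

Lemma upd_same (mu : nat -> R) (j : nat) (y : R) : upd mu j y j = y.
Proof. unfold upd. rewrite Nat.eqb_refl. reflexivity. Qed.

Lemma upd_other (mu : nat -> R) (i j : nat) (y : R) : i <> j -> upd mu j y i = mu i.
Proof. intros h. unfold upd. apply Nat.eqb_neq in h. rewrite h. reflexivity. Qed.

Section Expectation.
Context (t : nat -> R) (m : nat) (ht : forall i, (i < m)%nat -> t i < t (S i)).
Implicit Types F G : (nat -> R) -> R.

Notation random := (bdd_lip (box t 0 m) (cdist 0 m)).

Lemma box_upd (k : nat) (mu : nat -> R) (y : R) :
  box t (S k) m mu -> t k < y < t (S k) -> box t k m (upd mu (S k) y).
Proof.
  intros hmu hy l hl. destruct (Nat.eq_dec l (S k)) as [-> | hne].
  - rewrite upd_same. exact hy.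
  - rewrite upd_other by auto. apply hmu. lia.
Qed.

Lemma Eit_ext (k : nat) F G : (k <= m)%nat ->
  (forall mu, box t 0 m mu -> F mu = G mu) ->
  forall mu, box t k m mu -> Eit t k F mu = Eit t k G mu.
Proof.
  intros hk hFG. induction k as [|k IH]; intros mu hmu; simpl; auto.
  pose proof (ht k ltac:(lia)). f_equal. apply RInt_eq; [lra|].
  intros y hy. apply IH; [lia|]. apply box_upd; auto.
Qed.

(** The Lipschitz bound at level [k] is an explicit premise so that the lemma can be used inside the
    induction proving that very bound. *)
Lemma Eit_lip_slice (k : nat) F : random F -> (k < m)%nat ->
  (exists L, 0 <= L /\ forall mu nu r, box t k m mu -> box t k m nu -> 0 <= r ->
     cdist k m mu nu r -> Rabs (Eit t k F mu - Eit t k F nu) <= L * r) ->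
  forall mu, box t (S k) m mu ->
  ex_RInt (fun y => Eit t k F (upd mu (S k) y)) (t k) (t (S k)).
Proof.
  intros hF hk (L & hL & h) mu hmu. pose proof (ht k hk).
  apply (ex_RInt_lipschitz _ _ L); auto; [lra|].
  intros x y hx hy. apply h; auto using box_upd, Rabs_pos.
  intros l hl. destruct (Nat.eq_dec l (S k)) as [-> | hne].
  - rewrite !upd_same. lra.
  - rewrite !upd_other by auto. rewrite Rminus_diag, Rabs_R0. apply Rabs_pos.
Qed.

(** Averaging over one cell does not increase the Lipschitz constant. Integrability and Lipschitz
    bounds advance together: the bound at level [k] makes the next integrand integrable, and its
    mean inherits the bound. *)
Lemma Eit_lip (k : nat) F : random F -> (k <= m)%nat ->
  exists L, 0 <= L /\ forall mu nu r, box t k m mu -> box t k m nu -> 0 <= r ->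
     cdist k m mu nu r -> Rabs (Eit t k F mu - Eit t k F nu) <= L * r.
Proof.
  intros hF. induction k as [|k IH]; intros hk.
  { destruct hF as (M & L & hM & hL & h1 & h2). exists L. simpl. split; auto. }
  destruct IH as [L [hL h]]; [lia|]. exists L. split; auto.
  intros mu nu r hmu hnu hr hd. pose proof (ht k ltac:(lia)). simpl.
  pose proof (Eit_lip_slice k F hF ltac:(lia) (ex_intro _ L (conj hL h))) as hex.
  unfold Rdiv. rewrite <- Rmult_minus_distr_r, <- RInt_sub by (apply hex; auto).
  rewrite Rabs_mult, Rabs_inv, (Rabs_pos_eq (t (S k) - t k)) by lra.
  apply Rmult_le_reg_r with (t (S k) - t k); [lra|].
  rewrite Rmult_assoc, Rinv_l, Rmult_1_r by lra. rewrite (Rmult_comm (L * r)).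
  apply RInt_Rabs_le; [lra | apply ex_RInt_sub; apply hex; auto |].
  intros y hy. apply h; auto using box_upd.
  intros l hl. destruct (Nat.eq_dec l (S k)) as [-> | hne].
  - rewrite !upd_same, Rminus_diag, Rabs_R0. exact hr.
  - rewrite !upd_other by auto. apply hd. lia.
Qed.

Lemma Eit_slice (k : nat) F (mu : nat -> R) : random F -> (k < m)%nat ->
  box t (S k) m mu -> ex_RInt (fun y => Eit t k F (upd mu (S k) y)) (t k) (t (S k)).
Proof.
  intros hF hk. apply Eit_lip_slice; auto. apply Eit_lip; auto. lia.
Qed.

Lemma Eit_add (k : nat) F G : random F -> random G -> (k <= m)%nat ->
  forall mu, box t k m mu ->
  Eit t k (fun nu => F nu + G nu) mu = Eit t k F mu + Eit t k G mu.
Proof.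
  intros hF hG. induction k as [|k IH]; intros hk mu hmu; simpl; auto.
  pose proof (ht k ltac:(lia)). rewrite <- Rdiv_plus_distr. f_equal.
  rewrite <- RInt_add by (apply Eit_slice; auto; lia).
  apply RInt_eq; [lra|]. intros y hy. apply IH; [lia|]. apply box_upd; auto.
Qed.

Lemma Eit_mull (k : nat) (c : R) F : random F -> (k <= m)%nat ->
  forall mu, box t k m mu -> Eit t k (fun nu => c * F nu) mu = c * Eit t k F mu.
Proof.
  intros hF. induction k as [|k IH]; intros hk mu hmu; simpl; auto.
  pose proof (ht k ltac:(lia)). unfold Rdiv. rewrite <- Rmult_assoc. f_equal.
  rewrite <- RInt_mull by (apply Eit_slice; auto; lia).
  apply RInt_eq; [lra|]. intros y hy. apply IH; [lia|]. apply box_upd; auto.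
Qed.

Lemma Eit_const (k : nat) (c : R) : (k <= m)%nat ->
  forall mu, Eit t k (fun _ => c) mu = c.
Proof.
  induction k as [|k IH]; intros hk mu; simpl; auto. pose proof (ht k ltac:(lia)).
  rewrite (RInt_ext _ (fun _ => c)) by (intros; apply IH; lia).
  rewrite RInt_cst. field. lra.
Qed.

Lemma Eit_mono (k : nat) F G : random F -> random G -> (k <= m)%nat ->
  (forall mu, box t 0 m mu -> F mu <= G mu) ->
  forall mu, box t k m mu -> Eit t k F mu <= Eit t k G mu.
Proof.
  intros hF hG hk hFG. induction k as [|k IH]; intros mu hmu; simpl; auto.
  pose proof (ht k ltac:(lia)). apply Rmult_le_compat_r.
  { left. apply Rinv_0_lt_compat. lra. }
  apply RInt_le; [lra | apply Eit_slice; auto; lia | apply Eit_slice; auto; lia|].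
  intros y hy. apply IH; [lia|]. apply box_upd; auto.
Qed.

(** At level [m] no coordinate remains, so the dummy point [fun _ => 0] in [Expect] is admissible in
    all lemmas about [Eit]. *)
Lemma box_nil (mu : nat -> R) : box t m m mu.
Proof. intros l hl. lia. Qed.

Lemma Expect_ext F G : (forall mu, box t 0 m mu -> F mu = G mu) ->
  Expect t m F = Expect t m G.
Proof. intros h. apply Eit_ext; auto using box_nil. Qed.

Lemma Expect_add F G : random F -> random G ->
  Expect t m (fun nu => F nu + G nu) = Expect t m F + Expect t m G.
Proof. intros hF hG. apply Eit_add; auto using box_nil. Qed.

Lemma Expect_mull (c : R) F : random F ->
  Expect t m (fun nu => c * F nu) = c * Expect t m F.
Proof. intros hF. apply Eit_mull; auto using box_nil. Qed.

Lemma Expect_const (c : R) : Expect t m (fun _ => c) = c.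
Proof. apply Eit_const; auto. Qed.

Lemma Expect_mono F G : random F -> random G ->
  (forall mu, box t 0 m mu -> F mu <= G mu) -> Expect t m F <= Expect t m G.
Proof. intros hF hG h. apply Eit_mono; auto using box_nil. Qed.

Lemma Expect_sub F G : random F -> random G ->
  Expect t m (fun nu => F nu - G nu) = Expect t m F - Expect t m G.
Proof.
  intros hF hG. rewrite (Expect_ext _ (fun nu => F nu + (-1) * G nu)) by (intros; ring).
  rewrite Expect_add, Expect_mull; auto; [ring|]. apply bdd_lip_mull; auto.
Qed.

Lemma Expect_Rabs_le F (M : R) : random F ->
  (forall mu, box t 0 m mu -> Rabs (F mu) <= M) -> Rabs (Expect t m F) <= M.
Proof.
  intros hF h. apply Rabs_le. split.
  - rewrite <- (Expect_const (- M)). apply Expect_mono; auto using bdd_lip_const.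
    intros mu hmu. specialize (h mu hmu). apply Rabs_le_between in h. lra.
  - rewrite <- (Expect_const M). apply Expect_mono; auto using bdd_lip_const.
    intros mu hmu. specialize (h mu hmu). apply Rabs_le_between in h. lra.
Qed.

(** * Sums of independent centered terms *)

Section Independence.
Context (u : nat -> R -> R) (A : R)
  (hu : forall l, (1 <= l <= m)%nat -> forall y, t (pred l) < y < t l -> Rabs (u l y) <= A)
  (hu0 : forall l, (1 <= l <= m)%nat ->
     ex_RInt (u l) (t (pred l)) (t l) /\ RInt (u l) (t (pred l)) (t l) = 0).

Let S_ (mu : nat -> R) := psum (fun l => u l (mu l)) m.
(** The tail of the sum over [k+1..m]: what is still random once the first [k] ordinates have been
    integrated out. *)
Let T_ (k : nat) (mu : nat -> R) :=
  psum (fun l => u l (mu l)) m - psum (fun l => u l (mu l)) k.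

Lemma tail_upd (k : nat) (mu : nat -> R) (y : R) : (k < m)%nat ->
  T_ k (upd mu (S k) y) = T_ (S k) mu + u (S k) y.
Proof.
  intros hk. unfold T_.
  rewrite (psum_tail_eq (fun l => u l (mu l)) (fun l => u l (upd mu (S k) y l)) (S k) m);
    [| lia | intros l hl; rewrite upd_other by lia; reflexivity].
  simpl. rewrite upd_same. ring.
Qed.

(** Integrating out one more ordinate removes exactly its term, because each [u l] has mean zero on
    its cell; after [m] steps the tail is empty. *)
Lemma Expect_sum_centered : Expect t m S_ = 0.
Proof.
  assert (h : forall k, (k <= m)%nat -> forall mu, Eit t k S_ mu = T_ k mu).
  { induction k as [|k IH]; intros hk mu; simpl.
    - unfold S_, T_. simpl. ring.
    - pose proof (ht k ltac:(lia)). destruct (hu0 (S k)) as [hex h0]; [lia|]. simpl in hex, h0.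
      rewrite (RInt_ext_all _ (fun y => T_ (S k) mu + u (S k) y)).
      2: { intros y. rewrite IH by lia. apply tail_upd. lia. }
      rewrite RInt_add, RInt_cst, h0; auto using ex_RInt_const. field. lra. }
  unfold Expect. rewrite h; auto. unfold T_. ring.
Qed.

(** Additivity of variances, by induction on the number of integrated ordinates: in [(c + u)^2] the
    tail [c] does not depend on the current ordinate, so the cross term integrates to zero and each
    step costs at most [A^2]. *)
Lemma Expect_sum_centered_sq :
  random (fun mu => S_ mu ^ 2) -> Expect t m (fun mu => S_ mu ^ 2) <= INR m * A ^ 2.
Proof.
  intros hS.
  assert (h : forall k, (k <= m)%nat -> forall mu, box t k m mu ->
    Eit t k (fun mu => S_ mu ^ 2) mu <= T_ k mu ^ 2 + INR k * A ^ 2).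
  { induction k as [|k IH]; intros hk mu hmu.
    - simpl. unfold S_, T_. simpl. right. ring.
    - rewrite S_INR. simpl Eit.
      pose proof (ht k ltac:(lia)) as htk. destruct (hu0 (S k)) as [hex h0]; [lia|]. simpl in hex, h0.
      set (c := T_ (S k) mu).
      apply Rmult_le_reg_r with (t (S k) - t k); [lra|].
      unfold Rdiv. rewrite Rmult_assoc, Rinv_l, Rmult_1_r by lra.
      (* The majorant is affine in [u], since [u^2] is replaced by [A^2] before integrating. Its
         integral is therefore known exactly from the centering of [u]. *)
      replace ((c ^ 2 + (INR k + 1) * A ^ 2) * (t (S k) - t k)) with
        (RInt (fun y => (A ^ 2 + c ^ 2 + INR k * A ^ 2) + (2 * c) * u (S k) y) (t k) (t (S k))).
      2: { rewrite RInt_add, RInt_cst, RInt_mull, h0; auto using ex_RInt_const, ex_RInt_mull. simpl. ring. }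
      apply RInt_le; [lra | apply Eit_slice; auto |
        apply ex_RInt_add; auto using ex_RInt_const, ex_RInt_mull |].
      intros y hy. eapply Rle_trans; [apply IH; [lia | apply box_upd; auto]|].
      rewrite tail_upd by lia. fold c.
      pose proof (hu (S k) ltac:(lia) y hy) as hb.
      assert (u (S k) y ^ 2 <= A ^ 2).
      { rewrite <- pow2_abs. apply pow_incr. split; [apply Rabs_pos | exact hb]. }
      nra. }
  unfold Expect. eapply Rle_trans; [apply h; auto using box_nil|].
  unfold T_. rewrite Rminus_diag. right. ring.
Qed.
End Independence.

(** * Exchange of expectation and integration in space *)

Section Fubini.
Context (a b : R) (hab : a <= b) (w : R -> R) (hw : forall x, continuous w x)
  (F : (nat -> R) -> R -> R).

Definition random_field (f : (nat -> R) -> R -> R) : Prop :=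
  bdd_lip (fun p : (nat -> R) * R => box t 0 m (fst p) /\ a <= snd p <= b)
    (prod_dist (cdist 0 m)) (fun p => f (fst p) (snd p)).

Lemma random_field_slice (f : (nat -> R) -> R -> R) (x : R) :
  random_field f -> a <= x <= b -> random (fun mu => f mu x).
Proof.
  intros hf hx. apply (bdd_lip_comp _ _ _ _ (fun mu => (mu, x)) 1) with (4 := hf); auto; try lra.
  intros mu nu r _ _ hr hd. rewrite Rmult_1_l. split; simpl; auto.
  rewrite Rminus_diag, Rabs_R0. exact hr.
Qed.

Context (hF : random_field F).

Lemma random_RInt (c e : R) : a <= c -> c <= e -> e <= b ->
  random (fun mu => RInt (fun y => w y * F mu y) c e).
Proof.
  intros h1 h2 h3. apply (bdd_lip_RInt _ _ a b w hab hw) with (c := fun _ => c) (e := fun _ => e); auto.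
  apply cdist_refl.
Qed.

Lemma random_field_ex_RInt (mu : nat -> R) (c e : R) : box t 0 m mu ->
  a <= c -> c <= e -> e <= b -> ex_RInt (fun y => w y * F mu y) c e.
Proof.
  intros hmu h1 h2 h3.
  apply (bdd_lip_ex_RInt (box t 0 m) (cdist 0 m) a b); auto. apply cdist_refl.
Qed.

Lemma Expect_field_lipschitz : exists L, 0 <= L /\ forall x y, a <= x <= b -> a <= y <= b ->
  Rabs (Expect t m (fun mu => F mu x) - Expect t m (fun mu => F mu y)) <= L * Rabs (x - y).
Proof.
  pose proof hF as (M & L & hM & hL & h1 & h2). exists L. split; auto.
  intros x y hx hy. rewrite <- Expect_sub by (apply random_field_slice; auto).
  apply Expect_Rabs_le.
  { apply bdd_lip_sub; apply random_field_slice; auto. }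
  intros mu hmu. apply (h2 (mu, x) (mu, y)); try (split; simpl; auto; lra).
  - apply Rabs_pos.
  - split; simpl; [apply cdist_refl, Rabs_pos | lra].
Qed.

Lemma cont_on_Expect : cont_on a b (fun x => Expect t m (fun mu => F mu x)).
Proof.
  destruct Expect_field_lipschitz as [L [hL h]]. apply cont_on_of_lipschitz with L; auto.
Qed.

Lemma ex_RInt_Expect (c e : R) : a <= c -> c <= e -> e <= b ->
  ex_RInt (fun y => w y * Expect t m (fun mu => F mu y)) c e.
Proof.
  intros h1 h2 h3.
  apply ex_RInt_eq with (fun y => w y * Expect t m (fun mu => F mu (clamp a b y))); auto.
  { intros y hy. rewrite clamp_id; auto; lra. }
  apply ex_RInt_cont. intros y. apply continuous_mul; auto.
  apply (continuous_clamp a b (fun z => Expect t m (fun mu => F mu z))); auto.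
  apply cont_on_Expect.
Qed.

(* The difference of the two sides, as a function of the upper limit of
   integration, has quadratically small increments. *)
Lemma Expect_RInt :
  Expect t m (fun mu => RInt (fun y => w y * F mu y) a b)
  = RInt (fun y => w y * Expect t m (fun mu => F mu y)) a b.
Proof.
  pose proof hF as (M & L & hM & hL & h1 & h2).
  destruct (cont_on_bounded a b w hab) as [W [hW hWb]].
  { apply cont_on_of_continuous; auto. }
  set (G := fun x => Expect t m (fun mu => F mu x)).
  assert (hG : forall x y, a <= x <= b -> a <= y <= b -> Rabs (G x - G y) <= L * Rabs (x - y)).
  { intros x y hx hy. unfold G. rewrite <- Expect_sub by (apply random_field_slice; auto).
    apply Expect_Rabs_le.
    { apply bdd_lip_sub; apply random_field_slice; auto. }
    intros mu hmu. apply (h2 (mu, x) (mu, y)); try (split; simpl; auto; lra).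
    - apply Rabs_pos.
    - split; simpl; [apply cdist_refl, Rabs_pos | lra]. }
  set (Phi := fun x => Expect t m (fun mu => RInt (fun y => w y * F mu y) a x)
                       - RInt (fun y => w y * G y) a x).
  enough (h : Phi b = Phi a).
  { unfold Phi in h. rewrite (Expect_ext (fun mu => RInt (fun y => w y * F mu y) a a) (fun _ => 0)) in h.
    2: { intros. apply (RInt_point a (fun y => w y * F mu y)). }
    rewrite Expect_const in h. rewrite (RInt_point a (fun y => w y * G y)) in h.
    unfold zero in h; simpl in h. unfold G in h. lra. }
  apply (quadratic_increments_const a b (2 * (W * L))); auto.
  { repeat apply Rmult_le_pos; auto; lra. }
  intros x y hx hy.
  assert (hw' : ex_RInt w x y) by (apply ex_RInt_cont; auto).
  (* Over [[x,y]] both sides grow by [G x * RInt w x y] up to an error: freezing the integrand at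
     [x] changes it by at most [L (y - x)], hence the integral by at most [W L (y - x)^2]. *)
  assert (e1 : Expect t m (fun mu => RInt (fun z => w z * F mu z) a y)
     - Expect t m (fun mu => RInt (fun z => w z * F mu z) a x) - G x * RInt w x y
     = Expect t m (fun mu => RInt (fun z => w z * F mu z) x y - RInt w x y * F mu x)).
  { rewrite <- Expect_sub by (apply random_RInt; lra).
    rewrite (Expect_sub (fun mu => RInt (fun z => w z * F mu z) x y)
      (fun mu => RInt w x y * F mu x)).
    2: { apply random_RInt; lra. }
    2: { apply bdd_lip_mull, random_field_slice; auto; lra. }
    rewrite Expect_mull by (apply random_field_slice; auto; lra). unfold G.
    rewrite (Rmult_comm (RInt w x y)). f_equal.
    apply Expect_ext. intros mu hmu.
    rewrite <- (RInt_split (fun z => w z * F mu z) a x y) by (apply random_field_ex_RInt; auto; lra).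
    ring. }
  assert (b1 : Rabs (Expect t m (fun mu => RInt (fun z => w z * F mu z) x y - RInt w x y * F mu x))
    <= (y - x) * (W * (L * (y - x)))).
  { apply Expect_Rabs_le.
    { apply bdd_lip_sub; [apply random_RInt; lra | apply bdd_lip_mull, random_field_slice; auto; lra]. }
    intros mu hmu. rewrite (Rmult_comm (RInt w x y)), <- RInt_mull, <- RInt_sub; auto using ex_RInt_mull.
    2: { apply random_field_ex_RInt; auto; lra. }
    apply RInt_Rabs_le; [lra | apply ex_RInt_sub; auto using ex_RInt_mull;
      apply random_field_ex_RInt; auto; lra |].
    intros z hz. replace (w z * F mu z - F mu x * w z) with (w z * (F mu z - F mu x)) by ring.
    rewrite Rabs_mult. apply Rmult_le_compat; auto using Rabs_pos.
    { apply hWb; lra. }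
    apply Rle_trans with (L * Rabs (z - x)).
    - apply (h2 (mu, z) (mu, x)); try (split; simpl; auto; lra).
      + apply Rabs_pos.
      + split; simpl; [apply cdist_refl, Rabs_pos | lra].
    - apply Rmult_le_compat_l; auto. rewrite Rabs_pos_eq; lra. }
  assert (b2 : Rabs (RInt (fun z => w z * G z) x y - G x * RInt w x y)
    <= (y - x) * (W * (L * (y - x)))).
  { rewrite <- RInt_mull, <- RInt_sub; auto using ex_RInt_mull.
    2: { apply ex_RInt_Expect; lra. }
    apply RInt_Rabs_le; [lra | apply ex_RInt_sub; auto using ex_RInt_mull; apply ex_RInt_Expect; lra |].
    intros z hz. replace (w z * G z - G x * w z) with (w z * (G z - G x)) by ring.
    rewrite Rabs_mult. apply Rmult_le_compat; auto using Rabs_pos.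
    { apply hWb; lra. }
    eapply Rle_trans; [apply hG; lra|].
    apply Rmult_le_compat_l; auto. rewrite Rabs_pos_eq; lra. }
  rewrite <- e1 in b1.
  assert (e2 : RInt (fun z => w z * G z) a y
    = RInt (fun z => w z * G z) a x + RInt (fun z => w z * G z) x y).
  { rewrite RInt_split; auto; apply ex_RInt_Expect; lra. }
  unfold Phi. rewrite e2.
  apply Rabs_le_between in b1, b2. apply Rabs_le.
  replace (2 * (W * L) * (y - x) ^ 2) with (2 * ((y - x) * (W * (L * (y - x))))) by ring. lra.
Qed.

End Fubini.
End Expectation.

(** * The one-dimensional transport equation *)

(** The attenuation kernel, with [s] an optical distance and [z] the inverse speed along the
    axis. *)
Definition kappa (s z : R) : R := z * exp (- (s * z)).

Lemma kappa_pos (s z : R) : 0 <= z -> 0 <= kappa s z.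
Proof. intros hz. apply Rmult_le_pos; auto. left. apply exp_pos. Qed.

Lemma continuous_exp_comp (f : R -> R) (x : R) :
  continuous f x -> continuous (fun y => exp (f y)) x.
Proof.
  intros h. apply (continuous_comp f exp); auto.
  apply (ex_derive_continuous exp). exists (exp (f x)). apply is_derive_exp.
Qed.

Lemma continuous_kappa (f : R -> R) (z x : R) :
  continuous f x -> continuous (fun y => kappa (f y) z) x.
Proof.
  intros h. unfold kappa. apply continuous_mul; [apply continuous_const|].
  apply continuous_exp_comp.
  apply (continuous_opp (fun y => f y * z)).
  apply continuous_mul; [exact h | apply continuous_const].
Qed.

Section Transport.
Context (a b : R) (sT : R -> R) (hab : a <= b) (hsT : forall x, continuous sT x)
  (hpos : forall x, a <= x <= b -> 0 <= sT x).

(** The optical depth measured from the left end; in this variable the transport equation has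
    constant coefficients. *)
Definition tau (x : R) : R := RInt sT a x.

Lemma is_derive_tau (x : R) : is_derive tau x (sT x).
Proof.
  apply (is_derive_RInt sT tau a x); auto.
  apply filter_forall. intros y. apply (RInt_correct sT a y), ex_RInt_cont, hsT.
Qed.

Lemma continuous_tau (x : R) : continuous tau x.
Proof. apply (ex_derive_continuous tau). exists (sT x). apply is_derive_tau. Qed.

Lemma tau_a : tau a = 0.
Proof. exact (RInt_point a sT). Qed.

Lemma tau_mono (x y : R) : a <= x -> x <= y -> y <= b -> tau x <= tau y.
Proof.
  intros h1 h2 h3. unfold tau. rewrite <- (RInt_split sT a x y) by (apply ex_RInt_cont, hsT).
  assert (0 <= RInt sT x y); [|lra].
  apply RInt_ge_0; auto. { apply ex_RInt_cont, hsT. } intros z hz. apply hpos. lra.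
Qed.

(** The integrating factor is [exp (z * tau)]: subtracting the primitive of the source from
    [exp (z * tau) * u] gives zero derivative. The sign of [z] is free and the base point [y]
    arbitrary, so that both directions of travel are covered. *)
Lemma duhamel (f u : R -> R) (z : R) :
  (forall x, continuous f x) -> cont_on a b u ->
  (forall x, a < x < b -> exists d, is_derive u x d /\ d + z * sT x * u x = z * f x) ->
  forall x y, a <= x <= b -> a <= y <= b ->
  exp (z * tau x) * u x - exp (z * tau y) * u y
  = RInt (fun s => z * exp (z * tau s) * f s) y x.
Proof.
  intros hf hu hode x y hx hy.
  set (g := fun s => z * exp (z * tau s) * f s).
  assert (hg : forall s, continuous g s).
  { intros s. apply continuous_mul; auto. apply continuous_mul; [apply continuous_const|].
    apply continuous_exp_comp, continuous_mul; [apply continuous_const | apply continuous_tau]. }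
  assert (hGd : forall s, is_derive (fun r => RInt g a r) s (g s)).
  { intros s. apply (is_derive_RInt g (fun r => RInt g a r) a s); auto.
    apply filter_forall. intros r. apply (RInt_correct g a r), ex_RInt_cont, hg. }
  assert (he : exp (z * tau x) * u x - RInt g a x = exp (z * tau y) * u y - RInt g a y).
  { apply (derive_0_const a b (fun s => exp (z * tau s) * u s - RInt g a s)); auto.
    - apply cont_on_sub; auto.
      + apply cont_on_eq with (fun s => exp (z * tau s) * u (clamp a b s)).
        { intros s hs. rewrite clamp_id; auto. }
        apply cont_on_of_continuous. intros s. apply continuous_mul.
        * apply continuous_exp_comp, continuous_mul; [apply continuous_const | apply continuous_tau].
        * apply continuous_clamp; auto.
      + apply cont_on_of_continuous. intros s.
        apply (ex_derive_continuous (fun r => RInt g a r)). exists (g s). apply hGd.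
    - intros s hs. destruct (hode s hs) as [d [hd1 hd2]].
      assert (hE : is_derive (fun r => exp (z * tau r)) s (z * sT s * exp (z * tau s))).
      { apply (is_derive_comp exp (fun r => z * tau r)); [apply is_derive_exp|].
        apply (is_derive_scal tau s z). apply is_derive_tau. }
      replace 0 with ((z * sT s * exp (z * tau s)) * u s + exp (z * tau s) * d - g s).
      + apply (is_derive_minus (fun r => exp (z * tau r) * u r)); [|apply hGd].
        apply (is_derive_mult (fun r => exp (z * tau r)) u); auto. intros; apply Rmult_comm.
      + unfold g. replace d with (z * f s - z * sT s * u s) by lra. ring. }
  assert (hc : RInt g a y + RInt g y x = RInt g a x)
    by (apply RInt_split; apply ex_RInt_cont, hg).
  lra.
Qed.

Lemma duhamel_forward (f u : R -> R) (z : R) :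
  (forall x, continuous f x) -> cont_on a b u ->
  (forall x, a < x < b -> exists d, is_derive u x d /\ d + z * sT x * u x = z * f x) ->
  forall x, a <= x <= b ->
  u x = u a * exp (- (tau x * z)) + RInt (fun y => f y * kappa (tau x - tau y) z) a x.
Proof.
  intros hf hu hode x hx. pose proof (duhamel f u z hf hu hode x a hx ltac:(lra)) as h.
  rewrite tau_a, Rmult_0_r, exp_0 in h.
  rewrite (RInt_ext_all _ (fun y => exp (- (tau x * z)) * (z * exp (z * tau y) * f y))).
  2: { intros y. unfold kappa. replace (- ((tau x - tau y) * z))
         with (- (tau x * z) + z * tau y) by ring. rewrite exp_plus. ring. }
  rewrite RInt_mull.
  2: { apply ex_RInt_cont. intros s. apply continuous_mul; auto.
       apply continuous_mul; [apply continuous_const|].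
       apply continuous_exp_comp, continuous_mul; [apply continuous_const | apply continuous_tau]. }
  rewrite <- h. rewrite Rmult_1_l.
  replace (z * tau x) with (tau x * z) by ring. rewrite exp_Ropp.
  pose proof (exp_pos (tau x * z)). field. lra.
Qed.

(** For a negative velocity with [z = 1 / |mu|]: [duhamel] is applied with [- z] between [x] and the
    inflow end [b], then multiplied by [exp (tau x * z)]. *)
Lemma duhamel_backward (f u : R -> R) (z : R) :
  (forall x, continuous f x) -> cont_on a b u ->
  (forall x, a < x < b -> exists d, is_derive u x d /\ - d + z * sT x * u x = z * f x) ->
  forall x, a <= x <= b ->
  u x = u b * exp (- ((tau b - tau x) * z)) + RInt (fun y => f y * kappa (tau y - tau x) z) x b.
Proof.
  intros hf hu hode x hx.
  pose proof (duhamel f u (- z) hf hu) as h.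
  assert (hode' : forall s, a < s < b -> exists d, is_derive u s d /\ d + - z * sT s * u s = - z * f s).
  { intros s hs. destruct (hode s hs) as [d [hd1 hd2]]. exists d. split; auto. lra. }
  specialize (h hode' b x ltac:(lra) hx).
  rewrite (RInt_ext_all _ (fun y => - exp (tau x * z) * (- z * exp (- z * tau y) * f y))).
  2: { intros y. unfold kappa. replace (- ((tau y - tau x) * z))
         with (tau x * z + - z * tau y) by ring. rewrite exp_plus. ring. }
  rewrite RInt_mull.
  2: { apply ex_RInt_cont. intros s. apply continuous_mul; auto.
       apply continuous_mul; [apply continuous_const|].
       apply continuous_exp_comp, continuous_mul; [apply continuous_const | apply continuous_tau]. }
  rewrite <- h. replace (- z * tau x) with (- (tau x * z)) by ring.
  replace (- ((tau b - tau x) * z)) with (- z * tau b + tau x * z) by ring.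
  rewrite exp_plus, exp_Ropp.
  pose proof (exp_pos (tau x * z)). field. lra.
Qed.

(** Multiply the equation by [u] and integrate: [mu u u'] yields the boundary term
    [mu / 2 * (u b ^ 2 - u a ^ 2)], which is nonnegative because [u] vanishes at the inflow end. *)
Lemma energy (f u : R -> R) (mu : R) :
  (forall x, continuous f x) -> cont_on a b u ->
  (forall x, a < x < b -> exists d, is_derive u x d /\ mu * d + sT x * u x = f x) ->
  (0 < mu -> u a = 0) -> (mu < 0 -> u b = 0) ->
  RInt (fun x => sT x * u x ^ 2) a b <= RInt (fun x => f x * u x) a b.
Proof.
  intros hf hu hode h1 h2.
  set (v := fun x => u (clamp a b x)).
  assert (hv : forall x, continuous v x) by (apply continuous_clamp; auto).
  set (g := fun x => sT x * (v x * v x) - f x * v x).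
  assert (hg : forall s, continuous g s).
  { intros s. apply continuous_sub; apply continuous_mul; auto. apply continuous_mul; auto. }
  assert (hGd : forall s, is_derive (fun r => RInt g a r) s (g s)).
  { intros s. apply (is_derive_RInt g (fun r => RInt g a r) a s); auto.
    apply filter_forall. intros r. apply (RInt_correct g a r), ex_RInt_cont, hg. }
  assert (he : mu / 2 * (u b * u b) + RInt g a b = mu / 2 * (u a * u a) + RInt g a a).
  { apply (derive_0_const a b (fun s => mu / 2 * (u s * u s) + RInt g a s)); auto; try lra.
    - apply cont_on_add; auto.
      + apply cont_on_mull; auto. apply cont_on_eq with (fun s => v s * v s).
        { intros s hs. unfold v. rewrite clamp_id; auto. }
        apply cont_on_of_continuous. intros s. apply continuous_mul; auto.
      + apply cont_on_of_continuous. intros s.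
        apply (ex_derive_continuous (fun r => RInt g a r)). exists (g s). apply hGd.
    - intros s hs. destruct (hode s hs) as [d [hd1 hd2]].
      replace 0 with (mu / 2 * (d * u s + u s * d) + g s).
      + apply (is_derive_plus (fun r => mu / 2 * (u r * u r)) (fun r => RInt g a r)); [|apply hGd].
        apply (is_derive_scal (fun r => u r * u r)).
        apply (is_derive_mult u u); auto. intros; apply Rmult_comm.
      + unfold g, v. rewrite clamp_id by lra. rewrite <- hd2. field. }
  rewrite (RInt_point a g) in he. unfold zero in he; simpl in he.
  assert (hgb : RInt g a b <= 0).
  { destruct (Rtotal_order mu 0) as [hm|[hm|hm]].
    - rewrite h2 in he by lra. nra.
    - rewrite hm in he. lra.
    - rewrite h1 in he by lra. nra. }
  unfold g in hgb. rewrite RInt_sub in hgb.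
  2: { apply ex_RInt_cont. intros s. apply continuous_mul; auto. apply continuous_mul; auto. }
  2: { apply ex_RInt_cont. intros s. apply continuous_mul; auto. }
  rewrite (RInt_eq (fun x => sT x * u x ^ 2) (fun x => sT x * (v x * v x))); auto.
  2: { intros x hx. unfold v. rewrite clamp_id by lra. ring. }
  rewrite (RInt_eq (fun x => f x * u x) (fun x => f x * v x)); auto.
  2: { intros x hx. unfold v. rewrite clamp_id by lra. ring. }
  lra.
Qed.

(** Opposite velocities see the source from opposite sides of [x]; together they cover the whole
    interval with one symmetric kernel. This is where the symmetry of the ordinates pays off. *)
Lemma RInt_kappa_abs (f : R -> R) (x z : R) : (forall y, continuous f y) -> a <= x <= b ->
  RInt (fun y => f y * kappa (tau x - tau y) z) a x
  + RInt (fun y => f y * kappa (tau y - tau x) z) x b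
  = RInt (fun y => f y * kappa (Rabs (tau x - tau y)) z) a b.
Proof.
  intros hf hx.
  assert (hc : forall y, continuous (fun y => f y * kappa (Rabs (tau x - tau y)) z) y).
  { intros y. apply continuous_mul; auto. apply continuous_kappa.
    apply (continuous_comp (fun y => tau x - tau y) Rabs); [|apply continuous_Rabs].
    apply continuous_sub; [apply continuous_const | apply continuous_tau]. }
  rewrite <- (RInt_split _ a x b) by (apply ex_RInt_cont, hc).
  f_equal; apply RInt_eq; try lra; intros y hy.
  - rewrite Rabs_pos_eq; auto. pose proof (tau_mono y x). lra.
  - rewrite Rabs_minus_sym, Rabs_pos_eq; auto. pose proof (tau_mono x y). lra.
Qed.

(** On each side of [x], [sT y * kappa] is up to sign the derivative of [exp (- z |tau x - tau y|)],
    so each side contributes [1] minus an exponential. The resulting 2 is compensated by the weights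
    of the negative ordinates, which sum to one half. *)
Lemma RInt_kappa_le (x z : R) : 0 < z -> a <= x <= b ->
  RInt (fun y => sT y * kappa (Rabs (tau x - tau y)) z) a b <= 2.
Proof.
  intros hz hx. rewrite <- RInt_kappa_abs by auto.
  (* The sign [eps] selects the side: [-1] for [y] to the left of [x], [1] for [y] to the right. *)
  assert (hder : forall eps y, is_derive (fun s => exp (- (eps * (tau s - tau x) * z))) y
      (- (eps * sT y * kappa (eps * (tau y - tau x)) z))).
  { intros eps y. unfold kappa.
    replace (- (eps * sT y * (z * exp (- (eps * (tau y - tau x) * z)))))
      with (- (z * (eps * sT y)) * exp (- (eps * (tau y - tau x) * z))) by ring.
    apply (is_derive_comp exp (fun s => - (eps * (tau s - tau x) * z))); [apply is_derive_exp|].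
    apply (is_derive_opp (fun s => eps * (tau s - tau x) * z)).
    apply (is_derive_ext (fun s => z * (eps * (tau s - tau x)))); [intros; simpl; ring|].
    apply (is_derive_scal (fun s => eps * (tau s - tau x))).
    apply (is_derive_scal (fun s => tau s - tau x)).
    rewrite <- (Rminus_0_r (sT y)).
    apply (is_derive_minus tau (fun _ => tau x)); [apply is_derive_tau | exact (is_derive_const (tau x) y)]. }
  assert (hcont : forall eps y, continuous (fun y => - (eps * sT y * kappa (eps * (tau y - tau x)) z)) y).
  { intros eps y. apply (continuous_opp (fun y => eps * sT y * kappa (eps * (tau y - tau x)) z)).
    apply continuous_mul; [apply continuous_mul; [apply continuous_const | auto]|].
    apply (continuous_kappa (fun y => eps * (tau y - tau x))). apply continuous_mul; [apply continuous_const|].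
    apply continuous_sub; [apply continuous_tau | apply continuous_const]. }
  pose proof (fun eps c e => is_RInt_unique _ _ _ _
    (is_RInt_derive _ _ c e (fun y _ => hder eps y) (fun y _ => hcont eps y))) as hI.
  assert (h1 : RInt (fun y => sT y * kappa (tau x - tau y) z) a x <= 1).
  { specialize (hI (-1) a x). rewrite (RInt_ext_all _ (fun y => sT y * kappa (tau x - tau y) z)) in hI.
    2: { intros y. replace (-1 * (tau y - tau x)) with (tau x - tau y) by ring. ring. }
    rewrite hI. unfold minus, plus, opp; simpl.
    replace (- (-1 * (tau x - tau x) * z)) with 0 by ring. rewrite exp_0.
    pose proof (exp_pos (- (-1 * (tau a - tau x) * z))). lra. }
  assert (h2 : RInt (fun y => sT y * kappa (tau y - tau x) z) x b <= 1).
  { specialize (hI 1 x b). rewrite (RInt_ext_all _ (fun y => (-1) * (sT y * kappa (tau y - tau x) z))) in hI.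
    2: { intros y. replace (1 * (tau y - tau x)) with (tau y - tau x) by ring. ring. }
    rewrite RInt_mull in hI.
    2: { apply ex_RInt_cont. intros y. apply continuous_mul; auto.
         apply (continuous_kappa (fun y => tau y - tau x)).
         apply continuous_sub; [apply continuous_tau | apply continuous_const]. }
    unfold minus, plus, opp in hI; simpl in hI.
    replace (- (1 * (tau x - tau x) * z)) with 0 in hI by ring. rewrite exp_0 in hI.
    pose proof (exp_pos (- (1 * (tau b - tau x) * z))). lra. }
  lra.
Qed.

End Transport.

(** * Regularity of the exact solution *)

Section MoreBddLip.
Context {X : Type} (D : X -> Prop) (d : X -> X -> R -> Prop) (a b : R).

Lemma bdd_lip_Rabs (f : X -> R) : bdd_lip D d f -> bdd_lip D d (fun x => Rabs (f x)).
Proof.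
  intros (M & L & hM & hL & h1 & h2). exists M, L. repeat split; auto.
  - intros x hx. rewrite Rabs_Rabsolu. auto.
  - intros x y r hx hy hr hd. eapply Rle_trans; [apply Rabs_triang_inv2 | auto].
Qed.

Lemma bdd_lip_fst (f : X -> R) : bdd_lip D d f ->
  bdd_lip (fun p : X * R => D (fst p) /\ a <= snd p <= b) (prod_dist d) (fun p => f (fst p)).
Proof.
  apply (bdd_lip_comp D d _ _ fst 1); [lra | intros p hp; apply hp |].
  intros p p' r _ _ _ hd. rewrite Rmult_1_l. apply hd.
Qed.

Lemma bdd_lip_snd (L : R) (g : R -> R) : a <= b -> 0 <= L ->
  (forall x y, a <= x <= b -> a <= y <= b -> Rabs (g x - g y) <= L * Rabs (x - y)) ->
  bdd_lip (fun p : X * R => D (fst p) /\ a <= snd p <= b) (prod_dist d) (fun p => g (snd p)).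
Proof.
  intros hab hL hg.
  destruct (cont_on_bounded a b g hab) as [M [hM hb]].
  { apply cont_on_of_lipschitz with L; auto. }
  exists M, L. repeat split; auto.
  - intros p hp. apply hb, hp.
  - intros p p' r hp hp' hr [_ h]. eapply Rle_trans; [apply hg; [apply hp | apply hp']|].
    apply Rmult_le_compat_l; auto.
Qed.

Lemma bdd_lip_kappa (s z : X -> R) : (forall x, D x -> 0 <= s x) -> (forall x, D x -> 0 <= z x) ->
  bdd_lip D d s -> bdd_lip D d z -> bdd_lip D d (fun x => kappa (s x) (z x)).
Proof.
  intros hs hz hsl hzl. unfold kappa. apply bdd_lip_mul; auto.
  apply bdd_lip_exp.
  - intros x hx. specialize (hs x hx). specialize (hz x hx). nra.
  - apply bdd_lip_opp, bdd_lip_mul; auto.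
Qed.

End MoreBddLip.

Lemma tau_lipschitz (a b : R) (sT : R -> R) : a <= b -> (forall x, continuous sT x) ->
  exists L, 0 <= L /\ forall x y, a <= x <= b -> a <= y <= b ->
    Rabs (tau a sT x - tau a sT y) <= L * Rabs (x - y).
Proof.
  intros hab hc. destruct (cont_on_bounded a b sT hab) as [W [hW hb]].
  { apply cont_on_of_continuous; auto. }
  exists W. split; auto. apply mvt_Rabs; auto.
  - apply cont_on_of_continuous. intros x. apply continuous_tau; auto.
  - intros x hx. exists (sT x). split; [apply is_derive_tau; auto | apply hb; lra].
Qed.

Section DuhamelRegularity.
Context (a b : R) (hab : a <= b) (sT : R -> R) (hsT : forall x, continuous sT x)
  (D : R -> Prop) (zf p : R -> R).

Let Dx (v : R * R) : Prop := a <= fst v <= b /\ D (snd v).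
(* Lipschitz dependence on the velocity, uniformly in the position. *)
Let dx (v v' : R * R) (r : R) : Prop := fst v = fst v' /\ Rabs (snd v - snd v') <= r.

(** Comparable points share their position, so the Lipschitz constant is 0 and only the boundedness
    of a continuous function is at stake. *)
Lemma bdd_lip_position (g : R -> R) : cont_on a b g -> bdd_lip Dx dx (fun v => g (fst v)).
Proof.
  intros hg. destruct (cont_on_bounded a b g hab hg) as [M [hM hb]].
  exists M, 0. repeat split; auto; try lra.
  - intros v hv. apply hb, hv.
  - intros v v' r _ _ _ [h _]. rewrite h, Rminus_diag, Rabs_R0. lra.
Qed.

(** The common shape of [psi_forward] and [psi_backward]: [zf] is [1 / |mu|], [p] the inflow datum,
    [sig] the optical distance to the inflow end, and [k1], [k2], [w0] absorb the sign of the
    velocity. *)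
Lemma bdd_lip_duhamel (w wgt sig : R -> R) (c e : R -> R) (k1 k2 w0 : R) :
  (forall u, D u -> 0 <= zf u) ->
  bdd_lip Dx dx (fun v => zf (snd v)) -> bdd_lip Dx dx (fun v => p (snd v)) ->
  cont_on a b w -> cont_on a b sig -> (forall x, a <= x <= b -> 0 <= sig x) ->
  (forall x, continuous wgt x) -> (forall x, a <= x <= b -> a <= c x <= e x /\ e x <= b) ->
  bdd_lip Dx dx (fun v => k1 * (zf (snd v) * w (fst v))
    + (p (snd v) + w0 * zf (snd v)) * exp (- (sig (fst v) * zf (snd v)))
    + (1 + k2 * zf (snd v)) *
      RInt (fun y => wgt y * kappa (Rabs (tau a sT (fst v) - tau a sT y)) (zf (snd v)))
        (c (fst v)) (e (fst v))).
Proof.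
  intros hz hzl hp hw hsig hsig0 hwgt hce.
  apply bdd_lip_add; [apply bdd_lip_add|].
  - apply bdd_lip_mull, bdd_lip_mul; auto. apply bdd_lip_position; auto.
  - apply bdd_lip_mul.
    + apply bdd_lip_add; auto. apply bdd_lip_mull; auto.
    + apply bdd_lip_exp.
      * intros v hv. specialize (hz _ (proj2 hv)). specialize (hsig0 _ (proj1 hv)). nra.
      * apply bdd_lip_opp, bdd_lip_mul; auto. apply bdd_lip_position; auto.
  - apply bdd_lip_mul.
    { apply bdd_lip_add; [apply bdd_lip_const | apply bdd_lip_mull; auto]. }
    apply (bdd_lip_RInt Dx dx a b wgt hab hwgt) with
      (F := fun v y => kappa (Rabs (tau a sT (fst v) - tau a sT y)) (zf (snd v)))
      (c := fun v => c (fst v)) (e := fun v => e (fst v)).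
    + intros v r hr. split; auto. rewrite Rminus_diag, Rabs_R0. exact hr.
    + intros v hv. apply hce, hv.
    + intros v v' r _ _ _ [h _]. rewrite h. auto.
    + destruct (tau_lipschitz a b sT hab hsT) as [L [hL ht]].
      apply bdd_lip_kappa.
      * intros; apply Rabs_pos.
      * intros v hv. apply hz, hv.
      * apply bdd_lip_Rabs, bdd_lip_sub.
        -- apply (bdd_lip_fst Dx dx a b (fun v => tau a sT (fst v))).
           apply bdd_lip_position. apply cont_on_of_lipschitz with L; auto.
        -- apply (bdd_lip_snd Dx dx a b L); auto.
      * apply (bdd_lip_fst Dx dx a b (fun v => zf (snd v))); auto.
Qed.

End DuhamelRegularity.

Lemma exact_cont_on (xL xR delta : R) (psi : R -> R -> R) (mu : R) : Sset delta mu ->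
  (forall x mu, xL <= x <= xR -> Sset delta mu ->
     filterlim (fun p : R * R => psi (fst p) (snd p))
       (within (fun p : R * R => xL <= fst p <= xR /\ Sset delta (snd p))
          (locally (x, mu)))
       (locally (psi x mu))) ->
  cont_on xL xR (fun x => psi x mu).
Proof.
  intros hmu h x hx P hP. destruct (h x mu hx hmu P hP) as [eps he].
  exists eps. intros y hy hy'. apply (he (y, mu)); [|split; auto].
  split; simpl; auto. apply ball_center.
Qed.

Section Exact.
Context (a b delta : R) (sigT sigS q psiL psiR : R -> R) (psi : R -> R -> R)
  (hab : a < b) (hdelta : 0 < delta < 1)
  (hsigT : cont_on a b sigT) (hsigS : cont_on a b sigS) (hq : cont_on a b q)
  (hsig : forall x, a <= x <= b -> 0 < sigS x < sigT x)
  (hpsiL : bdd_lip_on (fun mu => delta < mu <= 1) psiL)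
  (hpsiR : bdd_lip_on (fun mu => -1 <= mu < -delta) psiR)
  (hpsi : exact_solution a b delta sigT sigS q psiL psiR psi).

Let sT (x : R) : R := sigT (clamp a b x).

Lemma continuous_sT (x : R) : continuous sT x.
Proof. apply continuous_clamp; auto; lra. Qed.

(** The reference direction: [mu = 1] belongs to the velocity set, as [(delta, 1]] is closed
    there. *)
Let w (x : R) : R := psi x 1.

Lemma cont_on_w : cont_on a b w.
Proof.
  destruct hpsi as (h & _). apply (exact_cont_on a b delta psi 1); auto. right. lra.
Qed.

Let wgt (y : R) : R := sT y * w (clamp a b y).

Lemma continuous_wgt (x : R) : continuous wgt x.
Proof.
  apply continuous_mul; [apply continuous_sT|].
  apply continuous_clamp; [lra | apply cont_on_w].
Qed.

(* Subtracting [w / mu] eliminates the scalar flux, whose regularity is not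
   known yet: the source of the equation for the difference is
   [sigT w (1 - 1 / mu)]. *)
Lemma deflated_equation (mu : R) : Sset delta mu -> forall x, a < x < b ->
  exists d, is_derive (fun y => psi y mu - / mu * w y) x d /\
    mu * d + sT x * (psi x mu - / mu * w x) = (1 - / mu) * wgt x.
Proof.
  intros hmu x hx. destruct hpsi as (_ & hode & _).
  destruct (hode x mu hx hmu) as [d [hd1 hd2]].
  destruct (hode x 1 hx) as [d' [hd1' hd2']]; [right; lra|].
  exists (d - / mu * d'). split.
  - apply (is_derive_minus (fun y => psi y mu) (fun y => / mu * w y)); auto.
    apply (is_derive_scal w). exact hd1'.
  - unfold wgt, sT. rewrite clamp_id by lra. rewrite <- hd2 in hd2'. unfold w.
    assert (mu <> 0) by (destruct hmu; lra).
    replace (mu * (d - / mu * d')) with (mu * d - d') by (field; auto).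
    replace d' with (mu * d + sigT x * psi x mu - sigT x * psi x 1) by lra. ring.
Qed.

(** The Duhamel formula for [psi - w / mu]. Only [w], the inflow datum and [1 / mu] occur on the
    right, so the dependence on [mu] is explicit. The redundant factors match the pattern of
    [bdd_lip_duhamel]. *)
Lemma psi_forward (mu x : R) : delta < mu <= 1 -> a <= x <= b ->
  psi x mu = 1 * (/ mu * w x) + (psiL mu + - w a * / mu) * exp (- (tau a sT x * / mu))
    + (1 + (-1) * / mu) * RInt (fun y => wgt y * kappa (Rabs (tau a sT x - tau a sT y)) (/ mu)) a x.
Proof.
  intros hmu hx. pose proof hpsi as (hc & _ & hin & _).
  assert (hS : Sset delta mu) by (right; lra).
  pose proof (duhamel_forward a b sT ltac:(lra) continuous_sT (fun y => (1 - / mu) * wgt y)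
    (fun y => psi y mu - / mu * w y) (/ mu)) as h.
  assert (h' : psi x mu - / mu * w x = (psi a mu - / mu * w a) * exp (- (tau a sT x * / mu))
     + RInt (fun y => (1 - / mu) * wgt y * kappa (tau a sT x - tau a sT y) (/ mu)) a x).
  { apply h; auto.
    - intros y. apply continuous_mul; [apply continuous_const | apply continuous_wgt].
    - apply cont_on_sub; [lra | apply (exact_cont_on a b delta); auto |].
      apply cont_on_mull; [lra | apply cont_on_w].
    - intros y hy. destruct (deflated_equation mu hS y hy) as [d [hd1 hd2]].
      exists d. split; auto. rewrite <- hd2. field. lra. }
  rewrite (RInt_eq (fun y => (1 - / mu) * wgt y * kappa (tau a sT x - tau a sT y) (/ mu))
    (fun y => (1 - / mu) * (wgt y * kappa (Rabs (tau a sT x - tau a sT y)) (/ mu)))) in h'; [|lra|].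
  2: { intros y hy. rewrite Rabs_pos_eq; [ring|].
       pose proof (tau_mono a b sT continuous_sT) as hm.
       assert (tau a sT y <= tau a sT x); [|lra]. apply hm; try lra.
       intros s hs. unfold sT. pose proof (hsig _ (clamp_in a b s ltac:(lra))). lra. }
  rewrite RInt_mull in h'.
  2: { apply ex_RInt_cont. intros y. apply continuous_mul; [apply continuous_wgt|].
       apply continuous_kappa. apply (continuous_comp (fun y => tau a sT x - tau a sT y) Rabs);
         [|apply continuous_Rabs].
       apply continuous_sub; [apply continuous_const | apply continuous_tau, continuous_sT]. }
  rewrite hin in h' by auto. lra.
Qed.

Lemma psi_backward (mu x : R) : -1 <= mu < -delta -> a <= x <= b ->
  psi x mu = (-1) * (- / mu * w x)
    + (psiR mu + w b * - / mu) * exp (- ((tau a sT b - tau a sT x) * - / mu))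
    + (1 + 1 * - / mu) * RInt (fun y => wgt y * kappa (Rabs (tau a sT x - tau a sT y)) (- / mu)) x b.
Proof.
  intros hmu hx. pose proof hpsi as (hc & _ & _ & hin).
  assert (hS : Sset delta mu) by (left; lra).
  pose proof (duhamel_backward a b sT ltac:(lra) continuous_sT (fun y => (1 - / mu) * wgt y)
    (fun y => psi y mu - / mu * w y) (- / mu)) as h.
  assert (h' : psi x mu - / mu * w x
     = (psi b mu - / mu * w b) * exp (- ((tau a sT b - tau a sT x) * - / mu))
     + RInt (fun y => (1 - / mu) * wgt y * kappa (tau a sT y - tau a sT x) (- / mu)) x b).
  { apply h; auto.
    - intros y. apply continuous_mul; [apply continuous_const | apply continuous_wgt].
    - apply cont_on_sub; [lra | apply (exact_cont_on a b delta); auto |].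
      apply cont_on_mull; [lra | apply cont_on_w].
    - intros y hy. destruct (deflated_equation mu hS y hy) as [d [hd1 hd2]].
      exists d. split; auto. rewrite <- hd2. field. lra. }
  rewrite (RInt_eq (fun y => (1 - / mu) * wgt y * kappa (tau a sT y - tau a sT x) (- / mu))
    (fun y => (1 - / mu) * (wgt y * kappa (Rabs (tau a sT x - tau a sT y)) (- / mu)))) in h'; [|lra|].
  2: { intros y hy. rewrite Rabs_minus_sym, Rabs_pos_eq; [ring|].
       pose proof (tau_mono a b sT continuous_sT) as hm.
       assert (tau a sT x <= tau a sT y); [|lra]. apply hm; try lra.
       intros s hs. unfold sT. pose proof (hsig _ (clamp_in a b s ltac:(lra))). lra. }
  rewrite RInt_mull in h'.
  2: { apply ex_RInt_cont. intros y. apply continuous_mul; [apply continuous_wgt|].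
       apply continuous_kappa. apply (continuous_comp (fun y => tau a sT x - tau a sT y) Rabs);
         [|apply continuous_Rabs].
       apply continuous_sub; [apply continuous_const | apply continuous_tau, continuous_sT]. }
  rewrite hin in h' by auto. lra.
Qed.

Lemma bdd_lip_of_bdd_lip_on (D : R -> Prop) (p : R -> R) : (exists u, D u) -> bdd_lip_on D p ->
  bdd_lip (fun v : R * R => a <= fst v <= b /\ D (snd v))
    (fun v v' r => fst v = fst v' /\ Rabs (snd v - snd v') <= r) (fun v => p (snd v)).
Proof.
  intros [u0 hu0] [[M hM] [L hL]]. exists M, (Rabs L). split.
  { eapply Rle_trans; [apply Rabs_pos | apply (hM u0 hu0)]. }
  split; [apply Rabs_pos|]. split.
  - intros v hv. apply hM, hv.
  - intros v v' r hv hv' hr [_ h]. eapply Rle_trans; [apply hL; [apply hv | apply hv']|].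
    eapply Rle_trans; [apply Rmult_le_compat_r; [apply Rabs_pos | apply (Rle_abs L)]|].
    apply Rmult_le_compat_l; [apply Rabs_pos | exact h].
Qed.

Lemma tau_nonneg (x : R) : a <= x <= b -> 0 <= tau a sT x <= tau a sT b.
Proof.
  intros hx.
  assert (hp : forall s, a <= s <= b -> 0 <= sT s).
  { intros s hs. unfold sT. pose proof (hsig _ (clamp_in a b s ltac:(lra))). lra. }
  split.
  - rewrite <- (tau_a a sT) at 1. apply (tau_mono a b); auto using continuous_sT; lra.
  - apply (tau_mono a b); auto using continuous_sT; lra.
Qed.

(** On either half of the velocity set [|mu|] stays above [delta], so [1 / |mu|] is bounded and
    Lipschitz, and the explicit formulas pass this on to [psi], uniformly in the position. *)
Lemma psi_bdd_lip_velocity (D : R -> Prop) :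
  D = (fun mu => delta < mu <= 1) \/ D = (fun mu => -1 <= mu < -delta) ->
  bdd_lip (fun v : R * R => a <= fst v <= b /\ D (snd v))
    (fun v v' r => fst v = fst v' /\ Rabs (snd v - snd v') <= r) (fun v => psi (fst v) (snd v)).
Proof.
  assert (hct : cont_on a b (tau a sT)).
  { apply cont_on_of_continuous. intros x. apply continuous_tau, continuous_sT. }
  assert (hid : bdd_lip_on D (fun mu => mu) -> (exists u, D u) -> forall k, (k = 1 \/ k = -1) ->
      (forall u, D u -> delta <= k * u) ->
      bdd_lip (fun v : R * R => a <= fst v <= b /\ D (snd v))
    (fun v v' r => fst v = fst v' /\ Rabs (snd v - snd v') <= r) (fun v => / (k * snd v))).
  { intros h1 h2 k _ hk. apply bdd_lip_inv with delta; [lra | intros v hv; apply hk, hv|].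
    apply bdd_lip_mull. apply (bdd_lip_of_bdd_lip_on D (fun u => u)); auto. }
  intros [-> | ->].
  - eapply bdd_lip_eq.
    { intros v hv. symmetry. apply psi_forward; apply hv. }
    apply (bdd_lip_duhamel a b ltac:(lra) sT continuous_sT (fun mu => delta < mu <= 1)
      (fun mu => / mu) psiL w wgt (tau a sT) (fun _ => a) (fun x => x) 1 (-1) (- w a)); auto using cont_on_w, continuous_wgt.
    + intros u hu. left. apply Rinv_0_lt_compat. lra.
    + apply bdd_lip_eq with (fun v => / (1 * snd v)).
      { intros v _. rewrite Rmult_1_l. reflexivity. }
      apply hid; auto; try (intros; lra).
      * split; [exists 1; intros u hu; apply Rabs_le; lra | exists 1; intros; lra].
      * exists 1; lra.
    + apply (bdd_lip_of_bdd_lip_on (fun mu => delta < mu <= 1) psiL); auto. exists 1; lra.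
    + intros x hx. apply tau_nonneg; auto.
    + intros; lra.
  - eapply bdd_lip_eq.
    { intros v hv. symmetry. apply psi_backward; apply hv. }
    apply (bdd_lip_duhamel a b ltac:(lra) sT continuous_sT (fun mu => -1 <= mu < - delta)
      (fun mu => - / mu) psiR w wgt (fun x => tau a sT b - tau a sT x) (fun x => x) (fun _ => b)
      (-1) 1 (w b)); auto using cont_on_w, continuous_wgt.
    + intros u hu. rewrite <- Rinv_opp. left. apply Rinv_0_lt_compat. lra.
    + apply bdd_lip_eq with (fun v => / (-1 * snd v)).
      { intros v hv. rewrite <- Rinv_opp. f_equal. ring. }
      apply hid; auto; try (intros; lra).
      * split; [exists 1; intros u hu; apply Rabs_le; lra | exists 1; intros; lra].
      * exists (-1); lra.
    + apply (bdd_lip_of_bdd_lip_on (fun mu => -1 <= mu < - delta) psiR); auto. exists (-1); lra.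
    + apply cont_on_sub; auto; try lra. apply cont_on_of_continuous. intros; apply continuous_const.
    + intros x hx. pose proof (tau_nonneg x hx). lra.
    + intros; lra.
Qed.

(** The two halves of the velocity set carry unrelated inflow data, so [psi] is compared only at
    velocities of equal sign. *)
Definition same_side (mu mu' : R) : Prop :=
  (delta < mu <= 1 /\ delta < mu' <= 1) \/ (-1 <= mu < -delta /\ -1 <= mu' < -delta).

(** A bootstrap: regularity in the velocity makes [psi x] integrable and the flux bounded; the
    transport equation then bounds the space derivative of [psi]; averaging over velocities gives
    the Lipschitz bound on the flux. *)
Lemma exact_regularity : exists M L, 0 <= M /\ 0 <= L /\
  (forall x mu, a <= x <= b -> Sset delta mu -> Rabs (psi x mu) <= M) /\
  (forall x x' mu mu', a <= x <= b -> a <= x' <= b -> same_side mu mu' ->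
     Rabs (psi x mu - psi x' mu') <= L * (Rabs (x - x') + Rabs (mu - mu'))) /\
  (forall x x', a <= x <= b -> a <= x' <= b ->
     Rabs (phi_exact delta psi x - phi_exact delta psi x') <= L * Rabs (x - x')).
Proof.
  destruct (psi_bdd_lip_velocity _ (or_introl eq_refl)) as (M1 & L1 & hM1 & hL1 & p1 & p2).
  destruct (psi_bdd_lip_velocity _ (or_intror eq_refl)) as (M2 & L2 & hM2 & hL2 & q1 & q2).
  set (M := M1 + M2). set (L := L1 + L2).
  assert (hM : forall x mu, a <= x <= b -> Sset delta mu -> Rabs (psi x mu) <= M).
  { intros x mu hx [h|h]; unfold M.
    - specialize (q1 (x, mu) (conj hx h)). simpl in q1. lra.
    - specialize (p1 (x, mu) (conj hx h)). simpl in p1. lra. }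
  assert (hL : forall x mu mu', a <= x <= b -> same_side mu mu' ->
     Rabs (psi x mu - psi x mu') <= L * Rabs (mu - mu')).
  { intros x mu mu' hx [[h h']|[h h']]; unfold L; pose proof (Rabs_pos (mu - mu')) as hr.
    - specialize (p2 (x, mu) (x, mu') _ (conj hx h) (conj hx h') hr (conj eq_refl (Rle_refl _))).
      simpl in p2. nra.
    - specialize (q2 (x, mu) (x, mu') _ (conj hx h) (conj hx h') hr (conj eq_refl (Rle_refl _))).
      simpl in q2. nra. }
  assert (hex : forall x, a <= x <= b ->
    ex_RInt (psi x) (-1) (-delta) /\ ex_RInt (psi x) delta 1).
  { intros x hx. split; apply ex_RInt_lipschitz with L; unfold L; try lra;
      intros u v hu hv; apply hL; auto; [right | left]; lra. }
  assert (hfint : forall f N, ex_RInt f (-1) (-delta) -> ex_RInt f delta 1 ->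
     (forall mu, Sset delta mu -> Rabs (f mu) <= N) -> Rabs (fint_S delta f) <= N).
  { intros f N h1 h2 h. unfold fint_S.
    assert (e1 : Rabs (RInt f (-1) (-delta)) <= (-delta - -1) * N).
    { apply RInt_Rabs_le; auto; try lra. intros u hu. apply h. left. lra. }
    assert (e2 : Rabs (RInt f delta 1) <= (1 - delta) * N).
    { apply RInt_Rabs_le; auto; try lra. intros u hu. apply h. right. lra. }
    unfold Rdiv. rewrite Rabs_mult, Rabs_inv, (Rabs_pos_eq (2 * (1 - delta))) by lra.
    apply Rmult_le_reg_r with (2 * (1 - delta)); [lra|].
    rewrite Rmult_assoc, Rinv_l, Rmult_1_r by lra.
    eapply Rle_trans; [apply Rabs_triang | lra]. }
  assert (hphi : forall x, a <= x <= b -> Rabs (phi_exact delta psi x) <= M).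
  { intros x hx. destruct (hex x hx). apply hfint; auto. }
  destruct (cont_on_bounded a b sigT ltac:(lra) hsigT) as [T [hT hTb]].
  destruct (cont_on_bounded a b sigS ltac:(lra) hsigS) as [S [hS hSb]].
  destruct (cont_on_bounded a b q ltac:(lra) hq) as [Q [hQ hQb]].
  (* Bounds the space derivative: solve the equation for [mu * d] and use [|mu| >= delta]. *)
  set (N := / delta * (S * M + Q + T * M)).
  assert (hM0 : 0 <= M) by (unfold M; lra).
  assert (hN : 0 <= N).
  { unfold N. apply Rmult_le_pos; [left; apply Rinv_0_lt_compat; lra|].
    repeat apply Rplus_le_le_0_compat; auto; apply Rmult_le_pos; auto. }
  assert (hx : forall mu x x', Sset delta mu -> a <= x <= b -> a <= x' <= b ->
     Rabs (psi x mu - psi x' mu) <= N * Rabs (x - x')).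
  { intros mu x x' hmu hx hx'. pose proof hpsi as (hc & hode & _).
    apply (mvt_Rabs a b N (fun y => psi y mu)); auto; [lra | apply (exact_cont_on a b delta); auto|].
    intros y hy. destruct (hode y mu hy hmu) as [d [hd1 hd2]]. exists d. split; auto.
    assert (hmu' : delta <= Rabs mu).
    { destruct hmu; [rewrite Rabs_left | rewrite Rabs_right]; lra. }
    assert (hd : Rabs mu * Rabs d <= S * M + Q + T * M).
    { rewrite <- Rabs_mult. replace (mu * d) with
        (sigS y * phi_exact delta psi y + q y + - (sigT y * psi y mu)) by (unfold phi_exact; lra).
      eapply Rle_trans; [apply Rabs_triang|]. rewrite Rabs_Ropp.
      apply Rplus_le_compat; [eapply Rle_trans; [apply Rabs_triang|]; apply Rplus_le_compat|].
      - rewrite Rabs_mult. apply Rmult_le_compat; auto using Rabs_pos; [apply hSb | apply hphi]; lra.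
      - apply hQb; lra.
      - rewrite Rabs_mult. apply Rmult_le_compat; auto using Rabs_pos; [apply hTb | apply hM]; auto; lra. }
    unfold N. apply Rmult_le_reg_l with delta; [lra|].
    rewrite <- Rmult_assoc, Rinv_r, Rmult_1_l by lra. pose proof (Rabs_pos d). nra. }
  exists M, (L + N). repeat split; auto.
  - unfold L. lra.
  - intros x x' mu mu' h1 h2 hs.
    replace (psi x mu - psi x' mu') with ((psi x mu - psi x mu') + (psi x mu' - psi x' mu')) by ring.
    eapply Rle_trans; [apply Rabs_triang|].
    specialize (hL x mu mu' h1 hs). specialize (hx mu' x x').
    assert (hs' : Sset delta mu') by (destruct hs as [[_ ?]|[_ ?]]; [right | left]; lra).
    specialize (hx hs' h1 h2). unfold L in *. pose proof (Rabs_pos (x - x')).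
    pose proof (Rabs_pos (mu - mu')). nra.
  - intros x x' h1 h2. destruct (hex x h1), (hex x' h2).
    replace (phi_exact delta psi x - phi_exact delta psi x') with
      (fint_S delta (fun nu => psi x nu - psi x' nu)).
    2: { unfold phi_exact, fint_S. rewrite !(RInt_sub (fun nu => psi x nu) (fun nu => psi x' nu)) by auto. field. lra. }
    eapply Rle_trans; [apply hfint with (N := N * Rabs (x - x'))|].
    + apply ex_RInt_sub; auto.
    + apply ex_RInt_sub; auto.
    + intros mu hmu. apply hx; auto.
    + unfold L. pose proof (Rabs_pos (x - x')). nra.
Qed.

End Exact.

(** * Stratified sampling *)

Lemma sum_n_m_psum (f : nat -> R) (n : nat) : sum_n_m f 1 n = psum f n.
Proof.
  induction n as [|n IH]; simpl.
  - rewrite sum_n_m_zero by lia. reflexivity.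
  - rewrite sum_n_Sm by lia. rewrite IH. reflexivity.
Qed.

(** Pairs [l] with its mirror index [2m + 1 - l]; the induction takes terms one by one from the
    upper end until [m] remain. *)
Lemma psum_fold (f : nat -> R) (m : nat) :
  psum f (2 * m) = psum (fun l => f l + f (2 * m + 1 - l)%nat) m.
Proof.
  assert (h : forall j, (j <= 2 * m)%nat ->
    psum f (2 * m) = psum f (2 * m - j) + psum (fun l => f (2 * m + 1 - l)%nat) j).
  { induction j as [|j IH]; intros hj.
    - rewrite Nat.sub_0_r. cbn [psum]. ring.
    - rewrite IH by lia. replace (psum f (2 * m - j))
        with (psum f (2 * m - S j) + f (2 * m + 1 - S j)%nat).
      + cbn [psum]. ring.
      + replace (2 * m - j)%nat with (S (2 * m - S j)) by lia.
        replace (2 * m + 1 - S j)%nat with (S (2 * m - S j)) by lia. reflexivity. }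
  rewrite (h m) by lia. replace (2 * m - m)%nat with m by lia. symmetry. apply psum_add.
Qed.

Section Sampling.
Context (delta : R) (m : nat) (t : nat -> R) (hdelta : 0 < delta < 1) (hgrid : grid delta m t).

(** The weight shared by a negative ordinate and its mirror image, written without the case
    distinction of [omega]. *)
Definition wt (l : nat) : R := (t l - t (pred l)) / (2 * (1 - delta)).

Lemma grid_lt (i : nat) : (i < m)%nat -> t i < t (S i).
Proof. apply hgrid. Qed.

Lemma grid_le (i j : nat) : (i <= j <= m)%nat -> t i <= t j.
Proof.
  intros [hij hj]. induction hij as [|j hij IH]; [lra|].
  pose proof (grid_lt j ltac:(lia)). specialize (IH ltac:(lia)). lra.
Qed.

Lemma cell_lt (l : nat) : (1 <= l <= m)%nat -> t (pred l) < t l.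
Proof. intros hl. pose proof (grid_lt (pred l) ltac:(lia)) as h. replace (S (pred l)) with l in h by lia. exact h. Qed.

Lemma cell_bounds (l : nat) : (1 <= l <= m)%nat -> -1 <= t (pred l) /\ t l <= - delta.
Proof.
  intros hl. destruct hgrid as (h0 & h1 & _). rewrite <- h0, <- h1. split; apply grid_le; lia.
Qed.

Lemma box_velocity (mu : nat -> R) (l : nat) : box t 0 m mu -> (1 <= l <= m)%nat ->
  -1 <= mu l < - delta.
Proof.
  intros hmu hl. specialize (hmu l hl). pose proof (cell_bounds l hl). lra.
Qed.

Lemma wt_pos (l : nat) : (1 <= l <= m)%nat -> 0 < wt l.
Proof. intros hl. pose proof (cell_lt l hl). apply Rdiv_lt_0_compat; lra. Qed.

Lemma psum_wt : psum wt m = 1 / 2.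
Proof.
  assert (h : forall k, psum wt k = (t k - t O) / (2 * (1 - delta))).
  { induction k as [|k IH]; simpl; [field; lra|]. rewrite IH. unfold wt. simpl. field. lra. }
  rewrite h. destruct hgrid as (h0 & h1 & _). rewrite h0, h1. field. lra.
Qed.

Lemma omega_wt (l : nat) : (1 <= l <= m)%nat ->
  omega delta m t l = wt l /\ omega delta m t (2 * m + 1 - l) = wt l.
Proof.
  intros hl. unfold omega, wt. split.
  - replace (Nat.leb l m) with true; auto. symmetry. apply Nat.leb_le. lia.
  - replace (Nat.leb (2 * m + 1 - l) m) with false by (symmetry; apply Nat.leb_gt; lia).
    replace (2 * m + 1 - (2 * m + 1 - l))%nat with l by lia. reflexivity.
Qed.

Lemma ordinate_wt (mu : nat -> R) (l : nat) : (1 <= l <= m)%nat ->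
  ordinate m mu l = mu l /\ ordinate m mu (2 * m + 1 - l) = - mu l.
Proof.
  intros hl. unfold ordinate. split.
  - replace (Nat.leb l m) with true; auto. symmetry. apply Nat.leb_le. lia.
  - replace (Nat.leb (2 * m + 1 - l) m) with false by (symmetry; apply Nat.leb_gt; lia).
    replace (2 * m + 1 - (2 * m + 1 - l))%nat with l by lia. reflexivity.
Qed.

Lemma phi_rom_fold (P : nat -> R -> R) (x : R) :
  phi_rom delta m t P x = psum (fun l => wt l * (P l x + P (2 * m + 1 - l)%nat x)) m.
Proof.
  unfold phi_rom. rewrite sum_n_m_psum, psum_fold. apply psum_eq. intros l hl.
  destruct (omega_wt l hl) as [-> ->]. ring.
Qed.

Lemma RInt_cells (f : R -> R) : (forall l, (1 <= l <= m)%nat -> ex_RInt f (t (pred l)) (t l)) ->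
  psum (fun l => RInt f (t (pred l)) (t l)) m = RInt f (-1) (- delta).
Proof.
  intros hf.
  assert (h : forall k, (k <= m)%nat -> ex_RInt f (t O) (t k) /\
    psum (fun l => RInt f (t (pred l)) (t l)) k = RInt f (t O) (t k)).
  { induction k as [|k IH]; intros hk; simpl.
    - split; [apply ex_RInt_point | symmetry; exact (RInt_point (t O) f)].
    - destruct IH as [IH1 IH2]; [lia|]. specialize (hf (S k) ltac:(lia)). simpl in hf. split.
      + apply ex_RInt_Chasles with (t k); auto.
      + rewrite IH2. apply RInt_split; auto. }
  destruct hgrid as (h0 & h1 & _). rewrite <- h0, <- h1. apply h. auto.
Qed.

(** * Stratified average of one function of the velocity *)

Section Observable.
Context (g : R -> R) (M L : R) (hM : 0 <= M) (hL : 0 <= L)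
  (gM : forall u, -1 <= u < - delta -> Rabs (g u) <= M)
  (gL : forall u v, -1 <= u < - delta -> -1 <= v < - delta -> Rabs (g u - g v) <= L * Rabs (u - v)).

Lemma ex_RInt_cell (l : nat) : (1 <= l <= m)%nat -> ex_RInt g (t (pred l)) (t l).
Proof.
  intros hl. pose proof (cell_lt l hl). pose proof (cell_bounds l hl).
  apply ex_RInt_lipschitz with L; auto; [lra|]. intros u v hu hv. apply gL; lra.
Qed.

Definition avg (l : nat) : R := RInt g (t (pred l)) (t l) / (t l - t (pred l)).

Lemma avg_close (l : nat) (u : R) : (1 <= l <= m)%nat -> t (pred l) < u < t l ->
  Rabs (g u - avg l) <= L * (t l - t (pred l)).
Proof.
  intros hl hu. pose proof (cell_lt l hl). pose proof (cell_bounds l hl).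
  pose proof (ex_RInt_cell l hl) as hex.
  replace (g u - avg l) with (RInt (fun v => g u - g v) (t (pred l)) (t l) / (t l - t (pred l))).
  2: { rewrite RInt_sub, RInt_cst; auto using ex_RInt_const. unfold avg. field. lra. }
  unfold Rdiv. rewrite Rabs_mult, Rabs_inv, (Rabs_pos_eq (t l - t (pred l))) by lra.
  apply Rmult_le_reg_r with (t l - t (pred l)); [lra|].
  rewrite Rmult_assoc, Rinv_l, Rmult_1_r, Rmult_comm by lra.
  apply RInt_Rabs_le; [lra | apply ex_RInt_sub; auto using ex_RInt_const |].
  intros v hv. eapply Rle_trans; [apply gL; lra|].
  apply Rmult_le_compat_l; auto. apply Rabs_le. lra.
Qed.

Lemma random_observable :
  bdd_lip (box t 0 m) (cdist 0 m) (fun mu => psum (fun l => wt l * g (mu l)) m).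
Proof.
  apply (bdd_lip_psum _ _ (fun l mu => wt l * g (mu l))). intros l hl. apply bdd_lip_mull.
  exists M, L. repeat split; auto.
  - intros mu hmu. apply gM, (box_velocity mu l hmu hl).
  - intros mu nu r hmu hnu hr hd. eapply Rle_trans.
    { apply gL; [apply (box_velocity mu l hmu hl) | apply (box_velocity nu l hnu hl)]. }
    apply Rmult_le_compat_l; auto.
Qed.

(** The centered term of cell [l]. Stratification makes it small twice: once through the weight,
    once through the oscillation of [g] over a short cell. *)
Let u (l : nat) (v : R) : R := wt l * (g v - avg l).

Lemma observable_centered (mu : nat -> R) : psum (fun l => wt l * g (mu l)) m =
  psum (fun l => u l (mu l)) m + psum (fun l => wt l * avg l) m.
Proof. rewrite <- psum_add. apply psum_eq. intros l _. unfold u. ring. Qed.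

Lemma u_centered (l : nat) : (1 <= l <= m)%nat ->
  ex_RInt (u l) (t (pred l)) (t l) /\ RInt (u l) (t (pred l)) (t l) = 0.
Proof.
  intros hl. pose proof (cell_lt l hl). pose proof (ex_RInt_cell l hl) as hex. unfold u. split.
  - apply ex_RInt_mull, ex_RInt_sub; auto using ex_RInt_const.
  - rewrite RInt_mull, RInt_sub, RInt_cst; auto using ex_RInt_sub, ex_RInt_const.
    match goal with |- ?p = ?q => change (@eq R p q) end. unfold avg. field. lra.
Qed.

Lemma random_centered : bdd_lip (box t 0 m) (cdist 0 m) (fun mu => psum (fun l => u l (mu l)) m).
Proof.
  apply bdd_lip_eq with (fun mu => psum (fun l => wt l * g (mu l)) m - psum (fun l => wt l * avg l) m).
  { intros mu _. rewrite observable_centered. ring. }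
  apply bdd_lip_sub; [apply random_observable | apply bdd_lip_const].
Qed.

Lemma Expect_observable :
  Expect t m (fun mu => psum (fun l => wt l * g (mu l)) m) = psum (fun l => wt l * avg l) m.
Proof.
  rewrite (Expect_ext t m grid_lt _ (fun mu => psum (fun l => u l (mu l)) m + psum (fun l => wt l * avg l) m))
    by (intros; apply observable_centered).
  rewrite (Expect_add t m grid_lt), (Expect_const t m grid_lt) by auto using random_centered, bdd_lip_const.
  rewrite (Expect_sum_centered t m grid_lt) by apply u_centered. ring.
Qed.

(** A cell has length [2 (1 - delta) wt l <= 2 wt l], so [g] deviates from its mean by at most
    [2 L W], and each weighted term by [2 L W^2]. With [W] of order [1 / n], [m] such terms give a
    variance of order [n^-3]. *)
Lemma Expect_observable_variance (W : R) : (forall l, (1 <= l <= m)%nat -> wt l <= W) ->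
  Expect t m (fun mu => (psum (fun l => wt l * g (mu l)) m
     - Expect t m (fun nu => psum (fun l => wt l * g (nu l)) m)) ^ 2)
  <= INR m * (2 * L * W ^ 2) ^ 2.
Proof.
  intros hW. rewrite Expect_observable.
  rewrite (Expect_ext t m grid_lt _ (fun mu => (psum (fun l => u l (mu l)) m) ^ 2)).
  2: { intros mu _. rewrite observable_centered. f_equal. ring. }
  apply (Expect_sum_centered_sq t m grid_lt u).
  - intros l hl v hv. unfold u. pose proof (wt_pos l hl). specialize (hW l hl).
    rewrite Rabs_mult, (Rabs_pos_eq (wt l)) by lra.
    pose proof (avg_close l v hl hv) as h.
    replace (t l - t (pred l)) with (2 * (1 - delta) * wt l) in h by (unfold wt; field; lra).
    assert (h' : Rabs (g v - avg l) <= 2 * L * wt l).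
    { eapply Rle_trans; [exact h|].
      assert (0 <= L * wt l) by nra. assert (0 <= L * wt l * delta) by nra. nra. }
    apply Rle_trans with (wt l * (2 * L * wt l)).
    + apply Rmult_le_compat_l; lra.
    + assert (wt l * wt l <= W ^ 2) by nra. nra.
  - apply u_centered.
  - apply (bdd_lip_pow2 _ _ (fun mu => psum (fun l => u l (mu l)) m)), random_centered.
Qed.

End Observable.
End Sampling.

(** * The error equation and the energy estimate *)

Definition rom_error (delta : R) (m : nat) (t : nat -> R) (psi : R -> R -> R)
    (P : nat -> R -> R) (x : R) : R :=
  phi_rom delta m t P x - phi_exact delta psi x.

Definition sampling_error (delta : R) (m : nat) (t : nat -> R) (psi : R -> R -> R)
    (mu : nat -> R) (x : R) : R :=
  psum (fun l => wt delta t l * (psi x (mu l) + psi x (- mu l))) m - phi_exact delta psi x.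

(** The kernel of the operator with respect to the measure [sS y dy]; leaving [sS] out keeps the
    kernel Lipschitz. The index [l] stands for the pair of velocities [mu l] and [- mu l]. *)
Definition rom_kernel (delta : R) (m : nat) (t : nat -> R) (tau_ : R -> R)
    (mu : nat -> R) (x y : R) : R :=
  psum (fun l => wt delta t l * kappa (Rabs (tau_ x - tau_ y)) (/ - mu l)) m.

Lemma cont_on_psum (a b : R) (F : nat -> R -> R) (n : nat) : a <= b ->
  (forall l, (1 <= l <= n)%nat -> cont_on a b (F l)) ->
  cont_on a b (fun x => psum (fun l => F l x) n).
Proof.
  intros hab. induction n as [|n IH]; intros h; simpl.
  - apply cont_on_of_continuous. intros x. apply continuous_const.
  - apply cont_on_add; [auto | apply IH; intros l hl; apply h; lia | apply h; lia].
Qed.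

Lemma cont_on_mul (a b : R) (f g : R -> R) : a <= b ->
  cont_on a b f -> cont_on a b g -> cont_on a b (fun x => f x * g x).
Proof.
  intros hab hf hg.
  apply cont_on_eq with (fun x => f (clamp a b x) * g (clamp a b x)).
  { intros x hx. rewrite clamp_id; auto. }
  apply cont_on_of_continuous. intros x. apply continuous_mul; apply continuous_clamp; auto.
Qed.

Lemma cont_on_pow2 (a b : R) (f : R -> R) : a <= b ->
  cont_on a b f -> cont_on a b (fun x => f x ^ 2).
Proof.
  intros hab hf. apply cont_on_eq with (fun x => f x * f x); [intros; ring|].
  apply cont_on_mul; auto.
Qed.

Section Rom.
Context (a b delta lam : R) (sigT sigS q psiL psiR : R -> R) (psi : R -> R -> R) (sT sS : R -> R)
  (hab : a < b) (hdelta : 0 < delta < 1) (hlam : 0 < lam < 1)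
  (hsT : forall x, continuous sT x) (hsS : forall x, continuous sS x)
  (eT : forall x, a <= x <= b -> sT x = sigT x) (eS : forall x, a <= x <= b -> sS x = sigS x)
  (hsig : forall x, a <= x <= b -> 0 < sS x /\ 0 < sT x /\ sS x <= lam * sT x)
  (hpsi : exact_solution a b delta sigT sigS q psiL psiR psi)
  (hphi : cont_on a b (phi_exact delta psi)).
Context (m : nat) (t : nat -> R) (hgrid : grid delta m t) (mu : nat -> R) (P : nat -> R -> R)
  (hmu : box t 0 m mu) (hrom : rom_solution a b delta sigT sigS q psiL psiR m t mu P).

Notation e := (rom_error delta m t psi P).
Notation Z := (sampling_error delta m t psi mu).
Notation K := (rom_kernel delta m t (tau a sT) mu).
Notation w := (wt delta t).

(** Angular errors: [el] along the negative ordinate, with inflow at [b], and [er] along its mirror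
    image, with inflow at [a]. *)
Let el (l : nat) (x : R) : R := P l x - psi x (mu l).
Let er (l : nat) (x : R) : R := P (2 * m + 1 - l)%nat x - psi x (- mu l).

Lemma velocity_in (l : nat) : (1 <= l <= m)%nat ->
  mu l < 0 /\ delta < - mu l /\ Sset delta (mu l) /\ Sset delta (- mu l).
Proof.
  intros hl. pose proof (hmu l hl). pose proof (cell_bounds delta m t hgrid l hl).
  repeat split; try lra; [left | right]; lra.
Qed.

Lemma cont_on_psi (nu : R) : Sset delta nu -> cont_on a b (fun x => psi x nu).
Proof. intros h. apply (exact_cont_on a b delta); auto. apply hpsi. Qed.

Lemma cont_on_el (l : nat) : (1 <= l <= m)%nat -> cont_on a b (el l).
Proof.
  intros hl. apply cont_on_sub; [lra | apply (hrom l); lia | apply cont_on_psi, velocity_in, hl].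
Qed.

Lemma cont_on_er (l : nat) : (1 <= l <= m)%nat -> cont_on a b (er l).
Proof.
  intros hl. apply cont_on_sub; [lra | apply (hrom (2 * m + 1 - l)%nat); lia |
    apply cont_on_psi, velocity_in, hl].
Qed.

Lemma rom_error_split (x : R) : e x = psum (fun l => w l * (el l x + er l x)) m + Z x.
Proof.
  unfold rom_error, sampling_error. rewrite phi_rom_fold. unfold Rminus.
  rewrite <- Rplus_assoc, <- psum_add. f_equal. apply psum_eq. intros l hl.
  unfold el, er. ring.
Qed.

Lemma cont_on_Z : cont_on a b Z.
Proof.
  apply cont_on_sub; [lra | | exact hphi].
  apply (cont_on_psum a b (fun l x => w l * (psi x (mu l) + psi x (- mu l)))); [lra|].
  intros l hl. apply cont_on_mull; [lra|].
  apply cont_on_add; [lra | |]; apply cont_on_psi, velocity_in, hl.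
Qed.

Lemma cont_on_rom_error : cont_on a b e.
Proof.
  apply cont_on_eq with (fun x => psum (fun l => w l * (el l x + er l x)) m + Z x).
  { intros x _. symmetry. apply rom_error_split. }
  apply cont_on_add; [lra | | apply cont_on_Z].
  apply (cont_on_psum a b (fun l x => w l * (el l x + er l x))); [lra|].
  intros l hl. apply cont_on_mull; [lra|].
  apply cont_on_add; auto using cont_on_el, cont_on_er. lra.
Qed.

(** Both solutions share [q] and the inflow data, so all angular errors solve a transport equation
    with this one source and zero inflow. *)
Let f (y : R) : R := sS y * e (clamp a b y).

Lemma continuous_f (y : R) : continuous f y.
Proof.
  apply continuous_mul; auto. apply continuous_clamp; [lra | apply cont_on_rom_error].
Qed.

Lemma el_equation (l : nat) (x : R) : (1 <= l <= m)%nat -> a < x < b ->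
  exists d, is_derive (el l) x d /\ mu l * d + sT x * el l x = f x.
Proof.
  intros hl hx. destruct (velocity_in l hl) as (_ & _ & hS & _).
  destruct hpsi as (_ & hode & _). destruct (hode x (mu l) hx hS) as [d [hd1 hd2]].
  destruct (hrom l ltac:(lia)) as (_ & hode' & _). destruct (hode' x hx) as [d' [hd1' hd2']].
  destruct (ordinate_wt m mu l hl) as [e1 _]. rewrite e1 in hd2'.
  exists (d' - d). split.
  - apply (is_derive_minus (P l) (fun y => psi y (mu l))); auto.
  - unfold f, el, rom_error, phi_exact. rewrite clamp_id, eT, eS by lra. lra.
Qed.

Lemma er_equation (l : nat) (x : R) : (1 <= l <= m)%nat -> a < x < b ->
  exists d, is_derive (er l) x d /\ - mu l * d + sT x * er l x = f x.
Proof.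
  intros hl hx. destruct (velocity_in l hl) as (_ & _ & _ & hS).
  destruct hpsi as (_ & hode & _). destruct (hode x (- mu l) hx hS) as [d [hd1 hd2]].
  destruct (hrom (2 * m + 1 - l)%nat ltac:(lia)) as (_ & hode' & _).
  destruct (hode' x hx) as [d' [hd1' hd2']].
  destruct (ordinate_wt m mu l hl) as [_ e1]. rewrite e1 in hd2'.
  exists (d' - d). split.
  - apply (is_derive_minus (P (2 * m + 1 - l)%nat) (fun y => psi y (- mu l))); auto.
  - unfold f, er, rom_error, phi_exact. rewrite clamp_id, eT, eS by lra. lra.
Qed.

Lemma el_b (l : nat) : (1 <= l <= m)%nat -> el l b = 0.
Proof.
  intros hl. destruct (velocity_in l hl) as (h1 & h2 & _).
  destruct (hrom l ltac:(lia)) as (_ & _ & _ & h). destruct hpsi as (_ & _ & _ & h').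
  destruct (ordinate_wt m mu l hl) as [e1 _]. rewrite e1 in h.
  pose proof (hmu l hl). pose proof (cell_bounds delta m t hgrid l hl).
  unfold el. rewrite h, h'; lra.
Qed.

Lemma er_a (l : nat) : (1 <= l <= m)%nat -> er l a = 0.
Proof.
  intros hl. destruct (velocity_in l hl) as (h1 & h2 & _).
  destruct (hrom (2 * m + 1 - l)%nat ltac:(lia)) as (_ & _ & h & _). destruct hpsi as (_ & _ & h' & _).
  destruct (ordinate_wt m mu l hl) as [_ e1]. rewrite e1 in h.
  pose proof (hmu l hl). pose proof (cell_bounds delta m t hgrid l hl).
  unfold er. rewrite h, h'; lra.
Qed.

Lemma sT_nonneg (x : R) : a <= x <= b -> 0 <= sT x.
Proof. intros hx. specialize (hsig x hx). lra. Qed.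

Lemma continuous_kernel_slice (x z y : R) :
  continuous (fun y => kappa (Rabs (tau a sT x - tau a sT y)) z) y.
Proof.
  apply (continuous_kappa (fun y => Rabs (tau a sT x - tau a sT y))).
  apply (continuous_comp (fun y => tau a sT x - tau a sT y) Rabs); [|apply continuous_Rabs].
  apply continuous_sub; [apply continuous_const | apply continuous_tau, hsT].
Qed.

Lemma el_er_duhamel (l : nat) (x : R) : (1 <= l <= m)%nat -> a <= x <= b ->
  el l x + er l x = RInt (fun y => f y * kappa (Rabs (tau a sT x - tau a sT y)) (/ - mu l)) a b.
Proof.
  intros hl hx. destruct (velocity_in l hl) as (h1 & h2 & _).
  rewrite <- RInt_kappa_abs by (try lra; auto using continuous_f, sT_nonneg).
  rewrite (duhamel_backward a b sT ltac:(lra) hsT f (el l) (/ - mu l)); auto using continuous_f, cont_on_el.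
  2: { intros y hy. destruct (el_equation l y hl hy) as [d [hd1 hd2]]. exists d. split; auto.
       rewrite <- hd2. field. lra. }
  rewrite (duhamel_forward a b sT ltac:(lra) hsT f (er l) (/ - mu l)); auto using continuous_f, cont_on_er.
  2: { intros y hy. destruct (er_equation l y hl hy) as [d [hd1 hd2]]. exists d. split; auto.
       rewrite <- hd2. field. lra. }
  rewrite el_b, er_a by auto. ring.
Qed.

Lemma rom_error_equation (x : R) : a <= x <= b ->
  e x = RInt (fun y => sS y * (e (clamp a b y) * K x y)) a b + Z x.
Proof.
  intros hx. rewrite rom_error_split at 1. f_equal.
  rewrite (RInt_ext_all _ (fun y => psum (fun l => w l *
     (f y * kappa (Rabs (tau a sT x - tau a sT y)) (/ - mu l))) m)).
  2: { intros y. unfold rom_kernel. rewrite <- psum_mull, <- psum_mull.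
       apply psum_eq. intros l _. unfold f. ring. }
  destruct (RInt_psum (fun l y => w l * (f y * kappa (Rabs (tau a sT x - tau a sT y)) (/ - mu l)))
    a b m) as [_ ->].
  { intros l _. apply ex_RInt_mull, ex_RInt_cont. intros y.
    apply continuous_mul; [apply continuous_f | apply continuous_kernel_slice]. }
  apply psum_eq. intros l hl. rewrite RInt_mull, el_er_duhamel; auto.
  apply ex_RInt_cont. intros y.
  apply continuous_mul; [apply continuous_f | apply continuous_kernel_slice].
Qed.

Lemma ex_RInt_weighted_sq (u : R -> R) : cont_on a b u -> ex_RInt (fun x => sT x * u x ^ 2) a b.
Proof.
  intros hu. apply (ex_RInt_cont_on a b); try lra.
  apply cont_on_mul; [lra | apply cont_on_of_continuous; auto | apply cont_on_pow2; auto; lra].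
Qed.

Notation norm2 u := (RInt (fun x => sT x * u x ^ 2) a b).

(* From the energy inequality [norm2 u <= int sS e u] and [sS <= lam sT],
   through [|e u| <= (e^2 + u^2) / 2]. *)
Lemma angular_error_norm (u : R -> R) (nu : R) : cont_on a b u ->
  (forall x, a < x < b -> exists d, is_derive u x d /\ nu * d + sT x * u x = f x) ->
  (0 < nu -> u a = 0) -> (nu < 0 -> u b = 0) -> norm2 u <= lam * norm2 e.
Proof.
  intros hu hode h1 h2.
  pose proof (energy a b sT ltac:(lra) hsT f u nu continuous_f hu hode h1 h2) as h.
  assert (h' : RInt (fun x => f x * u x) a b <= lam / 2 * norm2 e + lam / 2 * norm2 u).
  { rewrite <- !RInt_mull, <- RInt_add;
      auto using ex_RInt_mull, ex_RInt_weighted_sq, cont_on_rom_error.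
    apply RInt_le; [lra | | |].
    - apply (ex_RInt_cont_on a b); try lra. apply cont_on_mul; auto; [lra|].
      apply cont_on_of_continuous, continuous_f.
    - apply ex_RInt_add; apply ex_RInt_mull; auto using ex_RInt_weighted_sq, cont_on_rom_error.
    - intros x hx. unfold f. rewrite clamp_id by lra. destruct (hsig x ltac:(lra)) as (s1 & s2 & s3).
      pose proof (pow2_ge_0 (e x - u x)). pose proof (pow2_ge_0 (e x)). pose proof (pow2_ge_0 (u x)).
      assert (e x * u x <= (e x ^ 2 + u x ^ 2) / 2) by lra.
      apply Rle_trans with (sS x * ((e x ^ 2 + u x ^ 2) / 2)).
      { rewrite Rmult_assoc. apply Rmult_le_compat_l; lra. }
      apply Rle_trans with (lam * sT x * ((e x ^ 2 + u x ^ 2) / 2)).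
      { apply Rmult_le_compat_r; lra. }
      right. field. }
  assert (0 <= norm2 u).
  { apply RInt_ge_0; [lra | apply ex_RInt_weighted_sq; auto|].
    intros x hx. destruct (hsig x ltac:(lra)). apply Rmult_le_pos; [lra | apply pow2_ge_0]. }
  nra.
Qed.

(** The weights of the [2 m] values sum to 1, so [U] is their mean and the claim is the
    nonnegativity of their variance. *)
Lemma jensen (c d : nat -> R) :
  psum (fun l => w l * (c l + d l)) m ^ 2 <= psum (fun l => w l * (c l ^ 2 + d l ^ 2)) m.
Proof.
  set (U := psum (fun l => w l * (c l + d l)) m).
  assert (h : 0 <= psum (fun l => w l * ((c l - U) ^ 2 + (d l - U) ^ 2)) m).
  { apply Rle_trans with (psum (fun l => 0 * 0) m).
    - rewrite psum_mull. lra.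
    - apply psum_le. intros l hl. pose proof (wt_pos delta m t hdelta hgrid l hl) as hw.
      pose proof (pow2_ge_0 (c l - U)). pose proof (pow2_ge_0 (d l - U)).
      rewrite Rmult_0_l. apply Rmult_le_pos; lra. }
  rewrite (psum_eq _ (fun l => w l * (c l ^ 2 + d l ^ 2) - ((2 * U) * (w l * (c l + d l)) - (2 * U ^ 2) * w l)))
    in h by (intros; ring).
  rewrite psum_sub, psum_sub, !psum_mull, (psum_wt delta m t hdelta hgrid) in h. fold U in h. lra.
Qed.

(** Each angular error obeys [norm2 <= lam * norm2 e], and by Jensen so does their weighted mean
    [U]. As [e = U + Z], the part of [norm2 e] coming from [U] can be absorbed on the left. *)
Lemma rom_error_energy :
  norm2 e <= 2 / (1 - lam) * (1 + 2 / (1 - lam)) * norm2 Z.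
Proof.
  set (U := fun x => psum (fun l => w l * (el l x + er l x)) m).
  assert (hU : cont_on a b U).
  { apply (cont_on_psum a b (fun l x => w l * (el l x + er l x))); [lra|].
    intros l hl. apply cont_on_mull; [lra|].
    apply cont_on_add; auto using cont_on_el, cont_on_er. lra. }
  assert (hel : forall l, (1 <= l <= m)%nat -> norm2 (el l) <= lam * norm2 e).
  { intros l hl. destruct (velocity_in l hl) as (h1 & _).
    apply angular_error_norm with (mu l); auto using cont_on_el; try lra.
    - intros x hx. apply el_equation; auto.
    - intros _. apply el_b; auto. }
  assert (her : forall l, (1 <= l <= m)%nat -> norm2 (er l) <= lam * norm2 e).
  { intros l hl. destruct (velocity_in l hl) as (h1 & _).
    apply angular_error_norm with (- mu l); auto using cont_on_er; try lra.
    - intros x hx. apply er_equation; auto.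
    - intros _. apply er_a; auto. }
  assert (hUe : norm2 U <= lam * norm2 e).
  { apply Rle_trans with (psum (fun l => w l * (norm2 (el l) + norm2 (er l))) m).
    - assert (hF : forall l, (1 <= l <= m)%nat ->
        ex_RInt (fun x => w l * (sT x * el l x ^ 2 + sT x * er l x ^ 2)) a b).
      { intros l hl. apply ex_RInt_mull, ex_RInt_add; apply ex_RInt_weighted_sq;
          auto using cont_on_el, cont_on_er. }
      destruct (RInt_psum (fun l x => w l * (sT x * el l x ^ 2 + sT x * er l x ^ 2)) a b m hF)
        as [hex heq].
      rewrite (psum_eq _ (fun l => RInt (fun x => w l * (sT x * el l x ^ 2 + sT x * er l x ^ 2)) a b)).
      2: { intros l hl. rewrite RInt_mull, RInt_add;
             auto using ex_RInt_add, ex_RInt_weighted_sq, cont_on_el, cont_on_er. }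
      rewrite <- heq. apply RInt_le; [lra | apply ex_RInt_weighted_sq; auto | exact hex|].
      intros x hx. pose proof (jensen (fun l => el l x) (fun l => er l x)) as hj.
      pose proof (sT_nonneg x ltac:(lra)) as hs.
      rewrite (psum_eq _ (fun l => sT x * (w l * (el l x ^ 2 + er l x ^ 2)))) by (intros; ring).
      rewrite psum_mull. apply Rmult_le_compat_l; auto.
    - apply Rle_trans with (psum (fun l => w l * (2 * (lam * norm2 e))) m).
      + apply psum_le. intros l hl. pose proof (wt_pos delta m t hdelta hgrid l hl).
        specialize (hel l hl). specialize (her l hl). apply Rmult_le_compat_l; lra.
      + rewrite psum_mulr, (psum_wt delta m t hdelta hgrid). lra. }
  (* Weight of Young's inequality for [(U + Z)^2]. This choice gives
     [(1 + eta) * lam <= (1 + lam) / 2 < 1], leaving [(1 - lam) / 2] of [norm2 e] on the left. *)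
  set (eta := (1 - lam) / 2).
  assert (heta : 0 < eta) by (unfold eta; lra).
  assert (h : norm2 e <= (1 + eta) * norm2 U + (1 + / eta) * norm2 Z).
  { rewrite <- !RInt_mull, <- RInt_add;
      auto using ex_RInt_mull, ex_RInt_weighted_sq, cont_on_Z.
    apply RInt_le; [lra | apply ex_RInt_weighted_sq, cont_on_rom_error | |].
    - apply ex_RInt_add; apply ex_RInt_mull; auto using ex_RInt_weighted_sq, cont_on_Z.
    - intros x hx. pose proof (sT_nonneg x ltac:(lra)) as hs. rewrite rom_error_split.
      fold (U x).
      assert (hy : (U x + Z x) ^ 2 <= (1 + eta) * U x ^ 2 + (1 + / eta) * Z x ^ 2).
      { assert (hq : 0 <= / eta * (eta * U x - Z x) ^ 2).
        { apply Rmult_le_pos; [left; apply Rinv_0_lt_compat; auto | apply pow2_ge_0]. }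
        replace (/ eta * (eta * U x - Z x) ^ 2)
          with (eta * U x ^ 2 - 2 * U x * Z x + / eta * Z x ^ 2) in hq by (field; lra). lra. }
      apply Rmult_le_compat_l with (r := sT x) in hy; auto. lra. }
  replace (/ eta) with (2 / (1 - lam)) in h by (unfold eta; field; lra).
  assert (he0 : 0 <= norm2 e).
  { apply RInt_ge_0; [lra | apply ex_RInt_weighted_sq, cont_on_rom_error |].
    intros x hx. apply Rmult_le_pos; [apply sT_nonneg; lra | apply pow2_ge_0]. }
  assert (h2 : norm2 e * ((1 - lam) / 2) <= (1 + 2 / (1 - lam)) * norm2 Z).
  { assert ((1 + eta) * norm2 U <= (1 + eta) * (lam * norm2 e)) by (apply Rmult_le_compat_l; lra).
    assert ((1 + eta) * lam <= (1 + lam) / 2) by (unfold eta; nra).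
    nra. }
  apply Rmult_le_reg_r with ((1 - lam) / 2); [lra|].
  replace (2 / (1 - lam) * (1 + 2 / (1 - lam)) * norm2 Z * ((1 - lam) / 2))
    with ((1 + 2 / (1 - lam)) * norm2 Z) by (field; lra). exact h2.
Qed.

Lemma RInt_rom_kernel_le (x : R) : a <= x <= b -> RInt (fun y => sT y * K x y) a b <= 1.
Proof.
  intros hx. unfold rom_kernel.
  rewrite (RInt_ext_all _ (fun y => psum (fun l => w l *
     (sT y * kappa (Rabs (tau a sT x - tau a sT y)) (/ - mu l))) m)).
  2: { intros y. rewrite <- psum_mull. apply psum_eq. intros l _. ring. }
  assert (hex : forall l, ex_RInt (fun y => sT y * kappa (Rabs (tau a sT x - tau a sT y)) (/ - mu l)) a b).
  { intros l. apply ex_RInt_cont. intros y. apply continuous_mul; auto. apply continuous_kernel_slice. }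
  destruct (RInt_psum (fun l y => w l * (sT y * kappa (Rabs (tau a sT x - tau a sT y)) (/ - mu l)))
    a b m) as [_ ->]; auto using ex_RInt_mull.
  apply Rle_trans with (psum (fun l => w l * 2) m).
  - apply psum_le. intros l hl. pose proof (wt_pos delta m t hdelta hgrid l hl).
    rewrite RInt_mull by auto. apply Rmult_le_compat_l; [lra|].
    destruct (velocity_in l hl) as (h1 & _).
    apply RInt_kappa_le; try lra; auto using sT_nonneg. apply Rinv_0_lt_compat. lra.
  - rewrite psum_mulr, (psum_wt delta m t hdelta hgrid). lra.
Qed.

Lemma rom_kernel_pos (x y : R) : 0 <= K x y.
Proof.
  unfold rom_kernel. apply Rle_trans with (psum (fun l => 0 * 0) m).
  - rewrite psum_mull. lra.
  - apply psum_le. intros l hl. pose proof (wt_pos delta m t hdelta hgrid l hl).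
    rewrite Rmult_0_l. apply Rmult_le_pos; [lra|]. apply kappa_pos.
    destruct (velocity_in l hl) as (h1 & _). left. apply Rinv_0_lt_compat. lra.
Qed.

End Rom.

(** * Contraction and the weighted norm *)

(** Taking the supremum itself for [N] gives [N <= r + lam * N]. The crude bound [M0] only ensures
    that the supremum is finite and does not enter the result. *)
Lemma sup_contraction (Q : R -> Prop) (g : R -> R) (r lam M0 : R) :
  0 <= lam < 1 -> (exists x, Q x) -> (forall x, Q x -> Rabs (g x) <= M0) ->
  (forall N, 0 <= N -> (forall x, Q x -> Rabs (g x) <= N) ->
     forall x, Q x -> Rabs (g x) <= r + lam * N) ->
  forall x, Q x -> Rabs (g x) <= r / (1 - lam).
Proof.
  intros hl [x0 hx0] hb hc x hx.
  destruct (completeness (fun s => exists y, Q y /\ s = Rabs (g y))) as [N [hN1 hN2]].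
  - exists M0. intros s [y [hy ->]]. auto.
  - exists (Rabs (g x0)), x0. auto.
  - assert (hg : forall y, Q y -> Rabs (g y) <= N) by (intros y hy; apply hN1; exists y; auto).
    assert (hN : 0 <= N) by (eapply Rle_trans; [apply Rabs_pos | apply (hg x0 hx0)]).
    assert (h : N <= r + lam * N).
    { apply hN2. intros s [y [hy ->]]. apply hc; auto. }
    apply Rle_trans with N; auto.
    apply Rmult_le_reg_r with (1 - lam); [lra|].
    unfold Rdiv. rewrite Rmult_assoc, Rinv_l, Rmult_1_r by lra. lra.
Qed.

(** The constants do not depend on [s], which makes the variance of the kernel bounded uniformly in
    both positions. *)
Lemma kappa_velocity_lipschitz (delta T : R) : 0 < delta -> 0 <= T ->
  exists M L, 0 <= M /\ 0 <= L /\ forall s, 0 <= s <= T ->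
    (forall u, -1 <= u < - delta -> Rabs (kappa s (/ - u)) <= M) /\
    (forall u v, -1 <= u < - delta -> -1 <= v < - delta ->
       Rabs (kappa s (/ - u) - kappa s (/ - v)) <= L * Rabs (u - v)).
Proof.
  intros hd hT.
  set (D := fun v : R * R => 0 <= fst v <= T /\ -1 <= snd v < - delta).
  set (d := fun (v v' : R * R) r => fst v = fst v' /\ Rabs (snd v - snd v') <= r).
  assert (h : bdd_lip D d (fun v => kappa (fst v) (/ - snd v))).
  { apply bdd_lip_kappa.
    - intros v hv. apply hv.
    - intros v hv. left. apply Rinv_0_lt_compat. destruct hv; lra.
    - exists T, 0. repeat split; auto; try lra.
      + intros v hv. rewrite Rabs_pos_eq; apply hv.
      + intros v v' r _ _ _ [e _]. rewrite e, Rminus_diag, Rabs_R0. lra.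
    - apply bdd_lip_inv with delta; auto; [intros v hv; destruct hv; lra|].
      apply bdd_lip_opp. exists 1, 1. repeat split; try lra.
      + intros v hv. apply Rabs_le. destruct hv; lra.
      + intros v v' r _ _ _ [_ e]. lra. }
  destruct h as (M & L & hM & hL & h1 & h2). exists M, L. repeat split; auto.
  - intros u hu. apply (h1 (s, u)). split; simpl; lra.
  - intros u v hu hv. apply (h2 (s, u) (s, v)); try (split; simpl; lra).
    apply Rabs_pos.
Qed.

Section WeightedL2.
Context (a b : R) (sT sS : R -> R) (lam : R) (hab : a < b) (hlam : 0 < lam < 1)
  (hsT : forall x, continuous sT x) (hsS : forall x, continuous sS x)
  (hsig : forall x, a <= x <= b -> 0 < sS x /\ 0 < sT x /\ sS x <= lam * sT x).

Notation norm2 u := (RInt (fun x => sT x * u x ^ 2) a b).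
Notation mass := (RInt sT a b).

Lemma mass_pos : 0 < mass.
Proof. apply RInt_gt_0; auto. intros x hx. apply hsig. lra. Qed.

Lemma ex_RInt_sT : ex_RInt sT a b.
Proof. apply ex_RInt_cont. auto. Qed.

Lemma norm2_nonneg (u : R -> R) : cont_on a b u -> 0 <= norm2 u.
Proof.
  intros hu. apply RInt_ge_0; [lra | apply ex_RInt_weighted_sq; auto|].
  intros x hx. destruct (hsig x ltac:(lra)). apply Rmult_le_pos; [lra | apply pow2_ge_0].
Qed.

Lemma norm2_le (u : R -> R) (N : R) : cont_on a b u ->
  (forall x, a < x < b -> Rabs (u x) <= N) -> norm2 u <= mass * N ^ 2.
Proof.
  intros hu hN. rewrite Rmult_comm, <- RInt_mull by apply ex_RInt_sT.
  apply RInt_le; [lra | apply ex_RInt_weighted_sq; auto | apply ex_RInt_mull, ex_RInt_sT|].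
  intros x hx. destruct (hsig x ltac:(lra)). rewrite Rmult_comm.
  apply Rmult_le_compat_r; [lra|]. rewrite <- pow2_abs. apply pow_incr.
  split; [apply Rabs_pos | auto].
Qed.

Lemma cont_on_Rabs (u : R -> R) : cont_on a b u -> cont_on a b (fun x => Rabs (u x)).
Proof.
  intros hu. apply cont_on_eq with (fun x => Rabs (u (clamp a b x))).
  { intros x hx. rewrite clamp_id; auto. }
  apply cont_on_of_continuous. intros x.
  apply (continuous_comp (fun x => u (clamp a b x)) Rabs); [|apply continuous_Rabs].
  apply continuous_clamp; auto. lra.
Qed.

Lemma ex_RInt_weighted (u : R -> R) : cont_on a b u -> ex_RInt (fun x => sT x * u x) a b.
Proof.
  intros hu. apply (ex_RInt_cont_on a b); try lra.
  apply cont_on_mul; auto; [lra | apply cont_on_of_continuous; auto].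
Qed.

(* Nonnegativity of the weighted integral of [(|u| - c)^2], where [c] is the
   mean of [|u|]. *)
Lemma cauchy_schwarz (u : R -> R) : cont_on a b u ->
  RInt (fun x => sT x * Rabs (u x)) a b ^ 2 <= mass * norm2 u.
Proof.
  intros hu. pose proof mass_pos as hm. set (I := RInt (fun x => sT x * Rabs (u x)) a b).
  set (c := I / mass).
  assert (hc : cont_on a b (fun x => Rabs (u x) - c)).
  { apply cont_on_sub; [lra | apply cont_on_Rabs; auto |].
    apply cont_on_of_continuous. intros; apply continuous_const. }
  pose proof (norm2_nonneg _ hc) as h.
  rewrite (RInt_ext_all _ (fun x => (sT x * u x ^ 2 - (2 * c) * (sT x * Rabs (u x))) + c ^ 2 * sT x)) in h.
  2: { intros x. rewrite <- (pow2_abs (u x)). ring. }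
  rewrite RInt_add, RInt_sub, !RInt_mull in h;
    auto using ex_RInt_sub, ex_RInt_mull, ex_RInt_weighted_sq, ex_RInt_weighted, cont_on_Rabs, ex_RInt_sT.
  fold I in h. unfold c in h.
  replace (norm2 u - 2 * (I / mass) * I + (I / mass) ^ 2 * mass) with (norm2 u - I ^ 2 / mass) in h
    by (field; lra).
  replace (I ^ 2) with (mass * (I ^ 2 / mass)) by (field; lra).
  apply Rmult_le_compat_l; lra.
Qed.

(** The triangle inequality of the weighted norm: expand [(|v| + r)^2] and apply Cauchy-Schwarz to
    the cross term. *)
Lemma norm_perturbation (u v : R -> R) (r : R) : cont_on a b u -> cont_on a b v -> 0 <= r ->
  (forall x, a <= x <= b -> Rabs (u x - v x) <= r) ->
  sqrt (norm2 u) <= sqrt (norm2 v) + sqrt mass * r.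
Proof.
  intros hu hv hr h. pose proof mass_pos as hm. pose proof (norm2_nonneg v hv) as hv0.
  set (I := RInt (fun x => sT x * Rabs (v x)) a b).
  assert (h1 : norm2 u <= norm2 v + (2 * r) * I + r ^ 2 * mass).
  { unfold I. rewrite <- !RInt_mull, <- !RInt_add;
      auto using ex_RInt_add, ex_RInt_mull, ex_RInt_weighted_sq, ex_RInt_weighted, cont_on_Rabs, ex_RInt_sT.
    apply RInt_le; [lra | apply ex_RInt_weighted_sq; auto |
      auto 10 using ex_RInt_add, ex_RInt_mull, ex_RInt_weighted_sq, ex_RInt_weighted, cont_on_Rabs, ex_RInt_sT|].
    intros x hx. destruct (hsig x ltac:(lra)) as (_ & hs & _). specialize (h x ltac:(lra)).
    assert (hux : u x ^ 2 <= v x ^ 2 + 2 * r * Rabs (v x) + r ^ 2).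
    { replace (v x ^ 2 + 2 * r * Rabs (v x) + r ^ 2) with ((Rabs (v x) + r) ^ 2)
        by (rewrite <- (pow2_abs (v x)); ring).
      rewrite <- (pow2_abs (u x)). apply pow_incr. split; [apply Rabs_pos|].
      pose proof (Rabs_triang_inv (u x) (v x)). lra. }
    apply Rmult_le_compat_l with (r := sT x) in hux; lra. }
  assert (hI : I <= sqrt mass * sqrt (norm2 v)).
  { rewrite <- sqrt_mult by lra. apply Rle_trans with (Rabs I); [apply Rle_abs|].
    rewrite <- sqrt_Rsqr_abs. apply sqrt_le_1_alt. unfold Rsqr.
    replace (I * I) with (I ^ 2) by ring. apply cauchy_schwarz; auto. }
  rewrite <- (sqrt_pow2 (sqrt (norm2 v) + sqrt mass * r)).
  2: { apply Rplus_le_le_0_compat; [apply sqrt_pos | apply Rmult_le_pos; auto using sqrt_pos]. }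
  apply sqrt_le_1_alt. apply Rle_trans with (1 := h1).
  replace ((sqrt (norm2 v) + sqrt mass * r) ^ 2) with
    (sqrt (norm2 v) * sqrt (norm2 v) + 2 * r * (sqrt mass * sqrt (norm2 v))
     + r ^ 2 * (sqrt mass * sqrt mass)) by ring.
  rewrite !sqrt_sqrt by lra.
  assert (2 * r * I <= 2 * r * (sqrt mass * sqrt (norm2 v))) by (apply Rmult_le_compat_l; lra).
  lra.
Qed.

(** The kernel has mass at most 1 against [sT]; replacing [sT] by [sS <= lam * sT] gains the factor
    [lam]. *)
Lemma kernel_contraction (k g : R -> R) (N : R) : 0 <= N -> (forall y, 0 <= k y) ->
  ex_RInt (fun y => sT y * k y) a b -> RInt (fun y => sT y * k y) a b <= 1 ->
  (forall y, a < y < b -> Rabs (g y) <= N) -> ex_RInt (fun y => sS y * (g y * k y)) a b ->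
  Rabs (RInt (fun y => sS y * (g y * k y)) a b) <= lam * N.
Proof.
  intros hN hk hex h1 hg hex'.
  assert (hp : forall y, a < y < b ->
    Rabs (sS y * (g y * k y)) <= (lam * N) * (sT y * k y)).
  { intros y hy. destruct (hsig y ltac:(lra)) as (h2 & h3 & h4). specialize (hg y hy).
    specialize (hk y). rewrite !Rabs_mult, (Rabs_pos_eq (sS y)), (Rabs_pos_eq (k y)) by lra.
    replace (lam * N * (sT y * k y)) with ((lam * sT y) * (N * k y)) by ring.
    apply Rmult_le_compat; try lra.
    - apply Rmult_le_pos; auto using Rabs_pos.
    - apply Rmult_le_compat_r; auto. }
  apply Rle_trans with (RInt (fun y => (lam * N) * (sT y * k y)) a b).
  - assert (ha : forall f h, ex_RInt f a b -> ex_RInt h a b ->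
      (forall y, a < y < b -> Rabs (f y) <= h y) -> Rabs (RInt f a b) <= RInt h a b).
    { intros f h hf hh hfh. apply Rabs_le. split.
      - replace (- RInt h a b) with (RInt (fun y => (-1) * h y) a b) by (rewrite RInt_mull by auto; match goal with |- ?p = ?q => change (@eq R p q) end; ring).
        apply RInt_le; auto using ex_RInt_mull; [lra|].
        intros y hy. specialize (hfh y hy). apply Rabs_le_between in hfh. lra.
      - apply RInt_le; auto; [lra|].
        intros y hy. specialize (hfh y hy). apply Rabs_le_between in hfh. lra. }
    apply ha; auto using ex_RInt_mull.
  - rewrite RInt_mull by auto. rewrite <- (Rmult_1_r (lam * N)) at 2.
    apply Rmult_le_compat_l; auto. apply Rmult_le_pos; lra.
Qed.

End WeightedL2.

(** * Estimates in expectation *)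

Section Estimates.
Context (a b delta lam : R) (sigT sigS q psiL psiR : R -> R) (psi : R -> R -> R) (sT sS : R -> R)
  (hab : a < b) (hdelta : 0 < delta < 1) (hlam : 0 < lam < 1)
  (hsT : forall x, continuous sT x) (hsS : forall x, continuous sS x)
  (eT : forall x, a <= x <= b -> sT x = sigT x) (eS : forall x, a <= x <= b -> sS x = sigS x)
  (hsig : forall x, a <= x <= b -> 0 < sS x /\ 0 < sT x /\ sS x <= lam * sT x)
  (hpsi : exact_solution a b delta sigT sigS q psiL psiR psi).
Context (M L : R) (hM : 0 <= M) (hL : 0 <= L)
  (psiM : forall x mu, a <= x <= b -> Sset delta mu -> Rabs (psi x mu) <= M)
  (psiLip : forall x x' mu mu', a <= x <= b -> a <= x' <= b -> same_side delta mu mu' ->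
     Rabs (psi x mu - psi x' mu') <= L * (Rabs (x - x') + Rabs (mu - mu')))
  (phiLip : forall x x', a <= x <= b -> a <= x' <= b ->
     Rabs (phi_exact delta psi x - phi_exact delta psi x') <= L * Rabs (x - x')).
Context (Mk Lk : R) (hMk : 0 <= Mk) (hLk : 0 <= Lk)
  (kappaLip : forall s, 0 <= s <= tau a sT b ->
    (forall u, -1 <= u < - delta -> Rabs (kappa s (/ - u)) <= Mk) /\
    (forall u v, -1 <= u < - delta -> -1 <= v < - delta ->
       Rabs (kappa s (/ - u) - kappa s (/ - v)) <= Lk * Rabs (u - v))).
Context (m : nat) (t : nat -> R) (hgrid : grid delta m t) (Psi : (nat -> R) -> nat -> R -> R)
  (hrom : forall mu, box t 0 m mu ->
     rom_solution a b delta sigT sigS q psiL psiR m t mu (Psi mu)).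
Context (W : R) (hW : forall l, (1 <= l <= m)%nat -> wt delta t l <= W).

Notation phi := (phi_exact delta psi).
Notation e mu := (rom_error delta m t psi (Psi mu)).
Notation Z mu := (sampling_error delta m t psi mu).
Notation K mu := (rom_kernel delta m t (tau a sT) mu).
Notation w := (wt delta t).
Notation norm2 u := (RInt (fun x => sT x * u x ^ 2) a b).
Notation mass := (RInt sT a b).
Notation EE := (Expect t m).
Notation random := (bdd_lip (box t 0 m) (cdist 0 m)).
Notation field := (random_field t m a b).
Notation hlt := (grid_lt delta m t hgrid).

Lemma cont_on_phi : cont_on a b phi.
Proof. apply cont_on_of_lipschitz with L; auto. lra. Qed.

(** For fixed [eps] the velocity [eps * mu l] stays on one side. The factor 2 adds the changes in
    position and in velocity, each at most [r]. *)
Lemma psi_field (l : nat) (eps : R) : (1 <= l <= m)%nat -> eps = 1 \/ eps = -1 ->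
  field (fun mu x => psi x (eps * mu l)).
Proof.
  intros hl heps. exists M, (L * 2). repeat split; auto; [lra | |].
  - intros [mu x] [hmu hx]. simpl in *. apply psiM; auto.
    pose proof (box_velocity delta m t hgrid mu l hmu hl).
    destruct heps as [-> | ->]; [left | right]; lra.
  - intros [mu x] [nu y] r [hmu hx] [hnu hy] hr [hd1 hd2]. simpl in *.
    pose proof (box_velocity delta m t hgrid mu l hmu hl).
    pose proof (box_velocity delta m t hgrid nu l hnu hl).
    eapply Rle_trans; [apply psiLip; auto|].
    + destruct heps as [-> | ->]; [right | left]; lra.
    + rewrite Rmult_assoc. apply Rmult_le_compat_l; auto.
      rewrite <- Rmult_minus_distr_l, Rabs_mult.
      replace (Rabs eps) with 1 by (destruct heps as [-> | ->]; unfold Rabs; destruct (Rcase_abs _); lra).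
      specialize (hd1 l hl). lra.
Qed.

Lemma Z_field : field (fun mu x => Z mu x).
Proof.
  apply bdd_lip_sub.
  - apply (bdd_lip_psum _ _ (fun l p => w l * (psi (snd p) (fst p l) + psi (snd p) (- fst p l)))).
    intros l hl. apply bdd_lip_mull, bdd_lip_add.
    + eapply bdd_lip_eq; [|apply (psi_field l 1 hl); auto].
      intros [mu x] _. simpl. rewrite Rmult_1_l. reflexivity.
    + eapply bdd_lip_eq; [|apply (psi_field l (-1) hl); auto].
      intros [mu x] _. simpl. f_equal. ring.
  - apply (bdd_lip_snd _ _ a b L phi); auto. lra.
Qed.

Lemma K_field : bdd_lip
  (fun p : ((nat -> R) * R) * R => (box t 0 m (fst (fst p)) /\ a <= snd (fst p) <= b) /\ a <= snd p <= b)
  (prod_dist (prod_dist (cdist 0 m)))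
  (fun p => K (fst (fst p)) (snd (fst p)) (snd p)).
Proof.
  destruct (tau_lipschitz a b sT ltac:(lra) hsT) as [T [hT ht]].
  apply (bdd_lip_psum _ _ (fun l p => w l *
    kappa (Rabs (tau a sT (snd (fst p)) - tau a sT (snd p))) (/ - fst (fst p) l))).
  intros l hl. apply bdd_lip_mull, bdd_lip_kappa.
  - intros; apply Rabs_pos.
  - intros [[mu x] y] [[hmu _] _]. simpl in *. left. apply Rinv_0_lt_compat.
    pose proof (box_velocity delta m t hgrid mu l hmu hl). lra.
  - apply bdd_lip_Rabs, bdd_lip_sub.
    + apply (bdd_lip_fst (fun p => box t 0 m (fst p) /\ a <= snd p <= b) (prod_dist (cdist 0 m))
        a b (fun p : (nat -> R) * R => tau a sT (snd p))).
      apply (bdd_lip_snd (box t 0 m) (cdist 0 m) a b T (tau a sT)); auto. lra.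
    + apply (bdd_lip_snd (fun p : (nat -> R) * R => box t 0 m (fst p) /\ a <= snd p <= b)
        (prod_dist (cdist 0 m)) a b T (tau a sT)); auto. lra.
  - apply bdd_lip_inv with delta; [lra | |].
    + intros [[mu x] y] [[hmu _] _]. simpl in *.
      pose proof (box_velocity delta m t hgrid mu l hmu hl). lra.
    + apply bdd_lip_opp. exists 1, 1. repeat split; try lra.
      * intros [[mu x] y] [[hmu _] _]. simpl in *.
        pose proof (box_velocity delta m t hgrid mu l hmu hl). apply Rabs_le. lra.
      * intros [[mu x] y] [[nu x'] y'] r _ _ hr [[hd _] _]. simpl in *.
        specialize (hd l hl). lra.
Qed.

Lemma K_slice_field (x : R) : a <= x <= b -> field (fun mu y => K mu x y).
Proof.
  intros hx.
  apply (bdd_lip_comp _ _ _ _ (fun p : (nat -> R) * R => ((fst p, x), snd p)) 1) with (4 := K_field); [lra | |].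
  - intros [mu y] [h1 h2]. simpl in *. auto.
  - intros [mu y] [nu y'] r _ _ hr [h1 h2]. rewrite Rmult_1_l. simpl in *.
    split; simpl; auto. split; simpl; auto. rewrite Rminus_diag, Rabs_R0. exact hr.
Qed.

Lemma cont_on_e (mu : nat -> R) : box t 0 m mu -> cont_on a b (e mu).
Proof.
  intros hmu. apply (cont_on_rom_error a b delta sigT sigS q psiL psiR psi hab hdelta hpsi cont_on_phi
    m t hgrid mu (Psi mu) hmu (hrom mu hmu)).
Qed.

Lemma continuous_K (mu : nat -> R) (x y : R) : continuous (fun y => K mu x y) y.
Proof.
  assert (h : forall n, continuous (fun y => psum (fun l => w l *
      kappa (Rabs (tau a sT x - tau a sT y)) (/ - mu l)) n) y).
  { induction n as [|n IH]; simpl; [apply continuous_const|].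
    apply continuous_add; auto.
    apply continuous_mul; [apply continuous_const | apply continuous_kernel_slice; auto]. }
  apply h.
Qed.

Lemma ex_RInt_eK (u k : R -> R) : cont_on a b u -> (forall y, continuous k y) ->
  ex_RInt (fun y => sS y * (u (clamp a b y) * k y)) a b.
Proof.
  intros hu hk. apply ex_RInt_cont. intros y.
  apply continuous_mul; auto. apply (continuous_mul (fun y => u (clamp a b y))); auto.
  apply continuous_clamp; auto. lra.
Qed.

Lemma K_contraction (mu : nat -> R) (x N : R) (u : R -> R) : box t 0 m mu -> a <= x <= b ->
  0 <= N -> cont_on a b u -> (forall y, a <= y <= b -> Rabs (u y) <= N) ->
  Rabs (RInt (fun y => sS y * (u (clamp a b y) * K mu x y)) a b) <= lam * N.
Proof.
  intros hmu hx hN hu huN.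
  apply (kernel_contraction a b sT sS lam); auto.
  - intros y. apply (rom_kernel_pos a delta sT hdelta m t hgrid mu hmu).
  - apply ex_RInt_cont. intros y. apply continuous_mul; auto. apply continuous_K.
  - apply (RInt_rom_kernel_le a b delta lam sT sS); auto.
  - intros y hy. apply huN. apply clamp_in. lra.
  - apply ex_RInt_eK; auto. intros y. apply continuous_K.
Qed.

Lemma e_equation (mu : nat -> R) (x : R) : box t 0 m mu -> a <= x <= b ->
  e mu x = RInt (fun y => sS y * (e mu (clamp a b y) * K mu x y)) a b + Z mu x.
Proof.
  intros hmu hx.
  apply (rom_error_equation a b delta lam sigT sigS q psiL psiR psi sT sS hab hdelta hsT hsS
    eT eS hsig hpsi cont_on_phi m t hgrid mu (Psi mu) hmu (hrom mu hmu) x hx).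
Qed.

(** Continuity bounds each [e mu] separately; the contraction then replaces that bound by one in
    terms of [Z], uniform over the box. *)
Lemma e_bounded : exists Me, 0 <= Me /\ forall mu x, box t 0 m mu -> a <= x <= b ->
  Rabs (e mu x) <= Me.
Proof.
  destruct Z_field as (MZ & LZ & hMZ & hLZ & z1 & z2).
  exists (MZ / (1 - lam)). split.
  { apply Rmult_le_pos; auto. left. apply Rinv_0_lt_compat. lra. }
  intros mu x hmu. revert x.
  destruct (cont_on_bounded a b (e mu) ltac:(lra) (cont_on_e mu hmu)) as [M0 [_ hM0]].
  apply sup_contraction with M0; auto; [lra | exists a; lra|].
  intros N hN h x hx. rewrite e_equation by auto.
  eapply Rle_trans; [apply Rabs_triang|].
  pose proof (K_contraction mu x N (e mu) hmu hx hN (cont_on_e mu hmu) h).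
  specialize (z1 (mu, x) (conj hmu hx)). simpl in z1. lra.
Qed.

(** Subtracting two error equations, [e mu - e nu] solves the equation with kernel [K mu] and
    forcing [(K mu - K nu) e nu + Z mu - Z nu], which is Lipschitz in the ordinates; the contraction
    inverts it. In space the regularity is that of [K] and [Z]. *)
Lemma e_field : field (fun mu x => e mu x).
Proof.
  destruct Z_field as (MZ & LZ & hMZ & hLZ & z1 & z2).
  destruct K_field as (MK & LK & hMK & hLK & k1 & k2).
  destruct e_bounded as (Me & hMe & he).
  destruct (cont_on_bounded a b sS ltac:(lra) (cont_on_of_continuous a b sS hsS)) as [B [hB hsB]].
  (* Lipschitz constant of the forcing: the first part for the change of kernel acting on an error
     bounded by [Me], the second for [Z]. *)
  set (C := (b - a) * (B * (Me * LK)) + LZ).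
  assert (hC : 0 <= C).
  { unfold C. apply Rplus_le_le_0_compat; auto.
    apply Rmult_le_pos; [lra | repeat apply Rmult_le_pos; auto]. }
  assert (hint : forall mu nu x x' r, box t 0 m mu -> box t 0 m nu -> a <= x <= b -> a <= x' <= b ->
     0 <= r -> cdist 0 m mu nu r -> Rabs (x - x') <= r ->
     Rabs (RInt (fun y => sS y * (e nu (clamp a b y) * (K mu x y - K nu x' y))) a b
       + (Z mu x - Z nu x')) <= C * r).
  { intros mu nu x x' r hmu hnu hx hx' hr hd hd'.
    eapply Rle_trans; [apply Rabs_triang|]. unfold C. rewrite Rmult_plus_distr_r.
    apply Rplus_le_compat.
    - replace ((b - a) * (B * (Me * LK)) * r) with ((b - a) * (B * (Me * (LK * r)))) by ring.
      apply RInt_Rabs_le; [lra | |].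
      + apply ex_RInt_eK; [apply cont_on_e; auto|]. intros y. apply continuous_sub; apply continuous_K.
      + intros y hy. rewrite !Rabs_mult. rewrite clamp_id by lra.
        apply Rmult_le_compat; auto using Rabs_pos; [apply Rmult_le_pos; apply Rabs_pos | apply hsB; lra|].
        apply Rmult_le_compat; auto using Rabs_pos; [apply he; auto; lra|].
        apply (k2 ((mu, x), y) ((nu, x'), y)); auto.
        * split; [split; auto | simpl; lra].
        * split; [split; auto | simpl; lra].
        * split; simpl; [split; auto | rewrite Rminus_diag, Rabs_R0; auto].
    - apply (z2 (mu, x) (nu, x')); try (split; auto). exact hr. }
  assert (hmuLip : forall mu nu r, box t 0 m mu -> box t 0 m nu -> 0 <= r -> cdist 0 m mu nu r ->
     forall x, a <= x <= b -> Rabs (e mu x - e nu x) <= C * r / (1 - lam)).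
  { intros mu nu r hmu hnu hr hd.
    apply sup_contraction with (Q := fun x => a <= x <= b) (M0 := Me + Me); [lra | exists a; lra | |].
    - intros x hx. eapply Rle_trans; [apply (Rabs_triang (e mu x) (- e nu x))|].
      rewrite Rabs_Ropp. pose proof (he mu x hmu hx). pose proof (he nu x hnu hx). lra.
    - intros N hN h x hx.
      assert (hdiff : cont_on a b (fun y => e mu y - e nu y)).
      { apply cont_on_sub; auto using cont_on_e. lra. }
      pose proof (K_contraction mu x N (fun y => e mu y - e nu y) hmu hx hN hdiff h) as hk.
      pose proof (hint mu nu x x r hmu hnu hx hx hr hd) as hi.
      assert (hi' : Rabs (x - x) <= r) by (rewrite Rminus_diag, Rabs_R0; auto).
      specialize (hi hi').
      rewrite (e_equation mu x), (e_equation nu x) by auto.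
      replace (RInt (fun y => sS y * (e mu (clamp a b y) * K mu x y)) a b + Z mu x -
         (RInt (fun y => sS y * (e nu (clamp a b y) * K nu x y)) a b + Z nu x))
      with ((RInt (fun y => sS y * (e nu (clamp a b y) * (K mu x y - K nu x y))) a b
            + (Z mu x - Z nu x)) +
        RInt (fun y => sS y * ((e mu (clamp a b y) - e nu (clamp a b y)) * K mu x y)) a b).
      + eapply Rle_trans; [apply Rabs_triang|]. lra.
      + assert (h1 : RInt (fun y => sS y * ((e mu (clamp a b y) - e nu (clamp a b y)) * K mu x y)) a b
          = RInt (fun y => sS y * (e mu (clamp a b y) * K mu x y)) a b
            - RInt (fun y => sS y * (e nu (clamp a b y) * K mu x y)) a b).
        { rewrite <- RInt_sub by (apply ex_RInt_eK; auto using cont_on_e, continuous_K).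
          apply RInt_ext_all. intros y. ring. }
        assert (h2 : RInt (fun y => sS y * (e nu (clamp a b y) * (K mu x y - K nu x y))) a b
          = RInt (fun y => sS y * (e nu (clamp a b y) * K mu x y)) a b
            - RInt (fun y => sS y * (e nu (clamp a b y) * K nu x y)) a b).
        { rewrite <- RInt_sub by (apply ex_RInt_eK; auto using cont_on_e, continuous_K).
          apply RInt_ext_all. intros y. ring. }
        rewrite h1, h2. lra. }
  exists Me, (C + C / (1 - lam)). repeat split; auto.
  { apply Rplus_le_le_0_compat; auto. apply Rmult_le_pos; auto. left. apply Rinv_0_lt_compat. lra. }
  - intros [mu x] [hmu hx]. apply he; auto.
  - intros [mu x] [nu x'] r [hmu hx] [hnu hx'] hr [hd hd']. simpl in *.
    replace (e mu x - e nu x') with ((e nu x - e nu x') + (e mu x - e nu x)) by ring.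
    eapply Rle_trans; [apply Rabs_triang|].
    rewrite Rmult_plus_distr_r. apply Rplus_le_compat.
    + pose proof (hint nu nu x x' r hnu hnu hx hx' hr (cdist_refl 0 m nu r hr) hd') as hi.
      rewrite (e_equation nu x), (e_equation nu x') by auto.
      replace (RInt (fun y => sS y * (e nu (clamp a b y) * K nu x y)) a b + Z nu x -
         (RInt (fun y => sS y * (e nu (clamp a b y) * K nu x' y)) a b + Z nu x'))
      with (RInt (fun y => sS y * (e nu (clamp a b y) * (K nu x y - K nu x' y))) a b
            + (Z nu x - Z nu x')); auto.
      assert (h2 : RInt (fun y => sS y * (e nu (clamp a b y) * (K nu x y - K nu x' y))) a b
          = RInt (fun y => sS y * (e nu (clamp a b y) * K nu x y)) a b
            - RInt (fun y => sS y * (e nu (clamp a b y) * K nu x' y)) a b).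
      { rewrite <- RInt_sub by (apply ex_RInt_eK; auto using cont_on_e, continuous_K).
        apply RInt_ext_all. intros y. ring. }
      rewrite h2. lra.
    + replace (C / (1 - lam) * r) with (C * r / (1 - lam)) by (field; lra). apply hmuLip; auto.
Qed.

Lemma psi_pair_regular (x : R) : a <= x <= b ->
  (forall u, -1 <= u < - delta -> Rabs (psi x u + psi x (- u)) <= 2 * M) /\
  (forall u v, -1 <= u < - delta -> -1 <= v < - delta ->
     Rabs (psi x u + psi x (- u) - (psi x v + psi x (- v))) <= (2 * L) * Rabs (u - v)).
Proof.
  intros hx. split.
  - intros u hu. eapply Rle_trans; [apply Rabs_triang|].
    pose proof (psiM x u hx ltac:(left; lra)). pose proof (psiM x (- u) hx ltac:(right; lra)). lra.
  - intros u v hu hv.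
    replace (psi x u + psi x (- u) - (psi x v + psi x (- v)))
      with ((psi x u - psi x v) + (psi x (- u) - psi x (- v))) by ring.
    eapply Rle_trans; [apply Rabs_triang|].
    pose proof (psiLip x x u v hx hx ltac:(right; lra)) as h1.
    pose proof (psiLip x x (- u) (- v) hx hx ltac:(left; lra)) as h2.
    rewrite Rminus_diag, Rabs_R0 in h1, h2.
    replace (- u - - v) with (- (u - v)) in h2 by ring. rewrite Rabs_Ropp in h2. lra.
Qed.

(** The quadrature is unbiased: [wt l] times the mean over cell [l] is the integral over the cell
    divided by [|S|], and the cells tile the negative half. *)
Lemma Expect_flux (x : R) : a <= x <= b ->
  EE (fun mu => psum (fun l => w l * (psi x (mu l) + psi x (- mu l))) m) = phi x.
Proof.
  intros hx. destruct (psi_pair_regular x hx) as [h1 h2].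
  rewrite (Expect_observable delta m t hgrid (fun u => psi x u + psi x (- u))
    (2 * M) (2 * L)) by (auto; lra).
  rewrite (psum_eq _ (fun l => RInt (fun u => psi x u + psi x (- u)) (t (pred l)) (t l) * / (2 * (1 - delta)))).
  2: { intros l hl. unfold avg, wt. pose proof (cell_lt delta m t hgrid l hl). field. lra. }
  rewrite psum_mulr, (RInt_cells delta m t hgrid).
  2: { intros l hl. apply (ex_RInt_cell delta m t hgrid _ (2 * L)); auto. lra. }
  assert (e1 : ex_RInt (psi x) (-1) (- delta)).
  { apply ex_RInt_lipschitz with L; auto; [lra|]. intros u v hu hv.
    pose proof (psiLip x x u v hx hx ltac:(right; lra)) as h.
    rewrite Rminus_diag, Rabs_R0, Rplus_0_l in h. exact h. }
  assert (e2 : ex_RInt (psi x) delta 1).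
  { apply ex_RInt_lipschitz with L; auto; [lra|]. intros u v hu hv.
    pose proof (psiLip x x u v hx hx ltac:(left; lra)) as h.
    rewrite Rminus_diag, Rabs_R0, Rplus_0_l in h. exact h. }
  (* The reflection [u -> - u] turns the mirrored ordinates into the integral over the positive
     half. *)
  assert (e3 : is_RInt (fun u => psi x (- u)) (-1) (- delta) (RInt (psi x) delta 1)).
  { pose proof (is_RInt_comp_opp (psi x) (-1) (- delta) (RInt (psi x) 1 delta)) as h.
    rewrite Ropp_involutive in h. replace (- -1) with 1 in h by ring.
    specialize (h (RInt_correct (psi x) 1 delta (ex_RInt_swap _ _ _ e2))).
    apply is_RInt_opp in h.
    pose proof (opp_RInt_swap (psi x) 1 delta (ex_RInt_swap _ _ _ e2)) as hsw.
    rewrite <- hsw. eapply is_RInt_ext; [|exact h].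
    intros u _. cbv beta. apply (opp_opp (psi x (- u))). }
  unfold phi_exact, fint_S. unfold Rdiv. f_equal.
  rewrite RInt_add; auto.
  - f_equal. apply is_RInt_unique. exact e3.
  - eexists. exact e3.
Qed.

(** The bound of [Expect_observable_variance] for the folded pair [psi x u + psi x (- u)], whose
    Lipschitz constant is [2 * L]. *)
Definition sampling_variance : R := INR m * (2 * (2 * L) * W ^ 2) ^ 2.
Definition kernel_variance : R := INR m * (2 * Lk * W ^ 2) ^ 2.

Lemma Z_mean_var (x : R) : a <= x <= b ->
  EE (fun mu => Z mu x) = 0 /\ EE (fun mu => Z mu x ^ 2) <= sampling_variance.
Proof.
  intros hx. destruct (psi_pair_regular x hx) as [h1 h2]. split.
  - unfold sampling_error.
    rewrite (Expect_sub t m hlt), (Expect_const t m hlt), Expect_flux; auto using bdd_lip_const; [ring|].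
    apply (random_observable delta m t hgrid (fun u => psi x u + psi x (- u)) (2 * M) (2 * L)); auto; lra.
  - pose proof (Expect_observable_variance delta m t hdelta hgrid
      (fun u => psi x u + psi x (- u)) (2 * M) (2 * L) ltac:(lra) ltac:(lra) h1 h2 W hW) as h.
    cbv beta in h. rewrite Expect_flux in h by auto. exact h.
Qed.

Definition mean_kernel (x y : R) : R := EE (fun mu => K mu x y).

Lemma tau_diff (x y : R) : a <= x <= b -> a <= y <= b ->
  0 <= Rabs (tau a sT x - tau a sT y) <= tau a sT b.
Proof.
  intros hx hy. split; [apply Rabs_pos|].
  assert (hp : forall s, a <= s <= b -> 0 <= sT s).
  { intros s hs. destruct (hsig s hs). lra. }
  pose proof (tau_mono a b sT hsT hp a x). pose proof (tau_mono a b sT hsT hp a y).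
  pose proof (tau_mono a b sT hsT hp x b). pose proof (tau_mono a b sT hsT hp y b).
  rewrite tau_a in *. apply Rabs_le. lra.
Qed.

Lemma K_var (x y : R) : a <= x <= b -> a <= y <= b ->
  EE (fun mu => (K mu x y - mean_kernel x y) ^ 2) <= kernel_variance.
Proof.
  intros hx hy. destruct (kappaLip _ (tau_diff x y hx hy)) as [h1 h2].
  apply (Expect_observable_variance delta m t hdelta hgrid
    (fun u => kappa (Rabs (tau a sT x - tau a sT y)) (/ - u)) Mk Lk); auto.
Qed.

Lemma random_norm2_Z : random (fun mu => norm2 (Z mu)).
Proof.
  apply (random_RInt t m a b ltac:(lra) sT hsT (fun mu x => Z mu x ^ 2)); try lra.
  apply (bdd_lip_pow2 _ _ (fun p => Z (fst p) (snd p))), Z_field.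
Qed.

Lemma Expect_norm2_Z : EE (fun mu => norm2 (Z mu)) <= mass * sampling_variance.
Proof.
  assert (hf : field (fun mu x => Z mu x ^ 2)).
  { apply (bdd_lip_pow2 _ _ (fun p => Z (fst p) (snd p))), Z_field. }
  rewrite (Expect_RInt t m hlt a b ltac:(lra) sT hsT (fun mu x => Z mu x ^ 2) hf).
  rewrite Rmult_comm, <- RInt_mull by (apply ex_RInt_cont; auto).
  apply RInt_le; [lra | apply (ex_RInt_Expect t m hlt a b ltac:(lra) sT hsT _ hf); lra |
    apply ex_RInt_mull, ex_RInt_cont; auto |].
  intros x hx. destruct (hsig x ltac:(lra)). rewrite Rmult_comm.
  apply Rmult_le_compat_r; [lra|]. apply Z_mean_var. lra.
Qed.

Definition energy_const : R := 2 / (1 - lam) * (1 + 2 / (1 - lam)).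

Lemma energy_const_pos : 0 < energy_const.
Proof.
  assert (0 < 2 / (1 - lam)) by (apply Rdiv_lt_0_compat; lra).
  apply Rmult_lt_0_compat; lra.
Qed.

Lemma norm2_e_le (mu : nat -> R) : box t 0 m mu -> norm2 (e mu) <= energy_const * norm2 (Z mu).
Proof.
  intros hmu.
  apply (rom_error_energy a b delta lam sigT sigS q psiL psiR psi sT sS hab hdelta hlam hsT hsS
    eT eS hsig hpsi cont_on_phi m t hgrid mu (Psi mu) hmu (hrom mu hmu)).
Qed.

Lemma L2norm_sT (u : R -> R) : L2norm sigT a b u = sqrt (norm2 u).
Proof.
  unfold L2norm. f_equal. apply RInt_eq; [lra|]. intros x hx. rewrite eT by lra. ring.
Qed.

(** The square root is not Lipschitz at 0, so composing it with [norm2] would fail; the triangle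
    inequality bounds the difference of norms directly. *)
Lemma random_norm_e : random (fun mu => sqrt (norm2 (e mu))).
Proof.
  destruct e_field as (Me & Le & hMe & hLe & h1 & h2).
  exists (sqrt (mass * Me ^ 2)), (sqrt mass * Le). split; [apply sqrt_pos|].
  split; [apply Rmult_le_pos; auto using sqrt_pos|]. split.
  - intros mu hmu. rewrite Rabs_pos_eq by apply sqrt_pos. apply sqrt_le_1_alt.
    apply (norm2_le a b sT sS lam); auto using cont_on_e.
    intros x hx. apply (h1 (mu, x)). split; auto; simpl; lra.
  - intros mu nu r hmu hnu hr hd.
    assert (half : forall mu nu, box t 0 m mu -> box t 0 m nu -> cdist 0 m mu nu r ->
      sqrt (norm2 (e mu)) <= sqrt (norm2 (e nu)) + sqrt mass * (Le * r)).
    { intros mu' nu' hmu' hnu' hd'. apply (norm_perturbation a b sT sS lam); auto using cont_on_e.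
      - apply Rmult_le_pos; auto.
      - intros x hx. apply (h2 (mu', x) (nu', x)); try (split; auto).
        + exact hr.
        + simpl. rewrite Rminus_diag, Rabs_R0. exact hr. }
    assert (hd' : cdist 0 m nu mu r) by (intros l hl; rewrite Rabs_minus_sym; apply hd; auto).
    pose proof (half mu nu hmu hnu hd). pose proof (half nu mu hnu hmu hd').
    apply Rabs_le. lra.
Qed.

(* [sqrt v <= s / 2 + v / (2 s)] replaces Jensen's inequality. *)
Lemma Expect_norm_error (s : R) : 0 < s -> energy_const * (mass * sampling_variance) <= s ^ 2 ->
  EE (fun mu => L2norm sigT a b (fun x => phi_rom delta m t (Psi mu) x - phi x)) <= s.
Proof.
  intros hs hB. pose proof energy_const_pos as hc.
  rewrite (Expect_ext t m hlt _ (fun mu => sqrt (norm2 (e mu)))) by (intros; apply L2norm_sT).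
  apply Rle_trans with (EE (fun mu => s / 2 + energy_const / (2 * s) * norm2 (Z mu))).
  - apply (Expect_mono t m hlt); auto using random_norm_e.
    { apply bdd_lip_add; [apply bdd_lip_const | apply bdd_lip_mull, random_norm2_Z]. }
    intros mu hmu. pose proof (norm2_e_le mu hmu) as h.
    pose proof (norm2_nonneg a b sT sS lam hab hsT hsig (e mu) (cont_on_e mu hmu)) as h0.
    set (v := norm2 (e mu)) in *. pose proof (sqrt_sqrt v h0) as hv.
    apply Rle_trans with (s / 2 + v / (2 * s)).
    + apply Rmult_le_reg_r with (2 * s); [lra|].
      replace ((s / 2 + v / (2 * s)) * (2 * s)) with (s * s + v) by (field; lra).
      pose proof (Rle_0_sqr (s - sqrt v)) as hq. unfold Rsqr in hq. lra.
    + apply Rplus_le_compat_l.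
      replace (energy_const / (2 * s) * norm2 (Z mu)) with ((energy_const * norm2 (Z mu)) / (2 * s))
        by (field; lra).
      apply Rmult_le_compat_r; auto. left. apply Rinv_0_lt_compat. lra.
  - rewrite (Expect_add t m hlt), (Expect_const t m hlt), (Expect_mull t m hlt);
      auto using bdd_lip_const, bdd_lip_mull, random_norm2_Z.
    pose proof Expect_norm2_Z as hZ.
    assert (h : energy_const / (2 * s) * EE (fun mu => norm2 (Z mu))
      <= energy_const / (2 * s) * (mass * sampling_variance)).
    { apply Rmult_le_compat_l; auto. left. apply Rdiv_lt_0_compat; [exact hc | lra]. }
    assert (h' : energy_const / (2 * s) * (mass * sampling_variance) <= s / 2).
    { apply Rmult_le_reg_r with (2 * s); [lra|].
      replace (energy_const / (2 * s) * (mass * sampling_variance) * (2 * s))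
        with (energy_const * (mass * sampling_variance)) by (field; lra).
      replace (s / 2 * (2 * s)) with (s ^ 2) by field. exact hB. }
    lra.
Qed.

(** * The bias *)

Notation G x := (EE (fun mu => e mu x)).

(** Half the expected weighted square of the kernel fluctuation plus half that of the error, the
    latter bounded through the energy estimate. *)
Definition bias_const : R := mass * (kernel_variance + energy_const * sampling_variance) / 2.

Lemma mean_kernel_lipschitz (x : R) : a <= x <= b -> exists C, 0 <= C /\
  forall y y', a <= y <= b -> a <= y' <= b ->
  Rabs (mean_kernel x y - mean_kernel x y') <= C * Rabs (y - y').
Proof.
  intros hx. apply (Expect_field_lipschitz t m hlt a b (fun mu y => K mu x y)).
  apply K_slice_field; auto.
Qed.

Lemma mean_kernel_field (x : R) : a <= x <= b -> field (fun _ y => mean_kernel x y).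
Proof.
  intros hx. destruct (mean_kernel_lipschitz x hx) as [C [hC h]].
  apply (bdd_lip_snd _ _ a b C (mean_kernel x)); auto. lra.
Qed.

Lemma correlation_bound (x : R) : a <= x <= b ->
  Rabs (EE (fun mu => RInt (fun y => sS y * ((K mu x y - mean_kernel x y) * e mu y)) a b))
  <= bias_const.
Proof.
  intros hx.
  pose proof (mean_kernel_field x hx) as hKbar. pose proof (K_slice_field x hx) as hKx.
  assert (hD : field (fun mu y => K mu x y - mean_kernel x y)).
  { apply (bdd_lip_sub _ _ (fun p => K (fst p) x (snd p)) (fun p => mean_kernel x (snd p))); auto. }
  assert (hD2 : field (fun mu y => (K mu x y - mean_kernel x y) ^ 2)).
  { apply (bdd_lip_pow2 _ _ (fun p => K (fst p) x (snd p) - mean_kernel x (snd p))); auto. }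
  assert (hDe : field (fun mu y => (K mu x y - mean_kernel x y) * e mu y)).
  { apply (bdd_lip_mul _ _ (fun p => K (fst p) x (snd p) - mean_kernel x (snd p))
      (fun p => e (fst p) (snd p))); [exact hD | exact e_field]. }
  set (H := fun mu => RInt (fun y => sT y * (K mu x y - mean_kernel x y) ^ 2) a b).
  assert (hH : random H).
  { apply (random_RInt t m a b ltac:(lra) sT hsT _ hD2); lra. }
  (* The energy estimate holds for each choice of ordinates, so [norm2 e] is exchanged for [norm2 Z]
     before the expectation is taken. *)
  set (bound := fun mu => / 2 * H mu + energy_const / 2 * norm2 (Z mu)).
  assert (hbound : random bound).
  { apply bdd_lip_add; apply bdd_lip_mull; auto using random_norm2_Z. }
  assert (hI : random (fun mu => RInt (fun y => sS y * ((K mu x y - mean_kernel x y) * e mu y)) a b)).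
  { apply (random_RInt t m a b ltac:(lra) sS hsS _ hDe); lra. }
  assert (hpt : forall mu, box t 0 m mu ->
    Rabs (RInt (fun y => sS y * ((K mu x y - mean_kernel x y) * e mu y)) a b) <= bound mu).
  { intros mu hmu.
    assert (x1 : ex_RInt (fun y => sS y * ((K mu x y - mean_kernel x y) * e mu y)) a b).
    { apply (random_field_ex_RInt t m a b ltac:(lra) sS hsS _ hDe); auto; lra. }
    assert (x2 : ex_RInt (fun y => sT y * (K mu x y - mean_kernel x y) ^ 2) a b).
    { apply (random_field_ex_RInt t m a b ltac:(lra) sT hsT _ hD2); auto; lra. }
    assert (x3 : ex_RInt (fun y => sT y * e mu y ^ 2) a b).
    { apply ex_RInt_weighted_sq; auto using cont_on_e. }
    apply Rle_trans with (/ 2 * H mu + / 2 * norm2 (e mu)).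
    - unfold H. rewrite <- !RInt_mull, <- RInt_add by auto using ex_RInt_mull.
      eapply Rle_trans; [apply abs_RInt_le; [lra | exact x1]|].
      apply RInt_le; [lra | apply ex_RInt_norm; exact x1 | auto using ex_RInt_add, ex_RInt_mull|].
      intros y hy. destruct (hsig y ltac:(lra)) as (s1 & s2 & s3).
      set (k := K mu x y - mean_kernel x y). set (v := e mu y).
      rewrite !Rabs_mult, (Rabs_pos_eq (sS y)) by lra.
      assert (hs : sS y <= sT y) by nra.
      assert (hkv : Rabs k * Rabs v <= / 2 * (k ^ 2 + v ^ 2)).
      { rewrite <- (pow2_abs k), <- (pow2_abs v).
        pose proof (pow2_ge_0 (Rabs k - Rabs v)). lra. }
      apply Rle_trans with (sT y * (Rabs k * Rabs v)).
      + apply Rmult_le_compat_r; auto. apply Rmult_le_pos; apply Rabs_pos.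
      + apply Rle_trans with (sT y * (/ 2 * (k ^ 2 + v ^ 2))); [|right; ring].
        apply Rmult_le_compat_l; lra.
    - unfold bound. pose proof (norm2_e_le mu hmu). lra. }
  assert (hE : EE bound <= bias_const).
  { unfold bound. rewrite (Expect_add t m hlt), !(Expect_mull t m hlt);
      auto using bdd_lip_mull, random_norm2_Z.
    assert (h1 : EE H <= mass * kernel_variance).
    { unfold H. rewrite (Expect_RInt t m hlt a b ltac:(lra) sT hsT _ hD2).
      rewrite (Rmult_comm mass), <- RInt_mull by (apply ex_RInt_cont; auto).
      apply RInt_le; [lra | apply (ex_RInt_Expect t m hlt a b ltac:(lra) sT hsT _ hD2); lra |
        apply ex_RInt_mull, ex_RInt_cont; auto |].
      intros y hy. destruct (hsig y ltac:(lra)). rewrite Rmult_comm.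
      apply Rmult_le_compat_r; [lra|]. apply K_var; lra. }
    pose proof Expect_norm2_Z as h2. pose proof energy_const_pos as hc.
    apply Rmult_le_compat_l with (r := energy_const / 2) in h2; [|lra].
    unfold bias_const. lra. }
  apply Rabs_le. split.
  - replace (- bias_const) with (-1 * bias_const) by ring.
    apply Rle_trans with (-1 * EE bound); [lra|].
    rewrite <- (Expect_mull t m hlt) by auto.
    apply (Expect_mono t m hlt); auto using bdd_lip_mull.
    intros mu hmu. specialize (hpt mu hmu). apply Rabs_le_between in hpt. lra.
  - apply Rle_trans with (EE bound); auto. apply (Expect_mono t m hlt); auto.
    intros mu hmu. specialize (hpt mu hmu). apply Rabs_le_between in hpt. lra.
Qed.

Lemma mean_kernel_pos (x y : R) : a <= x <= b -> a <= y <= b -> 0 <= mean_kernel x y.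
Proof.
  intros hx hy. unfold mean_kernel. rewrite <- (Expect_const t m hlt 0).
  apply (Expect_mono t m hlt); auto using bdd_lip_const.
  - apply (random_field_slice t m a b (fun mu y => K mu x y)); auto using K_slice_field.
  - intros mu hmu. apply (rom_kernel_pos a delta sT hdelta m t hgrid mu hmu).
Qed.

Lemma RInt_mean_kernel_le (x : R) : a <= x <= b ->
  ex_RInt (fun y => sT y * mean_kernel x y) a b /\ RInt (fun y => sT y * mean_kernel x y) a b <= 1.
Proof.
  intros hx. pose proof (K_slice_field x hx) as hK. split.
  - apply (ex_RInt_Expect t m hlt a b ltac:(lra) sT hsT _ hK); lra.
  - unfold mean_kernel.
    rewrite <- (Expect_RInt t m hlt a b ltac:(lra) sT hsT (fun mu y => K mu x y) hK).
    rewrite <- (Expect_const t m hlt 1).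
    apply (Expect_mono t m hlt); auto using bdd_lip_const.
    + apply (random_RInt t m a b ltac:(lra) sT hsT _ hK); lra.
    + intros mu hmu. apply (RInt_rom_kernel_le a b delta lam sT sS); auto.
Qed.

Lemma mean_error_equation (x : R) : a <= x <= b ->
  G x = EE (fun mu => RInt (fun y => sS y * ((K mu x y - mean_kernel x y) * e mu y)) a b)
    + RInt (fun y => sS y * (mean_kernel x y * G y)) a b.
Proof.
  intros hx.
  pose proof (mean_kernel_field x hx) as hKbar. pose proof (K_slice_field x hx) as hKx.
  assert (hDe : field (fun mu y => (K mu x y - mean_kernel x y) * e mu y)).
  { apply (bdd_lip_mul _ _ (fun p => K (fst p) x (snd p) - mean_kernel x (snd p))
      (fun p => e (fst p) (snd p))); [|exact e_field].
    apply (bdd_lip_sub _ _ (fun p => K (fst p) x (snd p)) (fun p => mean_kernel x (snd p))); auto. }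
  assert (hMe : field (fun mu y => mean_kernel x y * e mu y)).
  { apply (bdd_lip_mul _ _ (fun p => mean_kernel x (snd p)) (fun p => e (fst p) (snd p)));
      [exact hKbar | exact e_field]. }
  assert (hZ : random (fun mu => Z mu x)).
  { apply (random_field_slice t m a b (fun mu x => Z mu x)); auto using Z_field. }
  assert (r1 : random (fun mu => RInt (fun y => sS y * ((K mu x y - mean_kernel x y) * e mu y)) a b)).
  { apply (random_RInt t m a b ltac:(lra) sS hsS _ hDe); lra. }
  assert (r2 : random (fun mu => RInt (fun y => sS y * (mean_kernel x y * e mu y)) a b)).
  { apply (random_RInt t m a b ltac:(lra) sS hsS _ hMe); lra. }
  rewrite (Expect_ext t m hlt _ (fun mu =>
    (RInt (fun y => sS y * ((K mu x y - mean_kernel x y) * e mu y)) a b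
     + RInt (fun y => sS y * (mean_kernel x y * e mu y)) a b) + Z mu x)).
  2: { intros mu hmu. rewrite e_equation by auto. f_equal. rewrite <- RInt_add.
       - apply RInt_eq; [lra|]. intros y hy. rewrite clamp_id by lra. ring.
       - apply (random_field_ex_RInt t m a b ltac:(lra) sS hsS _ hDe); auto; lra.
       - apply (random_field_ex_RInt t m a b ltac:(lra) sS hsS _ hMe); auto; lra. }
  rewrite (Expect_add t m hlt), (Expect_add t m hlt) by auto using bdd_lip_add.
  destruct (Z_mean_var x hx) as [-> _]. rewrite Rplus_0_r. f_equal.
  rewrite (Expect_RInt t m hlt a b ltac:(lra) sS hsS _ hMe).
  apply RInt_eq; [lra|]. intros y hy. f_equal. apply (Expect_mull t m hlt).
  apply (random_field_slice t m a b (fun mu x => e mu x)); [apply e_field | lra].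
Qed.

(** The correlation term is the forcing of the mean equation, whose deterministic kernel contracts
    the supremum norm by [lam]. *)
Lemma mean_error_bound (x : R) : a <= x <= b -> Rabs (G x) <= bias_const / (1 - lam).
Proof.
  destruct e_bounded as (Me & hMe & he). revert x.
  apply sup_contraction with (Q := fun x => a <= x <= b) (M0 := Me) (g := fun x => G x);
    [lra | exists a; lra | |].
  - intros x hx. apply (Expect_Rabs_le t m hlt); auto.
    apply (random_field_slice t m a b (fun mu x => e mu x)); auto using e_field.
  - intros N hN h x hx. rewrite mean_error_equation by auto.
    eapply Rle_trans; [apply Rabs_triang|].
    apply Rplus_le_compat; [apply correlation_bound; auto|].
    destruct (RInt_mean_kernel_le x hx) as [k1 k2].
    (* Clamping makes the kernel nonnegative and the integrand continuous on the whole line;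
       positivity and continuity of the mean kernel are known only on [[a,b]]. *)
    rewrite (RInt_eq _ (fun y => sS y * (G (clamp a b y) * mean_kernel x (clamp a b y)))); [|lra|].
    2: { intros y hy. rewrite clamp_id by lra. ring. }
    apply (kernel_contraction a b sT sS lam hab hlam hsig (fun y => mean_kernel x (clamp a b y))
      (fun y => G (clamp a b y))); auto.
    + intros y. apply mean_kernel_pos; auto. apply clamp_in. lra.
    + eapply ex_RInt_eq; [lra | | exact k1]. intros y hy. cbv beta. rewrite clamp_id by lra. reflexivity.
    + eapply Rle_trans; [right | exact k2]. apply RInt_eq; [lra|]. intros y hy.
      cbv beta. rewrite clamp_id by lra. reflexivity.
    + intros y hy. apply h. apply clamp_in. lra.
    + apply ex_RInt_cont. intros y. apply continuous_mul; auto.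
      apply (continuous_mul (fun y => G (clamp a b y)) (fun y => mean_kernel x (clamp a b y))).
      * apply (continuous_clamp a b (fun y => G y)); [lra|].
        apply (cont_on_Expect t m hlt a b ltac:(lra) (fun mu x => e mu x)), e_field.
      * apply (continuous_clamp a b (fun y => mean_kernel x y)); [lra|].
        apply (cont_on_Expect t m hlt a b ltac:(lra) (fun mu y => K mu x y)), K_slice_field; auto.
Qed.

Lemma Expect_bias :
  L2norm sigT a b (fun x => EE (fun mu => phi_rom delta m t (Psi mu) x) - phi x)
  <= sqrt mass * (bias_const / (1 - lam)).
Proof.
  assert (hcG : cont_on a b (fun x => G x)).
  { apply (cont_on_Expect t m hlt a b ltac:(lra) (fun mu x => e mu x)), e_field. }
  assert (hb : 0 <= bias_const / (1 - lam)).
  { eapply Rle_trans; [apply Rabs_pos | apply (mean_error_bound a); lra]. }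
  rewrite L2norm_sT. rewrite <- (sqrt_pow2 (bias_const / (1 - lam))) by auto.
  rewrite <- sqrt_mult.
  2: { left. apply (mass_pos a b sT sS lam); auto. }
  2: { apply pow2_ge_0. }
  apply sqrt_le_1_alt.
  apply Rle_trans with (norm2 (fun x => G x)).
  - right. apply RInt_eq; [lra|]. intros x hx. f_equal. f_equal.
    assert (he : random (fun mu => e mu x)).
    { apply (random_field_slice t m a b (fun mu x => e mu x)); [apply e_field | lra]. }
    rewrite <- (Expect_const t m hlt (phi x)).
    rewrite (Expect_ext t m hlt (fun mu => phi_rom delta m t (Psi mu) x) (fun mu => e mu x + phi x)).
    2: { intros mu _. unfold rom_error. ring. }
    rewrite (Expect_add t m hlt) by auto using bdd_lip_const.
    rewrite !(Expect_const t m hlt). ring.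
  - apply (norm2_le a b sT sS lam); auto. intros x hx. apply mean_error_bound. lra.
Qed.

End Estimates.

(** * Choice of the constants and conclusion *)

Lemma ratio_bounds (a b lam : R) (sigT sigS : R -> R) : a < b ->
  cont_on a b sigT -> cont_on a b sigS ->
  (forall x, a <= x <= b -> 0 < sigS x < sigT x) ->
  is_lub (fun r => exists x, a <= x <= b /\ r = sigS x / sigT x) lam ->
  0 < lam < 1 /\ forall x, a <= x <= b -> sigS x <= lam * sigT x.
Proof.
  intros hab hT hS hsig [hub hlub].
  assert (hle : forall x, a <= x <= b -> sigS x <= lam * sigT x).
  { intros x hx. destruct (hsig x hx).
    assert (h : sigS x / sigT x <= lam) by (apply hub; exists x; auto).
    apply Rmult_le_compat_r with (r := sigT x) in h; [|lra].
    unfold Rdiv in h. rewrite Rmult_assoc, Rinv_l, Rmult_1_r in h by lra. exact h. }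
  split; auto. split.
  - specialize (hle a ltac:(lra)). destruct (hsig a ltac:(lra)). nra.
  (* The continuous ratio attains its maximum, where it is less than 1; hence so is the supremum. *)
  - destruct (continuity_ab_maj (fun x => sigS (clamp a b x) / sigT (clamp a b x)) a b ltac:(lra))
      as [c [hc hc']].
    { intros c _. apply continuity_pt_filterlim.
      apply (continuous_mul (fun x => sigS (clamp a b x)) (fun x => / sigT (clamp a b x))).
      - apply continuous_clamp; auto. lra.
      - apply (continuous_comp (fun x => sigT (clamp a b x)) Rinv).
        + apply continuous_clamp; auto. lra.
        + apply (continuous_Rinv (sigT (clamp a b c))).
          destruct (hsig _ (clamp_in a b c ltac:(lra))). lra. }
    apply Rle_lt_trans with (sigS c / sigT c).
    + apply hlub. intros r [x [hx ->]]. specialize (hc x hx). cbv beta in hc.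
      rewrite !clamp_id in hc by auto. exact hc.
    + destruct (hsig c hc'). apply Rmult_lt_reg_r with (sigT c); [lra|].
      unfold Rdiv. rewrite Rmult_assoc, Rinv_l, Rmult_1_r by lra. lra.
Qed.

Lemma Rpower_minus3 (x : R) : 0 < x -> Rpower x (-3) = / x ^ 3.
Proof.
  intros hx. replace (-3) with (- INR 3) by (simpl; ring). rewrite Rpower_Ropp, Rpower_pow; auto.
Qed.

Lemma Rpower_half_sq (x : R) : 0 < x -> Rpower x (-3 / 2) ^ 2 = / x ^ 3.
Proof.
  intros hx. rewrite <- Rpower_minus3 by auto. simpl. rewrite Rmult_1_r, <- Rpower_plus.
  f_equal. field.
Qed.

Lemma ln_ge_1 (x : R) : 3 <= x -> 1 <= ln x.
Proof.
  intros hx. rewrite <- (ln_exp 1). apply ln_le; [apply exp_pos|].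
  pose proof exp_le_3. lra.
Qed.

Theorem theorem4p1
  (xL xR delta lam abar : R) (sigT sigS q psiL psiR : R -> R)
  (psi : R -> R -> R) :
  xL < xR ->
  0 < delta < 1 ->
  cont_on xL xR sigT -> cont_on xL xR sigS -> cont_on xL xR q ->
  (forall x, xL <= x <= xR -> 0 < sigS x < sigT x) ->
  is_lub (fun r => exists x, xL <= x <= xR /\ r = sigS x / sigT x) lam ->
  bdd_lip_on (fun mu => delta < mu <= 1) psiL ->
  bdd_lip_on (fun mu => -1 <= mu < -delta) psiR ->
  exact_solution xL xR delta sigT sigS q psiL psiR psi ->
  exists (n0 : nat) (C : R), (0 < n0)%nat /\ 0 < C /\
  forall (m : nat) (t : nat -> R) (Psi : (nat -> R) -> nat -> R -> R),
    grid delta m t ->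
    (forall l, (1 <= l <= 2 * m)%nat -> INR (2 * m) * omega delta m t l <= abar) ->
    (forall mu, (forall l, (1 <= l <= m)%nat -> t (pred l) <= mu l <= t l) ->
       rom_solution xL xR delta sigT sigS q psiL psiR m t mu (Psi mu)) ->
    (n0 < 2 * m)%nat ->
    Expect t m (fun mu =>
        L2norm sigT xL xR
          (fun x => phi_rom delta m t (Psi mu) x - phi_exact delta psi x))
      <= C * Rpower (INR (2 * m)) (-3/2) * sqrt (ln (INR (2 * m)))
    /\
    L2norm sigT xL xR
      (fun x => Expect t m (fun mu => phi_rom delta m t (Psi mu) x)
                - phi_exact delta psi x)
      <= C * lam * Rpower (INR (2 * m)) (-3) * ln (INR (2 * m)).
Proof.
  intros hab hdelta hT hS hq hsig hlub hpsiL hpsiR hpsi.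
  destruct (ratio_bounds xL xR lam sigT sigS hab hT hS hsig hlub) as [hlam hle].
  set (sT := fun x => sigT (clamp xL xR x)).
  set (sS := fun x => sigS (clamp xL xR x)).
  assert (hsT : forall x, continuous sT x) by (apply continuous_clamp; auto; lra).
  assert (hsS : forall x, continuous sS x) by (apply continuous_clamp; auto; lra).
  assert (eT : forall x, xL <= x <= xR -> sT x = sigT x) by (intros x hx; unfold sT; rewrite clamp_id; auto).
  assert (eS : forall x, xL <= x <= xR -> sS x = sigS x) by (intros x hx; unfold sS; rewrite clamp_id; auto).
  assert (hsig' : forall x, xL <= x <= xR -> 0 < sS x /\ 0 < sT x /\ sS x <= lam * sT x).
  { intros x hx. rewrite eT, eS by auto. destruct (hsig x hx). specialize (hle x hx). lra. }
  destruct (exact_regularity xL xR delta sigT sigS q psiL psiR psi)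
    as (M & L & hM & hL & psiM & psiLip & phiLip); auto.
  assert (htau : 0 <= tau xL sT xR).
  { left. apply (mass_pos xL xR sT sS lam); auto. }
  destruct (kappa_velocity_lipschitz delta (tau xL sT xR)) as (Mk & Lk & hMk & hLk & hk); auto; [lra|].
  pose proof (energy_const_pos lam hlam) as hce.
  pose proof (mass_pos xL xR sT sS lam hab hsT hsig') as hmass.
  set (mass := RInt sT xL xR) in *. set (ce := energy_const lam) in *.
  (* The two variances times [n^3]: insert [m = n / 2] and [W = abar / n]. *)
  set (vZ := 8 * L ^ 2 * abar ^ 4). set (vK := 2 * Lk ^ 2 * abar ^ 4).
  assert (h4 : 0 <= abar ^ 4) by (replace (abar ^ 4) with ((abar ^ 2) ^ 2) by ring; apply pow2_ge_0).
  assert (hvZ : 0 <= vZ) by (unfold vZ; pose proof (pow2_ge_0 L); apply Rmult_le_pos; lra).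
  assert (hvK : 0 <= vK) by (unfold vK; pose proof (pow2_ge_0 Lk); apply Rmult_le_pos; lra).
  set (A1 := ce * (mass * vZ)).
  set (A2 := sqrt mass * (mass * (vK + ce * vZ) / 2 / (1 - lam))).
  assert (hA1 : 0 <= A1) by (apply Rmult_le_pos; [lra | apply Rmult_le_pos; lra]).
  assert (hA2 : 0 <= A2).
  { assert (0 <= ce * vZ) by (apply Rmult_le_pos; lra).
    apply Rmult_le_pos; [apply sqrt_pos|].
    apply Rmult_le_pos; [|left; apply Rinv_0_lt_compat; lra].
    apply Rmult_le_pos; [|lra]. apply Rmult_le_pos; lra. }
  (* The added 1 makes the threshold [s] of [Expect_norm_error] strictly positive. Dividing by [lam]
     supplies the factor [lam] of the bias bound; none of these constants depends on [n]. *)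
  set (C1 := sqrt A1 + 1). set (C2 := A2 / lam).
  assert (hC1 : 1 <= C1) by (unfold C1; pose proof (sqrt_pos A1); lra).
  assert (hC2 : 0 <= C2) by (apply Rmult_le_pos; [auto | left; apply Rinv_0_lt_compat; lra]).
  (* Beyond 3, [n] exceeds [exp 1], so [ln n] and its square root are at least 1. *)
  exists 3%nat, (C1 + C2). split; [lia|]. split; [lra|].
  intros m t Psi hgrid homega hrom hm.
  set (n := INR (2 * m)).
  assert (hn : 4 <= n).
  { unfold n. replace 4 with (INR 4) by (simpl; ring). apply le_INR. lia. }
  assert (hnm : n = 2 * INR m) by (unfold n; rewrite mult_INR; simpl; ring).
  assert (hrom' : forall mu, box t 0 m mu ->
    rom_solution xL xR delta sigT sigS q psiL psiR m t mu (Psi mu)).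
  { intros mu hmu. apply hrom. intros l hl. specialize (hmu l hl). lra. }
  assert (hW : forall l, (1 <= l <= m)%nat -> wt delta t l <= abar / n).
  { intros l hl. pose proof (homega l ltac:(lia)) as h.
    destruct (omega_wt delta m t l hl) as [e _]. rewrite e in h. fold n in h.
    apply Rmult_le_reg_l with n; [lra|]. replace (n * (abar / n)) with abar by (field; lra). exact h. }
  assert (eZ : sampling_variance L m (abar / n) = vZ * / n ^ 3).
  { unfold sampling_variance, vZ. replace (INR m) with (n / 2) by lra. field. lra. }
  assert (eK : kernel_variance Lk m (abar / n) = vK * / n ^ 3).
  { unfold kernel_variance, vK. replace (INR m) with (n / 2) by lra. field. lra. }
  pose proof (ln_ge_1 n ltac:(lra)) as hln.
  assert (hsl : 1 <= sqrt (ln n)) by (rewrite <- sqrt_1; apply sqrt_le_1_alt; exact hln).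
  assert (hp : forall y, 0 < Rpower n y) by (intros; apply exp_pos).
  assert (hn3 : 0 < / n ^ 3) by (apply Rinv_0_lt_compat, pow_lt; lra).
  split.
  - apply Rle_trans with (C1 * Rpower n (-3 / 2)).
    + apply (Expect_norm_error xL xR delta lam sigT sigS q psiL psiR psi sT sS hab hdelta hlam
        hsT hsS eT eS hsig' hpsi M L hM hL psiM psiLip phiLip m t hgrid Psi hrom' (abar / n) hW).
      * apply Rmult_lt_0_compat; [lra | apply hp].
      * fold mass ce. rewrite eZ, Rpow_mult_distr, Rpower_half_sq by lra.
        replace (ce * (mass * (vZ * / n ^ 3))) with (A1 * / n ^ 3) by (unfold A1; ring).
        apply Rmult_le_compat_r; [lra|]. unfold C1. pose proof (sqrt_sqrt A1 hA1).
        pose proof (sqrt_pos A1). nra.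
    + rewrite <- (Rmult_1_r (C1 * Rpower n (-3 / 2))). specialize (hp (-3 / 2)).
      apply Rmult_le_compat; [apply Rmult_le_pos; lra | lra | | exact hsl].
      apply Rmult_le_compat_r; lra.
  - apply Rle_trans with (A2 * / n ^ 3).
    + pose proof (Expect_bias xL xR delta lam sigT sigS q psiL psiR psi sT sS hab hdelta hlam
        hsT hsS eT eS hsig' hpsi M L hM hL psiM psiLip phiLip Mk Lk hMk hLk hk m t hgrid Psi hrom'
        (abar / n) hW) as h.
      unfold bias_const in h. fold mass ce in h. rewrite eZ, eK in h.
      replace (A2 * / n ^ 3) with
        (sqrt mass * (mass * (vK * / n ^ 3 + ce * (vZ * / n ^ 3)) / 2 / (1 - lam))); [exact h|].
      unfold A2. field. split; lra.
    + rewrite Rpower_minus3 by lra. rewrite <- (Rmult_1_r (A2 * / n ^ 3)).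
      apply Rmult_le_compat; [apply Rmult_le_pos; lra | lra | | exact hln].
      apply Rmult_le_compat_r; [lra|].
      replace A2 with (C2 * lam) by (unfold C2; field; lra).
      apply Rmult_le_compat_r; lra.
Qed.
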